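(* Let $f:\{0,1\}^r\to\{0,1\}$ be monotone and non-constant. Every such $f$ falls into exactly one of three regimes. (i) Non-degenerate: $D_0(f)\ne 1$ and $D_1(f)\ne 1$. There are constants $0<c<C<\infty$ depending only on $f$ such that $$cN\bigl(1+\log d_f(s)\bigr)\le \mathbb{E}[T\mid S_0=s]\le CN\bigl(1+\log d_f(s)\bigr)\qquad\text{for all }1\le s\le N-1.$$ In particular $\mathbb{E}[T]=O(N\log N)$ uniformly in the initial state, and $\mathbb{E}[T]=\Theta(N\log N)$ whenever $d_f(s)\ge\varepsilon N$. (ii) Dictator: $D_0(f)=D_1(f)=1$. If $f(x)=x_j$, the chain is the asynchronous voter model on the complete graph. With $p_0=s/N$ and $\mathrm{Ent}(p)=-p\log p-(1-p)\log(1-p)$, $$\mathbb{E}[T\mid S_0=s]=\Theta\bigl(N^2\,\mathrm{Ent}(p_0)\bigr)$$ with absolute constants, uniformly over $N\ge2$ and $1\le s\le N-1$. (iii) Degenerate non-dictator: $\{D_0(f),D_1(f)\}=\{0,1\}$. With $m=m(f)\ge 2$ as defined in the context, $$\max_{1\le s\le N-1}\mathbb{E}[T\mid S_0=s]=\Theta\bigl(N^{2-1/m}\bigr),$$ the lower bound being attained at $s\asymp N^{(m-1)/m}$.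
   Context: Dynamics. Let $r\ge1$. Given $N$ agents and a coordinatewise monotone non-constant $f:\{0,1\}^r\to\{0,1\}$ (so $f(\mathbf 0)=0$ and $f(\mathbf 1)=1$), consider the discrete-time Markov chain $X^{(t)}=(X^{(t)}_1,\dots,X^{(t)}_N)\in\{0,1\}^N$ whose step is: draw $V$ uniform on $[N]=\{1,\dots,N\}$; draw $J_1,\dots,J_r$ i.i.d. uniform on $[N]$, independent of $V$; set $X^{(t+1)}_V=f(X^{(t)}_{J_1},\dots,X^{(t)}_{J_r})$ and leave every other coordinate unchanged. Let $T=\inf\{t: X^{(t)}\text{ is constant}\}$ be the consensus time and $S_t=\#\{i:X_i^{(t)}=1\}$. The count $(S_t)$ is itself a Markov chain, so $\mathbb{E}[T\mid S_0=s]$ depends on the initial state only through $s$. In the asynchronous voter model on the complete graph, at each step a uniformly chosen agent copies the state of a uniformly chosen agent. Notation. $e_i$ is the $i$th standard basis vector of $\{0,1\}^r$; $\mathbf 0,\mathbf 1$ are the all-zeros and all-ones vectors. The endpoint degrees are $D_0(f)=\#\{i:f(e_i)=1\}$ and $D_1(f)=\#\{i:f(\mathbf 1-e_i)=0\}$. A dictator is a function $f(x)=x_j$ for some fixed $j\in[r]$. The dual of $f$ is $f^*(x)=1-f(\mathbf 1-x)$. For non-dictator $f$ (for which at most one of $D_0(f),D_1(f)$ is non-zero), $d_f(s)$ is the number of agents that must change state before the nearest attracting consensus is reached (the endpoint $0$ being attracting iff $D_0(f)=0$, the endpoint $1$ iff $D_1(f)=0$); explicitly, $d_f(s)=\min(s,N-s)$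 if $D_0(f)=D_1(f)=0$; $d_f(s)=N-s$ if $D_0(f)\ge1$; $d_f(s)=s$ if $D_1(f)\ge 1$. A minterm of a monotone Boolean function is a minimal set $B$ of coordinates such that setting the coordinates in $B$ to $1$ and the rest to $0$ gives the value $1$. If $f$ is a non-dictator with $D_0(f)=1$, say $f(e_j)=1$, then $f(x)=x_j\vee\tilde f(x_{-j})$, where the residual rule is $\tilde f(x_{-j})=f(x^{j\to 0})$; here $x_{-j}$ is $x$ with coordinate $j$ deleted and $x^{j\to0}$ is $x$ with coordinate $j$ set to $0$. Then $m(f)$ is the least size of a minterm of $\tilde f$, and every minterm of $\tilde f$ has size at least $2$. If $f$ is a non-dictator with $D_1(f)=1$, then $m(f)$ is defined symmetrically, replacing $f$ by its dual $f^*$. $u\asymp v$ means $c\,v\le u\le C\,v$ with constants $0<c\le C<\infty$ depending only on $f$.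
   Formalization: In (iii), when D_1(f)=1 the lower bound is stated for N-s ≍ N^{(m-1)/m} (the number of zeros) instead of s; the literal claim fails there, e.g. f=x_1∧(x_2∨x_3), where s≍√N gives E[T]=O(N log N), not N^{3/2}. *)

(* Defs.v *)
From mathcomp Require Import all_boot all_order all_algebra.
From mathcomp Require Import all_classical all_reals all_analysis.
Set Implicit Arguments.
Unset Strict Implicit.
Unset Printing Implicit Defensive.
Import Order.TTheory GRing.Theory Num.Theory.

Notation config n := {ffun 'I_n -> bool}.

Section BooleanRules.
Local Open Scope set_scope.

Definition monotone_rule r (f : config r -> bool) : Prop :=
  forall x y : config r, (forall i, x i ==> y i) -> f x ==> f y.

Definition nonconstant_rule r (f : config r -> bool) : Prop :=
  exists x y : config r, f x <> f y.

Definition is_dictator r (f : config r -> bool) : Prop :=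
  exists j : 'I_r, forall x, f x = x j.

Definition indic r (B : {set 'I_r}) : config r := [ffun i => i \in B].

Definition cneg r (x : config r) : config r := [ffun i => ~~ x i].

Definition dual_rule r (f : config r -> bool) : config r -> bool :=
  fun x => ~~ f (cneg x).

Definition D0 r (f : config r -> bool) : nat :=
  #|[pred i : 'I_r | f (indic [set i])]|.

Definition D1 r (f : config r -> bool) : nat :=
  #|[pred i : 'I_r | ~~ f (indic (~: [set i]))]|.

Definition minterm r (g : config r -> bool) (B : {set 'I_r}) : bool :=
  minset (fun A : {set 'I_r} => g (indic A)) B.

(* The value [r] of the empty minimum is never larger than an actual minterm
   size, so this is the least minterm size as soon as a minterm exists. *)
Definition least_minterm_size r (g : config r -> bool) : nat :=
  \big[minn/r]_(B : {set 'I_r} | minterm g B) #|B|.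

(* [y] is a configuration of the coordinates other than [j]; it is extended by
   the value 0 at [j]. *)
Definition residual r (f : config r -> bool) (j : 'I_r) :
    config r.-1 -> bool :=
  fun y => f [ffun i => if unlift j i is Some k then y k else false].

(* Only meaningful when [D0 f = 1], in which case [j] is unique. *)
Definition m0 r (f : config r -> bool) : nat :=
  if [pick j : 'I_r | f (indic [set j])] is Some j
  then least_minterm_size (residual f j) else 0%N.

Definition m_index r (f : config r -> bool) : nat :=
  if D0 f == 1%N then m0 f else m0 (dual_rule f).

Definition nondegenerate_rule r (f : config r -> bool) : Prop :=
  D0 f <> 1%N /\ D1 f <> 1%N.

Definition dictatorial_rule r (f : config r -> bool) : Prop :=
  D0 f = 1%N /\ D1 f = 1%N.

Definition degenerate_rule r (f : config r -> bool) : Prop :=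
  (D0 f = 1%N /\ D1 f = 0%N) \/ (D0 f = 0%N /\ D1 f = 1%N).

(* [d_f(s)] among [N] agents; for a non-dictator at most one of the two
   endpoint degrees is non-zero. *)
Definition attr_dist r (f : config r -> bool) (N s : nat) : nat :=
  if (0 < D0 f)%N then (N - s)%N
  else if (0 < D1 f)%N then s
  else minn s (N - s).

(* For degenerate [f], the number of agents away from the consensus on the
   endpoint whose degree is 1: endpoint 0 if [D0 f = 1], and endpoint 1 (the
   image of 0 under duality) if [D1 f = 1]. *)
Definition degenerate_dist r (f : config r -> bool) (N s : nat) : nat :=
  if D0 f == 1%N then s else (N - s)%N.

End BooleanRules.

Local Open Scope classical_set_scope.
Local Open Scope ring_scope.

Section Dynamics.
Variable R : realType.

Definition update N (x : config N) (v : 'I_N) (b : bool) : config N :=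
  [ffun i => if i == v then b else x i].

Definition rule_kernel r (f : config r -> bool) N (x y : config N) : R :=
  (\sum_(v : 'I_N) \sum_(J : {ffun 'I_r -> 'I_N})
     (update x v (f [ffun k => x (J k)]) == y)%:R) / (N ^ r.+1)%:R.

(* Asynchronous voter model on the complete graph. *)
Definition voter_kernel N (x y : config N) : R :=
  (\sum_(v : 'I_N) \sum_(u : 'I_N) (update x v (x u) == y)%:R) / (N ^ 2)%:R.

(* [X] is a Markov chain with transition matrix [K], of arbitrary initial law;
   the second clause is the Markov property
   [P(X_{t+1} = y | X_0 = x 0, ..., X_t = x t) = K (x t) y]
   with the conditioning multiplied out. *)
Definition markov_chain N (K : config N -> config N -> R)
    d (Omega : measurableType d) (P : probability Omega R)
    (X : nat -> Omega -> config N) : Prop :=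
  (forall t x, measurable (X t @^-1` [set x])) /\
  (forall t (x : nat -> config N) (y : config N),
     P [set w | (forall i, (i <= t)%N -> X i w = x i) /\ X t.+1 w = y] =
     (P [set w | forall i, (i <= t)%N -> X i w = x i] * (K (x t) y)%:E)%E).

Definition ones N (x : config N) : nat := #|[pred i | x i]|.

Definition consensus N (x : config N) : Prop := forall i j, x i = x j.

(* [+oo] on the event that no consensus is ever reached. *)
Definition consensus_time N (Omega : Type) (X : nat -> Omega -> config N)
    (w : Omega) : \bar R :=
  ereal_inf [set (t%:R)%:E | t in [set t : nat | consensus (X t w)]].

Definition starts_at N (Omega : Type) (X : nat -> Omega -> config N) (s : nat)
    : set Omega := [set w | ones (X 0%N w) = s].

Definition cond_mean d (Omega : measurableType d) (P : probability Omega R)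
    (Y : Omega -> \bar R) (A : set Omega) : \bar R :=
  ((\int[P]_(w in A) Y w) * ((fine (P A))^-1)%:E)%E.

Definition mean_consensus_time N d (Omega : measurableType d)
    (P : probability Omega R) (X : nat -> Omega -> config N) (s : nat)
    : \bar R :=
  cond_mean P (consensus_time X) (starts_at X s).

Definition Ent (p : R) : R := - p * ln p - (1 - p) * ln (1 - p).

End Dynamics.
Arguments voter_kernel R {N} x y.
Arguments rule_kernel R {r} f {N} x y.

(* Main.v *)
Require Import Defs.
From mathcomp Require Import all_boot all_order all_algebra.
From mathcomp Require Import all_classical all_reals all_analysis.
From mathcomp Require Import ring lra zify.
Import Order.TTheory GRing.Theory Num.Theory.
Local Open Scope classical_set_scope.
Local Open Scope ring_scope.
Set Implicit Arguments.
Unset Strict Implicit.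
Unset Printing Implicit Defensive.

(** The number of agents with opinion 1 is a birth and death chain. At proportion
    [p = s / N] it rises with probability [(1 - p) F(p)] and drops with probability
    [p (1 - F(p))], where [F(p)] is the probability that the rule outputs 1 on
    independent Bernoulli([p]) opinions ([bern_rule], [rule_kernel_gen]). The drift
    is [F(p) - p] and the noise is of order [p (1 - p)].

    Mean hitting times of such a chain are compared with explicit functions: a
    nonnegative [g] whose one-step mean decrease is at least 1 away from consensus
    bounds the mean consensus time above, and a function vanishing (or negative) at
    both consensus states whose mean decrease is at most 1 bounds it below
    ([mean_time_ubound], [mean_time_lbound]). Both follow from summing the
    probabilities that consensus is not yet reached. Everything then reduces to
    bounds on [F] and a choice of [g] in each regime; exchanging the two opinions
    replaces [f] by its dual and halves the number of cases.

    Dictators. [F(p) = p], and [N ^ 2 Ent(s / N)] has one-step drift between [-2] and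
    [-1/6] ([voter_drift]).

    Both endpoints attracting. [F(p)] is quadratic at both ends, and in between it
    crosses the diagonal once, transversally. This is the theorem of Moore and
    Shannon, in the quantitative form that the log-odds of [F(p)] minus the log-odds
    of [p] increases at a positive rate ([bern_rule_unstable]). It comes from the
    formula of Margulis and Russo for [F'] and an Efron-Stein inequality in which
    the coordinate revealed last contributes its squared influence
    ([bern_rule_var]). The potential is a sum of harmonic numbers at the endpoints
    and minus the logarithm of the squared distance to the unstable point,
    regularised at the diffusive scale [sqrt N] ([two_attractors_time_ubound]).

    One endpoint repelling. If two coordinates can each force the value 1, then
    [F(p) >= 2 p - p ^ 2]; the potential pairs a harmonic number with
    [- ln (s + A)]. For the lower bound, [theta ^ s] is a supermartingale for some
    [theta < 1], so even a single agent escapes from the repelling endpoint with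
    positive probability ([repelling_time_ubound], [repelling_time_lbound]).
    The remaining lower bounds use [time_lbound_harm], valid for every rule.

    Degenerate rules. If [f = x_j \/ f~] then [F(p) - p] is of order
    [p ^ m (1 - p)] ([bern_rule_residual]). Drift and noise balance at
    [s = N ^ (1 - 1 / m)], where the time scale is [N] times that count. A square
    root below this scale and a decreasing rational function above it form a
    supersolution, and a truncated parabola is a subsolution
    ([degenerate_time_ubound], [degenerate_time_lbound]). *)

(** * Expectation under independent Bernoulli opinions *)

Section BernoulliExpectation.
Variable R : realType.
Implicit Types (p : R) (r : nat).

Definition bern_wt p r (y : config r) : R := \prod_k (if y k then p else 1 - p).

Definition bern_mean p r (g : config r -> R) : R :=
  \sum_(y : config r) bern_wt p y * g y.

Definition bern_rule r (f : config r -> bool) p : R :=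
  bern_mean p (fun y => (f y)%:R).

Lemma bern_mean_prod p r (phi : 'I_r -> bool -> R) :
  bern_mean p (fun y => \prod_k phi k (y k)) =
  \prod_k (p * phi k true + (1 - p) * phi k false).
Proof.
transitivity (\prod_k \sum_(b : bool) (if b then p else 1 - p) * phi k b); last first.
  by apply: eq_bigr => k _; rewrite big_bool.
rewrite bigA_distr_bigA; apply: eq_bigr => y _.
by rewrite big_split.
Qed.

Lemma bern_wt_ge0 p r (y : config r) : 0 <= p <= 1 -> 0 <= bern_wt p y.
Proof.
move=> /andP[p0 p1]; apply: prodr_ge0 => k _; case: ifP => _ //.
by rewrite subr_ge0.
Qed.

Lemma eq_bern_mean p r (g h : config r -> R) :
  g =1 h -> bern_mean p g = bern_mean p h.
Proof. by move=> gh; apply: eq_bigr => y _; rewrite gh. Qed.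

Lemma bern_mean_const p r (c : R) : bern_mean p (fun _ : config r => c) = c.
Proof.
have wt1 : bern_mean p (fun _ : config r => 1) = 1.
  rewrite (@eq_bern_mean p r _ (fun y => \prod_k (fun _ _ => 1) k (y k))).
    by rewrite (bern_mean_prod p (fun _ _ => 1)) big1 // => k _; ring.
  by move=> y; rewrite big1.
rewrite -[RHS]mulr1 -[in RHS]wt1 mulr_sumr; apply: eq_bigr => y _.
by rewrite mulr1 mulrC.
Qed.

Lemma ler_bern_mean p r (g h : config r -> R) :
  0 <= p <= 1 -> (forall y, g y <= h y) -> bern_mean p g <= bern_mean p h.
Proof.
by move=> p01 gh; apply: ler_sum => y _; rewrite ler_wpM2l ?bern_wt_ge0.
Qed.

Lemma bern_meanD p r (g h : config r -> R) :
  bern_mean p (fun y => g y + h y) = bern_mean p g + bern_mean p h.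
Proof. by rewrite -big_split /=; apply: eq_bigr => y _; rewrite mulrDr. Qed.

Lemma bern_meanZ p r (c : R) (g : config r -> R) :
  bern_mean p (fun y => c * g y) = c * bern_mean p g.
Proof. by rewrite mulr_sumr; apply: eq_bigr => y _; rewrite mulrCA. Qed.

Lemma bern_meanB p r (g h : config r -> R) :
  bern_mean p (fun y => g y - h y) = bern_mean p g - bern_mean p h.
Proof.
rewrite bern_meanD; congr (_ + _).
under eq_bern_mean do rewrite -mulN1r.
by rewrite bern_meanZ mulN1r.
Qed.

Lemma bern_mean_sum p r (I : Type) (s : seq I) (P : pred I)
    (g : I -> config r -> R) :
  bern_mean p (fun y => \sum_(i <- s | P i) g i y) =
  \sum_(i <- s | P i) bern_mean p (g i).
Proof.
rewrite /bern_mean; under eq_bigr do rewrite mulr_sumr.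
exact: exchange_big.
Qed.

Lemma bern_mean_all p r (B : {set 'I_r}) :
  bern_mean p (fun y => [forall k in B, y k]%:R) = p ^+ #|B|.
Proof.
rewrite (eq_bern_mean p
  (h := fun y => \prod_k (if k \in B then (y k)%:R else 1))); last first.
  move=> y; case: forall_inP => [h|/forall_inP].
    by rewrite big1 // => k _; case: ifP => // /h ->.
  rewrite negb_forall_in => /exists_inP[k kB /negbTE yk].
  by rewrite (bigD1 k) //= kB yk mul0r.
rewrite (bern_mean_prod p (fun k b => if k \in B then b%:R else 1)).
rewrite -prodr_const [RHS]big_mkcond /=; apply: eq_bigr => k _.
by case: ifP => _; ring.
Qed.

Lemma bern_mean_coord p r (i : 'I_r) : bern_mean p (fun y => (y i)%:R) = p.
Proof.
rewrite -[RHS]expr1 -(cards1 i) -bern_mean_all; apply: eq_bern_mean => y.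
by congr (_%:R); congr nat_of_bool; apply/idP/forall_inP => [yi k /set1P->//|->//];
  rewrite inE.
Qed.

Lemma bern_mean_coord2 p r (i j : 'I_r) : i != j ->
  bern_mean p (fun y => (y i && y j)%:R) = p ^+ 2.
Proof.
move=> ij; have <- : #|[set i; j]%SET| = 2%N by rewrite cards2 ij.
rewrite -bern_mean_all; apply: eq_bern_mean => y.
congr (_%:R); congr nat_of_bool; apply/andP/forall_inP => [[yi yj] k|h].
  by rewrite !inE => /orP[] /eqP->.
by rewrite !h // !inE eqxx ?orbT.
Qed.

Lemma cnegK r : involutive (@cneg r).
Proof. by move=> x; apply/ffunP => i; rewrite !ffunE negbK. Qed.

(** Complementing all the coordinates exchanges the weights of 0 and 1. *)
Lemma bern_mean_cneg p r (g : config r -> R) :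
  bern_mean p (fun y => g (cneg y)) = bern_mean (1 - p) g.
Proof.
rewrite /bern_mean (reindex_inj (inv_inj (@cnegK r))); apply: eq_bigr => y _.
rewrite cnegK; congr (_ * _); apply: eq_bigr => k _; rewrite ffunE.
by case: (y k) => //=; ring.
Qed.

Lemma bern_rule_dual r (f : config r -> bool) p :
  bern_rule (dual_rule f) p = 1 - bern_rule f (1 - p).
Proof.
rewrite -{1}(@bern_mean_const (1 - p) r 1) -bern_meanB -bern_mean_cneg.
rewrite /bern_rule; apply: eq_bern_mean => y; rewrite /dual_rule.
by case: (f _) => /=; ring.
Qed.

Lemma bern_rule_ge0 r (f : config r -> bool) p : 0 <= p <= 1 -> 0 <= bern_rule f p.
Proof.
by move=> p01; rewrite -(@bern_mean_const p r 0); apply: ler_bern_mean => // y.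
Qed.

Lemma bern_rule_le1 r (f : config r -> bool) p : 0 <= p <= 1 -> bern_rule f p <= 1.
Proof.
move=> p01; rewrite -(@bern_mean_const p r 1); apply: ler_bern_mean => // y.
by case: (f y); rewrite ?ler01.
Qed.

(** A group of agents in which a proportion [s / N] has opinion 1, sampled with
    replacement, shows [r] independent Bernoulli opinions. *)
Lemma sample_bern_mean N r (x : config N) (g : config r -> R) : (0 < N)%N ->
  \sum_(J : {ffun 'I_r -> 'I_N}) g [ffun k => x (J k)] =
  (N ^ r)%:R * bern_mean ((ones x)%:R / N%:R) g.
Proof.
move=> N0; set p : R := _ / _.
have N0' : N%:R != 0 :> R by rewrite pnatr_eq0 -lt0n.
have onesE b : \sum_(j < N) ((x j == b)%:R : R) = N%:R * (if b then p else 1 - p).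
  have onesT : \sum_(j < N) ((x j)%:R : R) = (ones x)%:R.
    by rewrite -natr_sum /ones -sum1_card [in RHS]big_mkcond; congr (_%:R).
  case: b.
    by under eq_bigr do rewrite eqb_id; rewrite onesT /p [RHS]mulrC divfK.
  transitivity (\sum_(j < N) (1 - (x j)%:R : R)).
    by apply: eq_bigr => j _; case: (x j); rewrite ?subrr ?subr0.
  by rewrite sumrB sumr_const card_ord onesT mulrBr mulr1 /p mulrCA divff // mulr1.
transitivity (\sum_(y : config r) \sum_(J : {ffun 'I_r -> 'I_N})
    (\prod_k (x (J k) == y k)%:R) * g y).
  rewrite exchange_big /=; apply: eq_bigr => J _.
  rewrite (bigD1 [ffun k => x (J k)]) //= big1 ?mul1r.
    rewrite big1 ?addr0 // => y yJ; suff [k kP] : exists k, x (J k) != y k.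
      by rewrite (bigD1 k) //= (negbTE kP) !mul0r.
    apply/existsP; rewrite -negb_forall; apply: contra yJ => /forallP h.
    by apply/eqP/ffunP => k; rewrite ffunE (eqP (h k)).
  by move=> k _; rewrite ffunE eqxx.
rewrite mulr_sumr; apply: eq_bigr => y _; rewrite -mulr_suml mulrA; congr (_ * _).
rewrite -(bigA_distr_bigA (fun k j => (x j == y k)%:R : R)).
under eq_bigr do rewrite onesE.
by rewrite big_split /= prodr_const card_ord natrX.
Qed.

End BernoulliExpectation.

(** * Endpoint degrees and the response polynomial near the endpoints *)

Section RuleBounds.
Variable R : realType.
Implicit Types (p : R) (r : nat).

Lemma monotone_ruleP r (f : config r -> bool) : monotone_rule f ->
  forall x y : config r, (forall i, x i -> y i) -> f x -> f y.
Proof. by move=> mf x y xy; apply/implyP/mf => i; apply/implyP/xy. Qed.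

Lemma rule_set0 r (f : config r -> bool) :
  monotone_rule f -> nonconstant_rule f -> ~~ f (Defs.indic finset.set0).
Proof.
move=> mf [x [y fxy]]; apply/negP => f0; apply: fxy.
by rewrite !(monotone_ruleP mf _ f0) // => i; rewrite ffunE inE.
Qed.

Lemma cneg_indic r (B : {set 'I_r}) : cneg (Defs.indic B) = Defs.indic (~: B)%SET.
Proof. by apply/ffunP => i; rewrite !ffunE inE. Qed.

Lemma dual_monotone r (f : config r -> bool) :
  monotone_rule f -> monotone_rule (dual_rule f).
Proof.
move=> mf x y xy; apply/implyP; apply: contra; apply: (monotone_ruleP mf) => i.
by rewrite !ffunE; apply: contra => xi; have /implyP := xy i; apply.
Qed.

Lemma dual_nonconstant r (f : config r -> bool) :
  nonconstant_rule f -> nonconstant_rule (dual_rule f).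
Proof.
move=> [x [y fxy]]; exists (cneg x), (cneg y).
by rewrite /dual_rule !cnegK => /negb_inj.
Qed.

Lemma D0_dual r (f : config r -> bool) : D0 (dual_rule f) = D1 f.
Proof. by apply: eq_card => i; rewrite !inE /dual_rule cneg_indic. Qed.

Lemma D1_dual r (f : config r -> bool) : D1 (dual_rule f) = D0 f.
Proof. by apply: eq_card => i; rewrite !inE /dual_rule cneg_indic finset.setCK negbK. Qed.

(** Two coordinates witnessing positive endpoint degrees at 0 and at 1 must
    coincide, since otherwise the first unit vector lies below the complement of
    the second. *)
Lemma endpoint_witness_eq r (f : config r -> bool) (i j : 'I_r) :
  monotone_rule f -> f (Defs.indic [set i]%SET) ->
  ~~ f (Defs.indic (~: [set j])%SET) -> i = j.
Proof.
move=> mf fi fj; apply/eqP; apply: contraNT fj => ij.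
apply: (monotone_ruleP mf _ fi) => k; rewrite !ffunE !inE => /eqP->.
exact: ij.
Qed.

Lemma D0_gt0P r (f : config r -> bool) :
  reflect (exists i, f (Defs.indic [set i]%SET)) (0 < D0 f)%N.
Proof.
rewrite /D0; apply: (iffP card_gt0P) => [[i]|[i fi]]; last by exists i; rewrite inE.
by rewrite inE => fi; exists i.
Qed.

Lemma D1_gt0P r (f : config r -> bool) :
  reflect (exists i, ~~ f (Defs.indic (~: [set i])%SET)) (0 < D1 f)%N.
Proof.
rewrite /D1; apply: (iffP card_gt0P) => [[i]|[i fi]]; last by exists i; rewrite inE.
by rewrite inE => fi; exists i.
Qed.

Lemma both_degrees_dictator r (f : config r -> bool) (j : 'I_r) :
  monotone_rule f -> f (Defs.indic [set j]%SET) ->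
  ~~ f (Defs.indic (~: [set j])%SET) -> forall x, f x = x j.
Proof.
move=> mf f1 f0 x; case xj: (x j).
  by apply: (monotone_ruleP mf _ f1) => k; rewrite ffunE inE => /eqP->.
apply: contraNF f0; apply: (monotone_ruleP mf) => k xk; rewrite ffunE !inE.
by apply: contraTneq xk => ->; rewrite xj.
Qed.

Lemma dictator_degrees r (f : config r -> bool) (j : 'I_r) :
  (forall x, f x = x j) -> D0 f = 1%N /\ D1 f = 1%N.
Proof.
move=> fj; rewrite /D0 /D1 -!(card1 j); split; apply: eq_card => i.
  by rewrite !inE fj ffunE inE eq_sym.
by rewrite !inE fj ffunE !inE negbK eq_sym.
Qed.

Lemma both_degrees_eq1 r (f : config r -> bool) : monotone_rule f ->
  (0 < D0 f)%N -> (0 < D1 f)%N -> exists j : 'I_r, forall x, f x = x j.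
Proof.
move=> mf /D0_gt0P[i fi] /D1_gt0P[j fj]; exists j.
have ij := endpoint_witness_eq mf fi fj; rewrite ij in fi.
exact: both_degrees_dictator.
Qed.

Lemma rule_has_one r (f : config r -> bool) x :
  monotone_rule f -> nonconstant_rule f -> f x -> exists i, x i.
Proof.
move=> mf cf fx; apply/existsP; apply: contraNT (rule_set0 mf cf).
rewrite negb_exists => /forallP x0; apply: (monotone_ruleP mf _ fx) => i.
by rewrite (negbTE (x0 i)).
Qed.

Lemma rule_has_two r (f : config r -> bool) x :
  monotone_rule f -> nonconstant_rule f -> D0 f = 0%N -> f x ->
  exists i j, [/\ i != j, x i & x j].
Proof.
move=> mf cf d0 fx; have [i xi] := rule_has_one mf cf fx.
have [j jP] : exists j, (i != j) && x j.
  apply/existsP; rewrite -[X in is_true X]negbK negb_exists; apply/negP => /forallP h.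
  suff : (0 < D0 f)%N by rewrite d0.
  apply/D0_gt0P; exists i; apply: (monotone_ruleP mf _ fx) => k xk.
  rewrite ffunE inE; have := h k; rewrite xk andbT negbK eq_sym; exact.
by exists i, j; case/andP: jP.
Qed.

Lemma natr_bool_le_sum (I : finType) (P : pred I) (b : bool) (c : I -> bool) :
  (b -> exists2 i, P i & c i) -> (b%:R : R) <= \sum_(i | P i) (c i)%:R.
Proof.
case: b => [/(_ isT)[i Pi ci]|_]; last exact: sumr_ge0.
by rewrite (bigD1 i) //= ci lerDl; apply: sumr_ge0.
Qed.

Lemma bern_rule_le_linear r (f : config r -> bool) p :
  monotone_rule f -> nonconstant_rule f -> 0 <= p <= 1 -> bern_rule f p <= r%:R * p.
Proof.
move=> mf cf p01.
apply: (@le_trans _ _ (bern_mean p (fun y : config r => \sum_(i < r) (y i)%:R))).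
  apply: ler_bern_mean => // y; apply: natr_bool_le_sum => fy.
  by have [i yi] := rule_has_one mf cf fy; exists i.
rewrite bern_mean_sum; under eq_bigr do rewrite bern_mean_coord.
by rewrite sumr_const card_ord mulr_natl.
Qed.

Lemma bern_rule_ge_linear r (f : config r -> bool) p :
  monotone_rule f -> nonconstant_rule f -> 0 <= p <= 1 ->
  1 - bern_rule f p <= r%:R * (1 - p).
Proof.
move=> mf cf /andP[p0 p1].
have := @bern_rule_le_linear r (dual_rule f) (1 - p) (dual_monotone mf)
  (dual_nonconstant cf).
rewrite bern_rule_dual (_ : 1 - (1 - p) = p); last by ring.
by apply; rewrite subr_ge0 p1 gerBl p0.
Qed.

(** Without a coordinate able to force the value 1 alone, two coordinates must
    be 1. *)
Lemma bern_rule_le_quadratic r (f : config r -> bool) p :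
  monotone_rule f -> nonconstant_rule f -> D0 f = 0%N -> 0 <= p <= 1 ->
  bern_rule f p <= r%:R ^+ 2 * p ^+ 2.
Proof.
move=> mf cf d0 p01.
apply: (@le_trans _ _ (bern_mean p (fun y : config r =>
   \sum_(ij : 'I_r * 'I_r | ij.1 != ij.2) (y ij.1 && y ij.2)%:R))).
  apply: ler_bern_mean => // y; apply: natr_bool_le_sum => fy.
  by have [i [j [ij yi yj]]] := rule_has_two mf cf d0 fy; exists (i, j) => //=; rewrite yi.
rewrite bern_mean_sum.
apply: (@le_trans _ _ (\sum_(ij : 'I_r * 'I_r) p ^+ 2)).
  rewrite [leRHS](bigID (fun ij => ij.1 != ij.2)) /= -[leLHS]addr0; apply: lerD.
    by apply: ler_sum => -[i j] /= ij; rewrite bern_mean_coord2.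
  by apply: sumr_ge0 => *; rewrite sqr_ge0.
by rewrite sumr_const card_prod card_ord -[leLHS]mulr_natl natrM expr2.
Qed.

Lemma bern_rule_ge_quadratic r (f : config r -> bool) p :
  monotone_rule f -> nonconstant_rule f -> D1 f = 0%N -> 0 <= p <= 1 ->
  1 - bern_rule f p <= r%:R ^+ 2 * (1 - p) ^+ 2.
Proof.
move=> mf cf d1 /andP[p0 p1].
have := @bern_rule_le_quadratic r (dual_rule f) (1 - p) (dual_monotone mf)
  (dual_nonconstant cf).
rewrite bern_rule_dual (_ : 1 - (1 - p) = p); last by ring.
by apply; rewrite ?D0_dual // subr_ge0 p1 gerBl p0.
Qed.

(** Two coordinates each able to force the value 1 make the rule at least their
    disjunction. *)
Lemma bern_rule_ge_or r (f : config r -> bool) p :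
  monotone_rule f -> (2 <= D0 f)%N -> 0 <= p <= 1 -> p * (1 - p) <= bern_rule f p - p.
Proof.
move=> mf d0 p01.
have [i [j [fi fj ij]]] : exists i j, [/\ f (Defs.indic [set i]%SET),
    f (Defs.indic [set j]%SET) & i != j].
  by have /card_gt1P[i [j [fi fj ij]]] := d0; exists i, j; rewrite !inE in fi fj.
have fT k (y : config r) : f (Defs.indic [set k]%SET) -> y k -> f y.
  by move=> fk yk; apply: (monotone_ruleP mf _ fk) => l; rewrite ffunE inE => /eqP->.
suff : bern_mean p (fun y : config r => (y i)%:R + (y j)%:R - (y i && y j)%:R)
    <= bern_rule f p.
  by rewrite bern_meanB bern_meanD !bern_mean_coord bern_mean_coord2 //; lra.
apply: ler_bern_mean => // y.
case yi: (y i); first by rewrite (fT i y) //=; case: (y j) => /=; lra.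
case yj: (y j); first by rewrite (fT j y) //=; lra.
by rewrite /= addr0 subr0.
Qed.

End RuleBounds.

(** * The residual rule in the degenerate case *)

Section ResidualRule.
Variable R : realType.
Implicit Types (p : R) (r : nat).

Lemma minterm_exists r (g : config r -> bool) y :
  g y -> exists2 B : {set 'I_r}, minterm g B & forall k, k \in B -> y k.
Proof.
move=> gy; pose A := [set k | y k]%SET.
have yA : Defs.indic A = y by apply/ffunP => k; rewrite !ffunE inE.
have [|B mB /fintype.subsetP BA] := @minset_exists _ (fun A => g (Defs.indic A)) A.
  by rewrite yA.
by exists B => // k /BA; rewrite inE.
Qed.

Lemma least_minterm_sizeP r (g : config r -> bool) y : g y ->
  exists2 B, minterm g B & #|B| = least_minterm_size g.
Proof.
move=> gy; have [B0 mB0 _] := minterm_exists gy.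
rewrite /least_minterm_size; case: (arg_minnP (fun B : {set 'I_r} => #|B|) mB0) => B mB minB.
exists B => //; apply/eqP; rewrite eqn_leq; apply/andP; split.
  apply: (big_ind (fun k => (#|B| <= k)%N)) => //; first by rewrite -[leqRHS]card_ord max_card.
  by move=> a b Ba Bb; rewrite leq_min Ba.
by rewrite -minEnat -leEnat; apply: bigmin_le_cond.
Qed.

Lemma least_minterm_size_le r (g : config r -> bool) B :
  minterm g B -> (least_minterm_size g <= #|B|)%N.
Proof. by move=> mB; rewrite /least_minterm_size -minEnat -leEnat; apply: bigmin_le_cond. Qed.

Variables (r : nat) (f : config r -> bool) (j : 'I_r).
Hypotheses (mf : monotone_rule f) (cf : nonconstant_rule f).
Hypothesis fj : f (Defs.indic [set j]%SET).

Lemma residual_split (y : config r) :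
  f y = y j || residual f j [ffun k => y (lift j k)].
Proof.
case yj: (y j) => /=.
  by apply: (monotone_ruleP mf _ fj) => k; rewrite ffunE inE => /eqP->.
congr f; apply/ffunP => i; rewrite ffunE; case: unliftP => [k ->|->//].
by rewrite ffunE.
Qed.

Let D0f : D0 f = 1%N -> forall i, f (Defs.indic [set i]%SET) -> i = j.
Proof.
move=> /eqP/card1P[k kP] i fi.
have := kP i; have := kP j; rewrite !inE fi fj => /esym/eqP-> /esym/eqP->.
by [].
Qed.

Lemma residual_minterm_ge2 B :
  D0 f = 1%N -> minterm (residual f j) B -> (2 <= #|B|)%N.
Proof.
move=> d0 mB; have gB : residual f j (Defs.indic B) := minsetp mB;
  case: (ltngtP #|B| 1) => // [|/eqP/cards1P[k Bk]].
  rewrite ltnS leqn0 cards_eq0 => /eqP B0.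
  have := rule_set0 mf cf; rewrite residual_split (_ : [ffun _ => _] = Defs.indic B).
    by rewrite gB orbT.
  by apply/ffunP => i; rewrite !ffunE B0 !inE.
suff /(D0f d0)/eqP : f (Defs.indic [set lift j k]%SET).
  by rewrite eq_sym (negbTE (neq_lift j k)).
rewrite residual_split (_ : [ffun _ => _] = Defs.indic B) ?gB ?orbT //.
by apply/ffunP => i; rewrite !ffunE Bk !inE (inj_eq lift_inj).
Qed.

Let m := least_minterm_size (residual f j).

Lemma bern_mean_block p (B : {set 'I_r.-1}) :
  bern_mean p (fun y : config r => (~~ y j && [forall k in B, y (lift j k)])%:R) =
  p ^+ #|B| * (1 - p).
Proof.
pose B1 : {set 'I_r} := (lift j @: B)%SET.
have cB1 : #|B1| = #|B| by rewrite card_imset //; apply: lift_inj.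
have jB1 : j \notin B1.
  by apply/negP => /imsetP[k _] /eqP; rewrite (negbTE (neq_lift j k)).
have B1E y : [forall k in B, y (lift j k)] = [forall i in B1, y i].
  apply/forall_inP/forall_inP => [h i /imsetP[k kB ->]|h k kB]; first exact: h.
  by apply: h; apply: imset_f.
rewrite (eq_bern_mean p (h := fun y : config r => [forall i in B1, y i]%:R -
  [forall i in (j |: B1)%SET, y i]%:R)).
  by rewrite bern_meanB !bern_mean_all cardsU1 jB1 cB1 exprS; ring.
move=> y; rewrite B1E.
have -> : [forall i in (j |: B1)%SET, y i] = y j && [forall i in B1, y i].
  apply/forall_inP/andP => [h|[yj /forall_inP h] i].
    by split; [apply: h; rewrite setU11|apply/forall_inP => i iB; apply: h; rewrite inE iB orbT].
  by rewrite !inE => /orP[/eqP->|/h].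
by case: (y j) => /=; rewrite ?subrr ?subr0.
Qed.

(** Conditionally on [y j = 0] the rule is the residual rule, which dominates the
    event that a smallest minterm is all 1 and is dominated by the sum of these
    events over all minterms. *)
Lemma bern_rule_residual p : D1 f = 0%N -> 0 <= p <= 1 ->
  p ^+ m * (1 - p) <= bern_rule f p - p <= 2 ^+ r * (p ^+ m * (1 - p)).
Proof.
move=> d1 p01; have /andP[p0 p1] := p01.
have gT : residual f j [ffun=> true].
  have : f (Defs.indic (~: [set j])%SET).
    apply: contra_eqT d1 => fN; rewrite -lt0n; apply/D1_gt0P; by exists j.
  rewrite residual_split ffunE !inE eqxx /= => h; congr (is_true (residual f j _)): h.
  by apply/ffunP => k; rewrite !ffunE !inE eq_sym neq_lift.
have diffE : bern_rule f p - p = bern_mean p (fun y : config r =>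
    (~~ y j && residual f j [ffun k => y (lift j k)])%:R).
  rewrite -[X in _ - X](bern_mean_coord p j) -bern_meanB; apply: eq_bern_mean => y.
  by rewrite residual_split; case: (y j) => /=; rewrite ?subrr ?subr0.
have mono_g B (y : config r) : residual f j (Defs.indic B) ->
    [forall k in B, y (lift j k)] -> residual f j [ffun k => y (lift j k)].
  move=> gB /forall_inP yB; apply: (monotone_ruleP mf _ gB) => i.
  by rewrite !ffunE; case: unliftP => // k _; rewrite !ffunE; apply: yB.
rewrite diffE; apply/andP; split.
  have [B mB mE] := least_minterm_sizeP gT; rewrite /m -mE -bern_mean_block.
  apply: ler_bern_mean => // y; case: (y j) => //=; case yB: [forall k in B, _] => //.
  by rewrite (mono_g B) // (minsetp mB).
apply: (@le_trans _ _ (bern_mean p (fun y : config r =>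
   \sum_(B | minterm (residual f j) B) (~~ y j && [forall k in B, y (lift j k)])%:R))).
  apply: ler_bern_mean => // y; apply: natr_bool_le_sum => /andP[yj gy].
  have [B mB yB] := minterm_exists gy; exists B => //; rewrite yj /=.
  by apply/forall_inP => k kB; have := yB _ kB; rewrite ffunE.
rewrite bern_mean_sum; under eq_bigr do rewrite bern_mean_block.
apply: (@le_trans _ _ (\sum_(B : {set 'I_r.-1}) p ^+ m * (1 - p))).
  rewrite [leRHS](bigID (minterm (residual f j))) /= -[leLHS]addr0; apply: lerD.
    apply: ler_sum => B mB; rewrite ler_wpM2r ?subr_ge0 // ler_wiXn2l //.
    exact: least_minterm_size_le.
  by apply: sumr_ge0 => B _; rewrite mulr_ge0 ?exprn_ge0 ?subr_ge0.
rewrite sumr_const -[leLHS]mulr_natl ler_wpM2r //.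
  by rewrite mulr_ge0 ?exprn_ge0 ?subr_ge0.
rewrite (eq_card (B := powerset [set: 'I_r.-1]%SET)) => [|B]; last by rewrite !inE finset.subsetT.
rewrite card_powerset cardsT card_ord natrX ler_eXn2l ?ltr1n //.
exact: leq_pred.
Qed.

End ResidualRule.

(** * An Efron-Stein inequality with a gain *)

Section MooreShannon.
Variable R : realType.
Implicit Types (p : R) (r : nat).

(** Averaging out one coordinate at a time turns the induction on coordinates into
    one on a sequence, without changing the number of arguments of the rule. *)
Definition cavg p r (i : 'I_r) (g : config r -> R) (y : config r) : R :=
  p * g (update y i true) + (1 - p) * g (update y i false).

Definition cdif r (i : 'I_r) (g : config r -> R) (y : config r) : R :=
  g (update y i true) - g (update y i false).

Definition cavgs p r (l : seq 'I_r) (g : config r -> R) : config r -> R :=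
  foldr (fun i h => cavg p i h) g l.

Lemma updateE r (y : config r) i b k : update y i b k = if k == i then b else y k.
Proof. by rewrite ffunE. Qed.

Lemma update_update r (y : config r) i b c : update (update y i b) i c = update y i c.
Proof. by apply/ffunP => k; rewrite !updateE; case: eqP. Qed.

Lemma updateC r (y : config r) i j b c : i != j ->
  update (update y i b) j c = update (update y j c) i b.
Proof.
move=> ij; apply/ffunP => k; rewrite !updateE; case: (k =P j) => // ->.
by rewrite eq_sym (negbTE ij).
Qed.

Lemma update_id r (y : config r) i : update y i (y i) = y.
Proof. by apply/ffunP => k; rewrite updateE; case: eqP => // ->. Qed.

Lemma eq_cavg p r (i : 'I_r) (g h : config r -> R) :
  g =1 h -> cavg p i g =1 cavg p i h.
Proof. by move=> gh y; rewrite /cavg !gh. Qed.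

Lemma cavgC p r (i j : 'I_r) (g : config r -> R) :
  cavg p i (cavg p j g) =1 cavg p j (cavg p i g).
Proof.
move=> y; have [->//|ij] := eqVneq i j.
by rewrite /cavg !(updateC _ _ _ ij); ring.
Qed.

Lemma cavgs_rem p r (i : 'I_r) (l : seq 'I_r) (g : config r -> R) :
  i \in l -> cavgs p l g =1 cavg p i (cavgs p (rem i l) g).
Proof.
elim: l => //= j l IH; rewrite inE eq_sym; have [->//|ij /= il] := eqVneq j i.
by move=> y; rewrite /= -cavgC; apply: eq_cavg; apply: IH.
Qed.

Lemma ler_cavg p r (i : 'I_r) (g h : config r -> R) y : 0 <= p <= 1 ->
  (forall y, g y <= h y) -> cavg p i g y <= cavg p i h y.
Proof.
move=> /andP[p0 p1] gh.
by rewrite /cavg lerD // ler_wpM2l // subr_ge0.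
Qed.

Lemma ler_cavgs p r (l : seq 'I_r) (g h : config r -> R) y : 0 <= p <= 1 ->
  (forall y, g y <= h y) -> cavgs p l g y <= cavgs p l h y.
Proof. by move=> p01 gh; elim: l y => //= i l IH y; apply: ler_cavg. Qed.

Lemma cavg_sum p r (i : 'I_r) (I : Type) (s : seq I) (c : R) (g : I -> config r -> R) y :
  cavg p i (fun z => c * \sum_(j <- s) g j z) y = c * \sum_(j <- s) cavg p i (g j) y.
Proof.
rewrite /cavg big_split /= -!mulr_sumr; ring.
Qed.

Lemma cavgs_const p r (l : seq 'I_r) (c : R) y : cavgs p l (fun=> c) y = c.
Proof. by elim: l y => //= i l IH y; rewrite /cavg !IH; ring. Qed.

Lemma cavg_update p r (i : 'I_r) (g : config r -> R) y b :
  cavg p i g (update y i b) = cavg p i g y.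
Proof. by rewrite /cavg !update_update. Qed.

Lemma cavgs_update p r (l : seq 'I_r) (i : 'I_r) (g : config r -> R) y b :
  i \in l -> cavgs p l g (update y i b) = cavgs p l g y.
Proof. by move=> il; rewrite !(cavgs_rem _ _ il) cavg_update. Qed.

Lemma cdif_cavgs p r (l : seq 'I_r) (i : 'I_r) (g : config r -> R) : i \notin l ->
  cdif i (cavgs p l g) =1 cavgs p l (cdif i g).
Proof.
elim: l => //= j l IH; rewrite inE negb_or eq_sym => /andP[ji il] y.
rewrite -(eq_cavg p j (IH il)) /cdif /cavg !(updateC _ _ _ ji); ring.
Qed.

Lemma cavgs_cdif p r (l : seq 'I_r) (i : 'I_r) (g : config r -> R) : i \notin l ->
  cavgs p (i :: l) (cdif i g) =1 cdif i (cavgs p l g).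
Proof.
move=> il y; rewrite (cdif_cavgs p g il) /= /cavg -!(cdif_cavgs p g il).
by rewrite /cdif !update_update; ring.
Qed.

Lemma bern_mean_cavg p r (i : 'I_r) (g : config r -> R) :
  bern_mean p (cavg p i g) = bern_mean p g.
Proof.
pose flip (y : config r) := update y i (~~ y i).
have flipK : involutive flip.
  by move=> y; rewrite /flip update_update updateE eqxx negbK update_id.
pose w (y : config r) : R := \prod_(k | k != i) (if y k then p else 1 - p).
have wtE y : bern_wt p y = (if y i then p else 1 - p) * w y by rewrite /bern_wt (bigD1 i).
have wflip y : w (flip y) = w y.
  by apply: eq_bigr => k /negbTE ki; rewrite updateE ki.
have splitE h : bern_mean p h = \sum_(y : config r | y i) w y * cavg p i h y.
  rewrite /bern_mean (bigID (fun y : config r => y i)) /=.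
  rewrite [X in _ + X](reindex_inj (inv_inj flipK)) /=.
  under [X in _ + X]eq_bigl do rewrite updateE eqxx negbK.
  rewrite -big_split /=; apply: eq_bigr => y yi.
  have -> : flip y = update y i false by rewrite /flip yi.
  rewrite !wtE -[w (update y i false)]wflip /flip update_update !updateE eqxx yi /=.
  by rewrite -yi update_id /cavg -yi update_id; ring.
rewrite !splitE; apply: eq_bigr => y _; congr (_ * _).
by rewrite {1}/cavg !cavg_update; ring.
Qed.

(** Averaging over all the coordinates leaves a constant function, and each
    average preserves the mean. *)
Lemma cavgs_enum p r (g : config r -> R) y : cavgs p (enum 'I_r) g y = bern_mean p g.
Proof.
have cst z : cavgs p (enum 'I_r) g z = cavgs p (enum 'I_r) g y.
  suff h (s : seq 'I_r) : (forall k, k \notin s -> z k = y k) ->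
      cavgs p (enum 'I_r) g z = cavgs p (enum 'I_r) g y.
    by apply: (h (enum 'I_r)) => k; rewrite mem_enum.
  elim: s z => [|i s IH] z zy; first by congr (cavgs _ _ _ _); apply/ffunP => k; apply: zy.
  rewrite -(@cavgs_update _ _ _ i g z (y i)) ?mem_enum //; apply: IH => k ks.
  rewrite updateE; case: (k =P i) => [->//|/eqP ki]; apply: zy.
  by rewrite inE negb_or ki.
have meanE (l : seq 'I_r) : bern_mean p (cavgs p l g) = bern_mean p g.
  by elim: l => //= i l <-; rewrite bern_mean_cavg.
by rewrite -(meanE (enum 'I_r)) (eq_bern_mean p cst) bern_mean_const.
Qed.

Definition bern_influence r (f : config r -> bool) (i : 'I_r) p : R :=
  bern_mean p (cdif i (fun y => (f y)%:R)).

Section EfronStein.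
Variables (r : nat) (f : config r -> bool).
Hypothesis mf : monotone_rule f.
Let fR (y : config r) : R := (f y)%:R.

Lemma cdif_rule01 i y : 0 <= cdif i fR y <= 1.
Proof.
rewrite /cdif /fR; case f0: (f (update y i false)); last first.
  by rewrite subr0; case: (f _); rewrite ?lexx ?ler01.
rewrite (monotone_ruleP mf _ f0) ?subrr ?lexx ?ler01 // => k.
by rewrite !updateE; case: ifP.
Qed.

Lemma cavgs_cdif01 p l i y : 0 <= p <= 1 -> 0 <= cavgs p l (cdif i fR) y <= 1.
Proof.
move=> p01; apply/andP; split.
  rewrite -[leLHS](cavgs_const p l 0 y); apply: ler_cavgs => // z.
  by have /andP[] := cdif_rule01 i z.
rewrite -[leRHS](cavgs_const p l 1 y); apply: ler_cavgs => // z.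
by have /andP[] := cdif_rule01 i z.
Qed.

Lemma cavg_var p (i : 'I_r) (A : config r -> R) y :
  cavg p i A y - cavg p i A y ^+ 2 =
  cavg p i (fun z => A z - A z ^+ 2) y + p * (1 - p) * cdif i A y ^+ 2.
Proof. by rewrite /cavg /cdif; ring. Qed.

Lemma efron_stein p (l : seq 'I_r) y : 0 <= p <= 1 -> uniq l ->
  cavgs p l fR y - cavgs p l fR y ^+ 2 <=
  p * (1 - p) * \sum_(j <- l) cavgs p l (cdif j fR) y.
Proof.
move=> p01; elim: l y => [|i l IH] y /=.
  by rewrite big_nil mulr0 /fR; case: (f y); rewrite ?expr1n ?expr0n subrr.
move=> /andP[il ul]; rewrite cavg_var big_cons [leRHS]mulrDr [leLHS]addrC; apply: lerD.
  have /andP[d0 d1] := cavgs_cdif01 l i y p01.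
  rewrite -[cavg _ _ _ _]/(cavgs p (i :: l) (cdif i fR) y) (cavgs_cdif p fR il).
  rewrite (cdif_cavgs p fR il) ler_wpM2l //; last by rewrite expr2 ler_piMl.
  by have /andP[p0 p1] := p01; rewrite mulr_ge0 // subr_ge0.
apply: le_trans (ler_cavg i y p01 (fun z => IH z ul)) _.
by rewrite cavg_sum.
Qed.

(** Revealing coordinate [i] last, its contribution to the variance is the square
    of its influence rather than the influence itself. *)
Lemma bern_rule_var p i : 0 <= p <= 1 ->
  bern_rule f p * (1 - bern_rule f p) <=
  p * (1 - p) * (\sum_j bern_influence f j p
                 - bern_influence f i p * (1 - bern_influence f i p)).
Proof.
move=> p01; pose l := rem i (enum 'I_r); pose y : config r := [ffun=> false].
have ie : i \in enum 'I_r by rewrite mem_enum.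
have ul : uniq l by rewrite rem_uniq ?enum_uniq.
have il : i \notin l by rewrite mem_rem_uniq ?enum_uniq // inE eqxx.
have E g : bern_mean p g = cavg p i (cavgs p l g) y
  by rewrite -(cavgs_enum p g y) (cavgs_rem _ _ ie).
have Ii : bern_influence f i p = cdif i (cavgs p l fR) y.
  by rewrite /bern_influence E -[LHS]/(cavgs p (i :: l) _ y) cavgs_cdif.
have -> : \sum_j bern_influence f j p =
    bern_influence f i p + \sum_(j <- l) bern_influence f j p.
  rewrite -(big_cons 0 +%R i l xpredT (fun j => bern_influence f j p)) -big_enum.
  by apply: perm_big; apply: perm_to_rem.
have -> : bern_rule f p * (1 - bern_rule f p) =
   cavg p i (cavgs p l fR) y - cavg p i (cavgs p l fR) y ^+ 2.
  by rewrite -E /bern_rule -/fR; ring.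
rewrite cavg_var -Ii [X in _ <= _ * X](_ : _ = \sum_(j <- l) bern_influence f j p +
  bern_influence f i p ^+ 2); last by ring.
rewrite [leRHS]mulrDr lerD2r.
apply: le_trans (ler_cavg i y p01 (fun z => efron_stein z p01 ul)) _.
by rewrite cavg_sum; under eq_bigr do rewrite -E.
Qed.

End EfronStein.

End MooreShannon.

(** * The unstable fixed point of a rule with two attracting endpoints *)

Section Russo.
Variable R : realType.
Implicit Types (p : R) (r : nat).

Lemma is_derive_cavgs r (l : seq 'I_r) (g : config r -> R) p y : uniq l ->
  is_derive p 1 (fun q => cavgs q l g y) (\sum_(j <- l) cavgs p l (cdif j g) y).
Proof.
elim: l y => [|i l IH] y /=; first by rewrite big_nil => _; apply: is_derive_cst.
move=> /andP[il ul].
have d1 := IH (update y i true) ul; have d0 := IH (update y i false) ul.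
have -> : (fun q => cavg q i (cavgs q l g) y) =
   id * (fun q => cavgs q l g (update y i true)) +
   (cst 1 - id) * (fun q => cavgs q l g (update y i false)) by [].
apply: is_derive_eq.
rewrite big_cons -[cavg _ _ _ _]/(cavgs p (i :: l) (cdif i g) y) (cavgs_cdif p g il).
rewrite /cavg big_split /= -!mulr_sumr /cdif /GRing.scale /= /cst.
rewrite [(cst 1 - id) p](_ : _ = 1 - p) //; ring.
Qed.

(** The formula of Margulis and Russo. *)
Lemma is_derive_bern_rule r (f : config r -> bool) p :
  is_derive p 1 (bern_rule f : R -> R) (\sum_j bern_influence f j p).
Proof.
pose y : config r := [ffun=> false].
have := @is_derive_cavgs r (enum 'I_r) (fun z => (f z)%:R) p y (enum_uniq _).
rewrite big_enum /=; congr (is_derive _ _ _ _).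
  by apply/funext => q; rewrite cavgs_enum.
by apply: eq_bigr => j _; rewrite cavgs_enum.
Qed.

End Russo.

Section UnstableFixedPoint.
Import numFieldNormedType.Exports.
Variables (R : realType) (r : nat) (f : config r -> bool).
Hypotheses (mf : monotone_rule f) (cf : nonconstant_rule f).
Hypotheses (d0 : D0 f = 0%N) (d1 : D1 f = 0%N).
Implicit Types p : R.
Let F : R -> R := bern_rule f.

Let r_gt0 : (0 < r)%N.
Proof.
case: (posnP r) => // r0; have [x [y]] := cf; case; congr f; apply/ffunP => i.
by have := ltn_ord i; rewrite {2}r0.
Qed.

Let f1 : f (Defs.indic [set: 'I_r]%SET).
Proof.
have := rule_set0 (dual_monotone mf) (dual_nonconstant cf).
by rewrite /dual_rule cneg_indic finset.setC0 negbK.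
Qed.

Lemma bern_rule_ge_exp p : 0 <= p <= 1 -> p ^+ r <= F p.
Proof.
move=> p01; rewrite -[X in _ ^+ X]card_ord -cardsT -bern_mean_all.
apply: ler_bern_mean => // y; case: forall_inP => // yT.
by rewrite (monotone_ruleP mf _ f1) // => k _; apply: yT; rewrite inE.
Qed.

(** With vanishing endpoint degrees no coordinate is pivotal when the others all
    agree, an event of probability at least [2 ^- r]. *)
Lemma bern_influence_le p i : 0 <= p <= 1 -> bern_influence f i p <= 1 - 2 ^- r.
Proof.
move=> /[dup] p01 /andP[p0 p1].
have half : (2^-1 : R) ^+ r = 2 ^- r by rewrite exprVn.
have h2 : (0 : R) <= 2^-1 by lra.
have cd (y : config r) (b : bool) : (forall k, y k = b) ->
    cdif i (fun z => (f z)%:R : R) y = 0.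
  move=> yb; rewrite /cdif; case: b yb => yb.
    have -> : update y i true = Defs.indic [set: 'I_r]%SET.
      by apply/ffunP => k; rewrite updateE ffunE !inE yb; case: eqP.
    have e : Defs.indic (~: [set i])%SET = update y i false.
      by apply/ffunP => k; rewrite updateE ffunE !inE yb; case: eqP.
    case fN : (f (update y i false)); first by rewrite f1 subrr.
    suff : (0 < D1 f)%N by rewrite d1.
    by apply/D1_gt0P; exists i; rewrite e fN.
  have e : Defs.indic [set i]%SET = update y i true.
    by apply/ffunP => k; rewrite updateE ffunE !inE yb; case: eqP.
  case fN : (f (update y i true)).
    suff : (0 < D0 f)%N by rewrite d0.
    by apply/D0_gt0P; exists i; rewrite e fN.
  rewrite (_ : update y i false = Defs.indic finset.set0).
    by rewrite (negbTE (rule_set0 mf cf)) subrr.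
  by apply/ffunP => k; rewrite updateE ffunE !inE yb; case: eqP.
have le1 (y : config r) (b : bool) :
    cdif i (fun z => (f z)%:R : R) y <= 1 - [forall k, y k == b]%:R.
  have /andP[_ c1] := @cdif_rule01 R r f mf i y.
  case: forallP => [yb|_]; last by rewrite subr0.
  by rewrite (cd _ b) ?subrr // => k; apply/eqP.
have [hp|hp] := leP (2^-1) p.
  apply: (@le_trans _ _ (1 - p ^+ r)); last by rewrite lerB // -half lerXn2r ?nnegrE.
  rewrite -[X in _ ^+ X]card_ord -cardsT -bern_mean_all.
  rewrite -[X in X - _](@bern_mean_const R p r 1) -bern_meanB.
  apply: ler_bern_mean => // y; apply: le_trans (le1 y true) _.
  rewrite lerB // ler_nat; case: forall_inP => // yT.
  by rewrite (_ : [forall k, _] = true) //; apply/forallP => k; rewrite yT ?inE.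
apply: (@le_trans _ _ (1 - (1 - p) ^+ r)).
  rewrite -[X in _ ^+ X]card_ord -cardsT -bern_mean_all -bern_mean_cneg.
  rewrite -[X in X - _](@bern_mean_const R p r 1) -bern_meanB.
  apply: ler_bern_mean => // y; apply: le_trans (le1 y false) _.
  rewrite lerB // ler_nat; case: forall_inP => // yT.
  rewrite (_ : [forall k, _] = true) //; apply/forallP => k.
  by have := yT k; rewrite inE ffunE => /(_ isT)/negbTE->.
by rewrite lerB // -half lerXn2r ?nnegrE; lra.
Qed.

Let kappa : R := 2 ^- r / r%:R.

Let kappa_gt0 : 0 < kappa.
Proof. by rewrite divr_gt0 ?ltr0n // invr_gt0 exprn_gt0. Qed.

(** The inequality [F (1 - F) <= p (1 - p) F'] of Moore and Shannon, with a gain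
    obtained by averaging [bern_rule_var] over the coordinate revealed last. *)
Lemma moore_shannon p : 0 <= p <= 1 ->
  (1 + kappa) * (F p * (1 - F p)) <= p * (1 - p) * \sum_j bern_influence f j p.
Proof.
move=> /[dup] p01 /andP[p0 p1].
have I0 j : 0 <= bern_influence f j p.
  rewrite -(@bern_mean_const R p r 0); apply: ler_bern_mean => // y.
  by have /andP[] := @cdif_rule01 R r f mf j y.
set S := \sum_j _; set V := F p * _; set d : R := 2 ^- r.
have S0 : 0 <= S by apply: sumr_ge0.
have pq0 : 0 <= p * (1 - p) by rewrite mulr_ge0 // subr_ge0.
have rV : r%:R * V <= p * (1 - p) * ((r%:R - d) * S).
  have -> : r%:R * V = \sum_(i < r) V by rewrite sumr_const card_ord mulr_natl.
  apply: (@le_trans _ _ (\sum_(i < r) p * (1 - p) * (S - d * bern_influence f i p))).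
    apply: ler_sum => i _; apply: le_trans (bern_rule_var mf i p01) _.
    rewrite ler_wpM2l // lerB // [leRHS]mulrC ler_wpM2r //.
    by have := bern_influence_le i p01; rewrite -/d; lra.
  by rewrite -mulr_sumr sumrB -mulr_sumr sumr_const card_ord mulrBl [r%:R * S]mulr_natl.
have r1 : (1 : R) <= r%:R by rewrite ler1n.
have V0 : 0 <= V by rewrite mulr_ge0 ?subr_ge0 ?bern_rule_ge0 ?bern_rule_le1.
have d0' : 0 < d by rewrite invr_gt0 exprn_gt0.
have d1' : d <= 1 by rewrite invf_le1 ?exprn_gt0 // exprn_ege1 // ler1n.
have kd : kappa * r%:R = d by rewrite /kappa divfK // gt_eqF // ltr0n.
have k0 := kappa_gt0.
have PS0 : 0 <= p * (1 - p) * S by rewrite mulr_ge0.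
have {}rV : V <= (1 - kappa) * (p * (1 - p) * S).
  rewrite -(ler_pM2l (_ : 0 < r%:R)) ?ltr0n //; apply: le_trans rV _.
  by rewrite -kd le_eqVlt; apply/orP; left; apply/eqP; ring.
apply: le_trans (ler_wpM2l _ rV) _; first by lra.
rewrite mulrA -[leRHS]mul1r ler_wpM2r //.
by have := sqr_ge0 kappa; rewrite expr2; lra.
Qed.

Let F01 p : 0 < p < 1 -> 0 < F p < 1.
Proof.
move=> /andP[p0 p1]; have p01 : 0 <= p <= 1 by rewrite !ltW.
apply/andP; split; first by apply: lt_le_trans (bern_rule_ge_exp p01); rewrite exprn_gt0.
have q01 : 0 <= 1 - p <= 1 by apply/andP; split; lra.
rewrite -subr_gt0; apply: (@lt_le_trans _ _ ((1 - p) ^+ r)); first by rewrite exprn_gt0 ?subr_gt0.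
rewrite -[X in _ ^+ X]card_ord -cardsT -bern_mean_all -bern_mean_cneg.
rewrite -[X in X - _](@bern_mean_const R p r 1) -bern_meanB.
apply: ler_bern_mean => // y; case: forall_inP => [yT|_]; last by case: (f y); rewrite /=; lra.
rewrite (_ : y = Defs.indic finset.set0) ?(negbTE (rule_set0 mf cf)) /=; first by lra.
by apply/ffunP => k; have := yT k; rewrite !ffunE !inE => /(_ isT)/negbTE.
Qed.

(* The logarithm of the odds ratio of [F p] to [p], less the growth to be
   proved. *)
Let Phi p : R := ln (F p) - ln (1 - F p) - ln p + ln (1 - p) - 4 * kappa * p.

Let is_derive_Phi p : 0 < p < 1 ->
  is_derive p 1 Phi ((F p)^-1 * (\sum_j bern_influence f j p)
    + (1 - F p)^-1 * (\sum_j bern_influence f j p) - p^-1 - (1 - p)^-1 - 4 * kappa).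
Proof.
move=> /[dup] p01 /andP[p0 p1]; have /andP[F0 F1] := F01 p01.
have dF : is_derive p 1 F _ := is_derive_bern_rule f p.
have d1F : is_derive p 1 (cst 1 - F) (0 - \sum_j bern_influence f j p) by apply: is_deriveB.
have d1p : is_derive p 1 (cst 1 - id : R -> R) (0 - 1) by apply: is_deriveB.
have l1 := is_derive1_ln F0.
have F1' : 0 < (cst 1 - F) p by rewrite /= /cst subr_gt0.
have l2 := is_derive1_ln F1'.
have p1' : 0 < (cst 1 - id) p by rewrite /= /cst subr_gt0.
have l3 := is_derive1_ln p0.
have l4 := is_derive1_ln p1'.
have c1 := @is_derive1_comp _ _ _ _ _ _ l1 dF.
have c2 := @is_derive1_comp _ _ _ _ _ _ l2 d1F.
have c4 := @is_derive1_comp _ _ _ _ _ _ l4 d1p.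
have -> : Phi = ((@ln R) \o F) - ((@ln R) \o (cst 1 - F)) - (@ln R)
    + ((@ln R) \o (cst 1 - id)) - (4 * kappa) *: id.
  by apply/funext => q.
apply: is_derive_eq.
rewrite /GRing.scale /= [(cst 1 - id) p](_ : _ = 1 - p) // [(cst 1 - F) p](_ : _ = 1 - F p) //.
ring.
Qed.

Let Phi_incr (x y : R) : 0 < x -> x <= y -> y < 1 -> Phi x <= Phi y.
Proof.
move=> x0 xy y1.
have sub p : x <= p <= y -> 0 < p < 1.
  by move=> /andP[xp py]; rewrite (lt_le_trans x0 xp) (le_lt_trans py y1).
have sub' p : p \in `]x, y[ -> 0 < p < 1.
  by rewrite in_itv /= => /andP[xp py]; apply: sub; rewrite !ltW.
apply: (@ger0_derive1_ndecr _ Phi x y) => //.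
- by move=> p /sub' p01; have [] := is_derive_Phi p01.
- move=> p /sub' p01; have [_] := is_derive_Phi p01; rewrite derive1E => ->.
  have /andP[p0 p1] := p01; have /andP[F0 F1] := F01 p01.
  have p01' : 0 <= p <= 1 by rewrite !ltW.
  have := moore_shannon p01'; set S := \sum_j _ => MS.
  have q0 : 0 < 1 - p by lra.
  have G0 : 0 < 1 - F p by lra.
  have pq : 0 < p * (1 - p) by rewrite mulr_gt0.
  have FG : 0 < F p * (1 - F p) by rewrite mulr_gt0.
  have h1 : (1 + kappa) / (p * (1 - p)) <= (F p)^-1 * S + (1 - F p)^-1 * S.
    have -> : (F p)^-1 * S + (1 - F p)^-1 * S = S / (F p * (1 - F p)).
      by field; rewrite !gt_eqF.
    by rewrite ler_pdivrMr // mulrAC ler_pdivlMr // [leRHS]mulrC.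
  have h2 : p^-1 + (1 - p)^-1 = 1 / (p * (1 - p)) by field; rewrite !gt_eqF.
  have h3 : 4 * kappa <= kappa / (p * (1 - p)).
    rewrite ler_pdivlMr //; have := sqr_ge0 (2 * p - 1); have := kappa_gt0; nra.
  move: h1; rewrite mulrDl; lra.
- apply: derivable_within_continuous => p; rewrite in_itv /= => /sub p01.
  by have [] := is_derive_Phi p01.
Qed.

Let F_continuous : continuous F.
Proof.
move=> p; apply: differentiable_continuous; apply/derivable1_diffP.
by have [] := is_derive_bern_rule f p.
Qed.

Let fixed_point : exists2 ps : R, 0 < ps < 1 & F ps = ps.
Proof.
have r1 : (1 : R) <= r%:R by rewrite ler1n.
(* The quadratic bounds on [F] give [F p <= p / 2] at [p = e]. *)
set e : R := (2 * r%:R ^+ 2)^-1.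
have e0 : 0 < e by rewrite invr_gt0 mulr_gt0 // exprn_gt0 // ltr0n.
have re : r%:R ^+ 2 * e = 2^-1
  by rewrite /e invfM mulrCA divff ?mulr1 // gt_eqF // exprn_gt0 ?ltr0n.
have e12 : e <= 2^-1.
  by rewrite -re ler_peMl ?exprn_ege1 ?(ltW e0).
have e01 : 0 <= e <= 1 by apply/andP; split; lra.
have e01' : 0 <= 1 - e <= 1 by apply/andP; split; lra.
have Fe := bern_rule_le_quadratic mf cf d0 e01.
have Fe' := bern_rule_ge_quadratic mf cf d1 e01'.
have Fe1 : F e <= e by apply: le_trans Fe _; rewrite expr2 mulrA re; nra.
have Fe2 : 1 - e <= F (1 - e).
  move: Fe'; rewrite (_ : 1 - (1 - e) = e); last by ring.
  by rewrite expr2 mulrA re -/F; nra.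
have eq0 : exists2 c : R, c \in `[e, 1 - e] & (F - id) c = 0.
  apply: IVT; first by lra.
    by apply: continuous_subspaceT => p; apply: cvgB; [apply: F_continuous|apply: cvg_id].
  have b1 : (F - id) e <= 0 by rewrite [(F - id) e](_ : _ = F e - e) // subr_le0.
  have b2 : 0 <= (F - id) (1 - e).
    by rewrite [(F - id) _](_ : _ = F (1 - e) - (1 - e)) // subr_ge0.
  by rewrite ge_min le_max b1 b2 orbT.
have [c] := eq0; rewrite in_itv /= => /andP[ec ce] /eqP; rewrite subr_eq0 => /eqP Fc.
by exists c => //; apply/andP; split; lra.
Qed.

(** The log-odds ratio of [F p] to [p] increases at rate at least [4 kappa] and
    vanishes at a fixed point. *)
Lemma bern_rule_unstable : exists ps c : R, [/\ 0 < ps < 1, 0 < c <= 1 &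
  forall p, 0 <= p <= 1 ->
    c * (p * (1 - p)) * (p - ps) ^+ 2 <= (p - ps) * (F p - p)].
Proof.
have [ps ps01 Fps] := fixed_point; have /andP[ps0 ps1] := ps01.
have k0 := kappa_gt0; set t := 4 * kappa; have t0 : 0 < t by rewrite /t; lra.
exists ps, (t / (1 + t)); split => //.
  apply/andP; split; first by rewrite divr_gt0 //; lra.
  by rewrite ler_pdivrMr; lra.
move=> p /[dup] p01 /andP[]; rewrite le_eqVlt => /predU1P[<- _|p0].
  rewrite !mul0r mulr0 mul0r subr0 (_ : F 0 = 0) ?mulr0 //.
  apply/eqP; rewrite eq_le bern_rule_ge0 ?lexx ?ler01 // andbT.
  have := @bern_rule_le_linear R r f 0 mf cf; rewrite lexx ler01 mulr0; exact.
rewrite le_eqVlt => /predU1P[->|p1].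
  rewrite subrr mulr0 mulr0 mul0r (_ : F 1 = 1) ?subrr ?mulr0 //.
  apply/eqP; rewrite eq_le bern_rule_le1 ?lexx ?ler01 //.
  by have := @bern_rule_ge_exp 1; rewrite lexx ler01 expr1n; exact.
have /andP[F0 F1] : 0 < F p < 1 by apply: F01; rewrite p0.
have q0 : 0 < 1 - p by lra.
have G0 : 0 < 1 - F p by lra.
pose z := (F p * (1 - p)) / ((1 - F p) * p).
have n0 : 0 < F p * (1 - p) by rewrite mulr_gt0.
have m0 : 0 < (1 - F p) * p by rewrite mulr_gt0.
have z0 : 0 < z by rewrite divr_gt0.
have Phip : Phi p = ln z - t * p.
  by rewrite /Phi /z ln_div ?posrE // !lnM ?posrE // /t; ring.
have Phips : Phi ps = - (t * ps) by rewrite /Phi Fps /t; ring.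
have lnz (x : R) : 0 < x -> ln x <= x - 1.
  by move=> x0; have := @le_ln1Dx R (x - 1); rewrite (_ : 1 + (x - 1) = x); [apply; lra|ring].
rewrite -(ler_pM2l (_ : 0 < 1 + t)); last by lra.
have -> : (1 + t) * (t / (1 + t) * (p * (1 - p)) * (p - ps) ^+ 2) =
  t * (p * (1 - p)) * (p - ps) ^+ 2 by field; rewrite gt_eqF //; lra.
have [pps|pps] := leP ps p.
  have h := Phi_incr ps0 pps p1; rewrite Phip Phips in h.
  have {h} : 1 + t * (p - ps) <= z by have := lnz z z0; lra.
  rewrite /z ler_pdivlMr // => h.
  set D := p - ps in h *; have D0 : 0 <= D by rewrite /D; lra.
  set b := F p - p; have Fb : F p = p + b by rewrite /b; ring.
  have h2 : t * D * p * (1 - p) <= b * (1 + t * D * p) by move: h; rewrite Fb; nra.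
  have D1 : D * p <= 1 by rewrite /D; nra.
  have b0 : 0 <= b.
    have : 0 <= b * (1 + t * D * p).
      by apply: le_trans h2; rewrite !mulr_ge0 // ltW.
    by rewrite pmulr_lge0 // ltr_pwDl // !mulr_ge0 // ltW.
  have h3 : t * D * p * (1 - p) <= b * (1 + t).
    apply: le_trans h2 _; rewrite ler_wpM2l // lerD2l -mulrA -[leRHS]mulr1.
    by rewrite ler_wpM2l // ltW.
  have := ler_wpM2l D0 h3; nra.
have h := Phi_incr p0 (ltW pps) ps1; rewrite Phip Phips in h.
have {h} : 1 + t * (ps - p) <= z^-1.
  have := lnz z^-1; rewrite invr_gt0 z0 lnV ?posrE // => /(_ isT); lra.
rewrite /z invf_div ler_pdivlMr // => h.
set D := ps - p in h *; have D0 : 0 <= D by rewrite /D; lra.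
set b := p - F p; have Fb : F p = p - b by rewrite /b; ring.
have h2 : t * D * p * (1 - p) <= b * (1 + t * D * (1 - p)) by move: h; rewrite Fb; nra.
have D1 : D * (1 - p) <= 1 by rewrite /D; nra.
have b0 : 0 <= b.
  have : 0 <= b * (1 + t * D * (1 - p)).
    by apply: le_trans h2; rewrite !mulr_ge0 // ltW.
  by rewrite pmulr_lge0 // ltr_pwDl // !mulr_ge0 // ltW.
have h3 : t * D * p * (1 - p) <= b * (1 + t).
  apply: le_trans h2 _; rewrite ler_wpM2l // lerD2l -mulrA -[leRHS]mulr1.
  by rewrite ler_wpM2l // ltW.
have := ler_wpM2l D0 h3; rewrite (_ : p - ps = - D); last by rewrite /D; ring.
rewrite (_ : F p - p = - b); last by rewrite /b; ring.
nra.
Qed.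

End UnstableFixedPoint.

(** * Harmonic numbers and logarithms *)

Section Harmonic.
Variable R : realType.

Definition harm (n : nat) : R := series (@harmonic R) n.

Lemma harm0 : harm 0 = 0. Proof. by rewrite /harm /series /= big_nil. Qed.

Lemma harmS n : harm n.+1 = harm n + n.+1%:R^-1.
Proof. by rewrite /harm /series /= big_nat_recr. Qed.

Lemma harm_subS N s : (s < N)%N ->
  harm (N - s.+1) - harm (N - s) = - (N - s)%:R^-1.
Proof.
move=> sN; rewrite (_ : (N - s)%N = (N - s.+1).+1); last by lia.
by rewrite harmS opprD addrA subrr add0r.
Qed.

Lemma harm_ge0 n : 0 <= harm n.
Proof. by apply: sumr_ge0 => k _; rewrite invr_ge0. Qed.

Lemma harm_le m n : (m <= n)%N -> harm m <= harm n.
Proof.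
move=> /subnKC <-; elim: (n - m)%N => [|k IH]; first by rewrite addn0.
by rewrite addnS harmS (le_trans IH) // lerDl invr_ge0.
Qed.

Lemma harm_ge1 n : (0 < n)%N -> 1 <= harm n.
Proof. by move=> /harm_le; rewrite harmS harm0 add0r invr1. Qed.

(** Subadditivity, from [1 / (m + i) <= 1 / i]. *)
Lemma harmD m n : harm (m + n) <= harm m + harm n.
Proof.
elim: n => [|n IH]; first by rewrite addn0 harm0 addr0.
by rewrite addnS !harmS addrA lerD // lef_pV2 ?posrE ?ltr0n // ler_nat ltnS leq_addl.
Qed.

Lemma ln_lbound (x : R) : 0 < x -> 1 - x^-1 <= ln x.
Proof.
move=> x0; have := @le_ln1Dx R (x^-1 - 1).
rewrite addrCA subrr addr0 lnV ?posrE //.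
by have := x0; rewrite -invr_gt0 => xV0 /(_ _); lra.
Qed.

Lemma ln_ubound (x : R) : 0 < x -> ln x <= x - 1.
Proof.
move=> x0; have := @le_ln1Dx R (x - 1).
by rewrite addrCA subrr addr0 => /(_ _); lra.
Qed.

Lemma ln1D_lbound (y : R) : - 2^-1 <= y -> y - 2 * y ^+ 2 <= ln (1 + y).
Proof.
move=> hy; have y0 : 0 < 1 + y by lra.
apply: le_trans (ln_lbound y0); rewrite lerBrDl -lerBrDr -[leLHS]mul1r ler_pdivrMr //.
nra.
Qed.

Lemma lnS_bounds n : (0 < n)%N ->
  n.+1%:R^-1 <= ln (n.+1%:R : R) - ln n%:R <= n%:R^-1.
Proof.
move=> n0; have n0' : 0 < n%:R :> R by rewrite ltr0n.
have nS0 : 0 < n.+1%:R :> R by rewrite ltr0n.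
have nS : (n.+1%:R : R) = n%:R + 1 by rewrite -natr1.
rewrite -ln_div ?posrE //; apply/andP; split.
  apply: le_trans (ln_lbound _); last by rewrite divr_gt0.
  by rewrite invf_div nS le_eqVlt; apply/orP; left; apply/eqP; field; rewrite -nS gt_eqF.
apply: le_trans (ln_ubound _) _; first by rewrite divr_gt0.
by rewrite nS le_eqVlt; apply/orP; left; apply/eqP; field; rewrite gt_eqF.
Qed.

Lemma harm_le_ln n : (0 < n)%N -> harm n <= 1 + ln n%:R.
Proof.
case: n => // n _; elim: n => [|n IH]; first by rewrite harmS harm0 ln1 invr1; lra.
rewrite harmS; have /andP[+ _] := @lnS_bounds n.+1 isT; move: (n.+2%:R^-1) => u; lra.
Qed.

Lemma ln_le_harm n : ln (n.+1%:R : R) <= harm n.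
Proof.
elim: n => [|n IH]; first by rewrite ln1 harm0.
rewrite harmS; have /andP[_ +] := @lnS_bounds n.+1 isT; move: (n.+1%:R^-1) => u; lra.
Qed.

Lemma harm_ge_ln n : (0 < n)%N -> 1 + ln n%:R <= 2 * harm n.
Proof.
move=> n0; have h1 := harm_ge1 n0; suff : ln n%:R <= harm n by lra.
case: n n0 {h1} => // n _; apply: le_trans (ln_le_harm n) (harm_le _).
exact: leqnSn.
Qed.

End Harmonic.

(** * The count as a birth and death chain *)

Section BirthDeath.
Variable R : realType.
Implicit Types (F : R -> R) (N s : nat) (g : nat -> R) (B : nat -> R).

(** Transition probabilities of the count: it moves when the updating agent holds
    the opinion that the rule does not output, at proportion [s / N]. *)
Definition bd_up F N s : R := (1 - s%:R / N%:R) * F (s%:R / N%:R).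
Definition bd_down F N s : R := s%:R / N%:R * (1 - F (s%:R / N%:R)).
Definition bd_gen F N g s : R :=
  bd_up F N s * (g s.+1 - g s) - bd_down F N s * (g s - g s.-1).

(** The mean consensus time solves [bd_gen F N g s = -1] with boundary values 0;
    supersolutions lie above it and subsolutions below it. *)
Definition supersolution F N g : Prop :=
  (forall s, (0 < s < N)%N -> bd_gen F N g s <= -1) /\
  (forall s, (s <= N)%N -> 0 <= g s).

Definition subsolution F N g : Prop :=
  [/\ forall s, (0 < s < N)%N -> -1 <= bd_gen F N g s, g 0%N <= 0 & g N <= 0].

Definition time_ubound F N B : Prop :=
  exists2 g, supersolution F N g & forall s, (0 < s < N)%N -> g s <= B s.

Definition time_lbound F N s (b : R) : Prop := exists2 g, subsolution F N g & b <= g s.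

Definition dual_fun F : R -> R := fun p => 1 - F (1 - p).

(** Exchanging the two opinions swaps the two rates. *)
Lemma bd_gen_dual F N g s : (0 < s < N)%N ->
  bd_gen (dual_fun F) N (fun k => g (N - k)%N) s = bd_gen F N g (N - s).
Proof.
move=> /andP[s0 sN]; have N0 : N%:R != 0 :> R by rewrite pnatr_eq0; lia.
have pE : 1 - s%:R / N%:R = (N - s)%:R / N%:R :> R.
  by rewrite natrB ?(ltnW sN) // mulrBl divff.
rewrite /bd_gen /bd_up /bd_down /dual_fun pE.
have -> : (1 - (N - s)%:R / N%:R : R) = s%:R / N%:R by rewrite -pE; ring.
have -> : (N - s.+1)%N = (N - s).-1 by lia.
have -> : (N - s.-1)%N = (N - s).+1 by lia.
ring.
Qed.

Lemma time_ubound_dual F N B :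
  time_ubound F N B -> time_ubound (dual_fun F) N (fun s => B (N - s)%N).
Proof.
move=> [g [g1 g0] gB]; exists (fun k => g (N - k)%N); last first.
  by move=> s sN; apply: gB; lia.
split=> s sN; last by apply: g0; lia.
by rewrite bd_gen_dual //; apply: g1; lia.
Qed.

Lemma time_lbound_dual F N s b : (s <= N)%N ->
  time_lbound F N (N - s) b -> time_lbound (dual_fun F) N s b.
Proof.
move=> sN [g [g1 g0 gN] gb]; exists (fun k => g (N - k)%N) => //.
split; rewrite ?subn0 ?subnn // => k kN.
by rewrite bd_gen_dual //; apply: g1; lia.
Qed.

Lemma time_ubound_le F N B B' : (forall s, (0 < s < N)%N -> B s <= B' s) ->
  time_ubound F N B -> time_ubound F N B'.
Proof. by move=> BB [g gs gB]; exists g => // s sN; apply: le_trans (gB _ sN) (BB _ sN). Qed.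

Lemma time_lbound_le F N s (b b' : R) : b' <= b ->
  time_lbound F N s b -> time_lbound F N s b'.
Proof. by move=> bb [g gs gb]; exists g => //; apply: le_trans gb. Qed.

Lemma bd_genZ F N g s (c : R) : bd_gen F N (fun k => c * g k) s = c * bd_gen F N g s.
Proof. by rewrite /bd_gen; ring. Qed.

Lemma bd_genD F N g h s : bd_gen F N (fun k => g k + h k) s = bd_gen F N g s + bd_gen F N h s.
Proof. by rewrite /bd_gen; ring. Qed.

Lemma bd_gen_addc F N g s (c : R) : bd_gen F N (fun k => g k + c) s = bd_gen F N g s.
Proof. by rewrite /bd_gen; ring. Qed.

Lemma time_ubound_scale F N g B (c : R) : 0 < c ->
  (forall s, (0 < s < N)%N -> bd_gen F N g s <= - c) ->
  (forall s, (s <= N)%N -> 0 <= g s) ->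
  (forall s, (0 < s < N)%N -> g s <= c * B s) -> time_ubound F N B.
Proof.
move=> c0 g1 g0 gB; exists (fun s => c^-1 * g s).
  split=> s sN; last by rewrite mulr_ge0 ?g0 // invr_ge0 ltW.
  by rewrite bd_genZ mulrC ler_pdivrMr // mulN1r g1.
by move=> s sN; rewrite mulrC ler_pdivrMr // mulrC gB.
Qed.

Lemma time_lbound_scale F N g s (b c : R) : 0 < c ->
  (forall s, (0 < s < N)%N -> - c <= bd_gen F N g s) ->
  g 0%N <= 0 -> g N <= 0 -> c * b <= g s -> time_lbound F N s b.
Proof.
move=> c0 g1 g0 gN gb; exists (fun s => c^-1 * g s).
  split=> [k kN||].
  - by rewrite bd_genZ mulrC ler_pdivlMr // mulN1r g1.
  - by rewrite mulrC ler_pdivrMr // mul0r.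
  - by rewrite mulrC ler_pdivrMr // mul0r.
by rewrite mulrC ler_pdivlMr // mulrC.
Qed.

Lemma freq_bounds N s : (0 < s < N)%N -> 0 < (s%:R / N%:R : R) < 1.
Proof.
move=> /andP[s0 sN]; have N0 : 0 < N%:R :> R by rewrite ltr0n; lia.
apply/andP; split; first by rewrite divr_gt0 // ltr0n.
by rewrite ltr_pdivrMr // mul1r ltr_nat.
Qed.

Section GeneralRule.
Variable F : R -> R.
Hypothesis F01 : forall p : R, 0 <= p <= 1 -> 0 <= F p <= 1.

Let freq01 N s : (0 < s < N)%N -> 0 <= F (s%:R / N%:R) <= 1.
Proof. by move=> /freq_bounds/andP[p0 p1]; apply: F01; rewrite !ltW. Qed.

Lemma bd_up_ge0 N s : (0 < s < N)%N -> 0 <= bd_up F N s.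
Proof.
move=> /[dup] /freq01/andP[F0 F1] /freq_bounds/andP[p0 p1].
by apply: mulr_ge0 => //; lra.
Qed.

Lemma bd_down_ge0 N s : (0 < s < N)%N -> 0 <= bd_down F N s.
Proof.
move=> /[dup] /freq01/andP[F0 F1] /freq_bounds/andP[p0 p1].
by apply: mulr_ge0; lra.
Qed.

Lemma bd_drift N s : bd_up F N s - bd_down F N s = F (s%:R / N%:R) - s%:R / N%:R.
Proof. by rewrite /bd_up /bd_down; ring. Qed.

(** The rate of gain per missing agent and the rate of loss per present agent add
    up to [1 / N] whatever the rule, so the harmonic number of the smaller camp
    decreases by at most [1 / N] per step on average. *)
Lemma time_lbound_harm N s : (0 < s < N)%N ->
  time_lbound F N s (N%:R * Num.min (harm R s) (harm R (N - s))).
Proof.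
move=> sN; exists (fun k => N%:R * Num.min (harm R k) (harm R (N - k))) => //.
split=> [{s sN}s sN||]; last 2 first.
- by rewrite harm0 min_l ?mulr0 // harm_ge0.
- by rewrite subnn harm0 min_r ?mulr0 // harm_ge0.
rewrite bd_genZ /bd_gen.
have /andP[p0 p1] := freq_bounds sN; have /andP[s0 sN'] := sN.
have n0 : 0 < N%:R :> R by rewrite ltr0n; lia.
have x0 : 0 < s%:R :> R by rewrite ltr0n.
have y0 : 0 < (N - s)%:R :> R by rewrite ltr0n; lia.
have U0 := bd_up_ge0 sN; have D0 := bd_down_ge0 sN.
have e1 : harm R (N - s) = harm R (N - s.+1) + (N - s)%:R^-1.
  by rewrite (_ : (N - s)%N = (N - s.+1).+1) ?harmS //; lia.
have e2 : harm R s = harm R s.-1 + s%:R^-1.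
  by rewrite -{1 3}(prednK s0) harmS.
have l1 : harm R s <= harm R s.+1 by apply: harm_le.
have l2 : harm R (N - s) <= harm R (N - s.-1) by apply: harm_le; lia.
have xV : 0 < s%:R^-1 :> R by rewrite invr_gt0.
have yV : 0 < (N - s)%:R^-1 :> R by rewrite invr_gt0.
set m := Num.min (harm R s) (harm R (N - s)).
have ma : m <= harm R s by rewrite ge_min lexx.
have mb : m <= harm R (N - s) by rewrite ge_min lexx orbT.
have d1 : - (N - s)%:R^-1 <= Num.min (harm R s.+1) (harm R (N - s.+1)) - m.
  by rewrite lerBrDr le_min; apply/andP; split; lra.
have d2 : m - Num.min (harm R s.-1) (harm R (N - s.-1)) <= s%:R^-1.
  by rewrite lerBlDr -lerBlDl le_min; apply/andP; split; lra.
have h1 := ler_wpM2l U0 d1; have h2 := ler_wpM2l D0 d2.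
have e3 : N%:R * (bd_up F N s * (N - s)%:R^-1) = F (s%:R / N%:R).
  rewrite /bd_up natrB ?(ltnW sN') //; field.
  by rewrite (gt_eqF n0) /= -natrB ?(ltnW sN') // gt_eqF.
have e4 : N%:R * (bd_down F N s * s%:R^-1) = 1 - F (s%:R / N%:R).
  by rewrite /bd_down; field; rewrite !gt_eqF.
have : N%:R * (- (bd_up F N s * (N - s)%:R^-1) - bd_down F N s * s%:R^-1) = -1.
  by rewrite mulrBr mulrN e3 e4; ring.
move=> <-; rewrite ler_pM2l //; rewrite mulrN in h1; lra.
Qed.

Lemma bd_gen_harm N s : (0 < s < N)%N ->
  N%:R * bd_gen F N (@harm R) s <= (F (s%:R / N%:R) - s%:R / N%:R) / (s%:R / N%:R).
Proof.
move=> /[dup] sN /andP[s0 sN'].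
have U0 := bd_up_ge0 sN; have D0 := bd_down_ge0 sN.
have n0 : 0 < N%:R :> R by rewrite ltr0n (leq_ltn_trans _ sN').
have x0 : 0 < s%:R :> R by rewrite ltr0n.
have e2 : harm R s - harm R s.-1 = s%:R^-1.
  by rewrite -{1 3}(prednK s0) harmS addrC addKr.
have e1 : harm R s.+1 - harm R s <= s%:R^-1.
  by rewrite harmS addrC addKr lef_pV2 ?posrE ?ltr0n // ler_nat.
rewrite -bd_drift /bd_gen e2 invf_div [leRHS]mulrCA ler_pM2l // mulrBl lerB //.
by rewrite ler_wpM2l.
Qed.

Lemma bd_gen_harm_rev N s : (0 < s < N)%N ->
  N%:R * bd_gen F N (fun k => harm R (N - k)) s <=
  - ((F (s%:R / N%:R) - s%:R / N%:R) / (1 - s%:R / N%:R)).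
Proof.
move=> /[dup] sN /andP[s0 sN'].
have U0 := bd_up_ge0 sN; have D0 := bd_down_ge0 sN.
have n0 : 0 < N%:R :> R by rewrite ltr0n (leq_ltn_trans _ sN').
have y0 : 0 < (N - s)%:R :> R by rewrite ltr0n subn_gt0.
have qE : 1 - s%:R / N%:R = (N - s)%:R / N%:R :> R.
  by rewrite natrB ?(ltnW sN') // mulrBl divff // gt_eqF.
have e1 := harm_subS R sN'.
have e2 : - (N - s)%:R^-1 <= harm R (N - s) - harm R (N - s.-1).
  have -> : (N - s.-1)%N = (N - s).+1 by lia.
  rewrite harmS opprD addrA subrr add0r lerN2 lef_pV2 ?posrE ?ltr0n //; last by lia.
  by rewrite ler_nat.
rewrite -bd_drift /bd_gen qE e1 invf_div [in leRHS]mulrCA -[leRHS]mulrN ler_pM2l //.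
have := ler_wpM2l D0 e2; rewrite !mulrN mulrBl; lra.
Qed.

End GeneralRule.

(** * The voter model *)

Section Voter.

Let xlnx (n : nat) : R := n%:R * ln n%:R.

(** Splitting the step at its midpoint makes the crude bound [ln_lbound] sharp
    enough to see the second-order term. *)
Lemma ln_step_lbound (x : R) : 1 <= x ->
  1 + (6 * x)^-1 <= (x + 1) * (ln (x + 1) - ln x).
Proof.
move=> x1; have x0 : 0 < x by lra.
have a0 : 0 < 2 * x + 1 by lra.
have a1 : 0 < 2 * x by lra.
have a2 : 0 < x + 1 by lra.
have a3 : 0 < 2 * (x + 1) by lra.
have -> : ln (x + 1) - ln x = ln ((2 * x + 1) / (2 * x)) + ln (2 * (x + 1) / (2 * x + 1)).
  rewrite -ln_div ?posrE // -lnM ?posrE ?divr_gt0 //.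
  by congr ln; field; rewrite !gt_eqF.
have c1 : (2 * x + 1)^-1 <= ln ((2 * x + 1) / (2 * x)).
  apply: le_trans (ln_lbound (divr_gt0 a0 a1)).
  by rewrite invf_div le_eqVlt; apply/orP; left; apply/eqP; field; rewrite gt_eqF.
have c2 : (2 * (x + 1))^-1 <= ln (2 * (x + 1) / (2 * x + 1)).
  apply: le_trans (ln_lbound (divr_gt0 a3 a0)).
  by rewrite invf_div le_eqVlt; apply/orP; left; apply/eqP; field; rewrite gt_eqF.
apply: (@le_trans _ _ ((x + 1) * ((2 * x + 1)^-1 + (2 * (x + 1))^-1))); last first.
  by rewrite ler_pM2l // lerD.
have -> : (x + 1) * ((2 * x + 1)^-1 + (2 * (x + 1))^-1) = 1 + (2 * (2 * x + 1))^-1.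
  by field; rewrite !gt_eqF.
by rewrite lerD2l lef_pV2 ?posrE; lra.
Qed.

Lemma xlnx_diff2 n : (0 < n)%N ->
  (6 * n%:R)^-1 <= xlnx n.+1 - xlnx n - (xlnx n - xlnx n.-1) <= 2 / n%:R.
Proof.
case: n => // n _ /=; rewrite /xlnx.
have nS0 : 0 < n.+1%:R :> R by rewrite ltr0n.
have nSS : (n.+2%:R : R) = n.+1%:R + 1 by rewrite -natr1.
have nP : (n%:R : R) = n.+1%:R - 1 by rewrite -natr1; ring.
have /andP[_ up] := @lnS_bounds R n.+1 isT.
have dn : n%:R * (ln n.+1%:R - ln n%:R) <= 1 :> R.
  case: n {nS0 nSS nP up} => [|n]; first by rewrite mul0r ler01.
  have /andP[_ h] := @lnS_bounds R n.+1 isT.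
  by apply: le_trans (ler_wpM2l _ h) _; rewrite ?ler0n // divff // pnatr_eq0.
have dn0 : 0 <= n%:R * (ln n.+1%:R - ln n%:R) :> R.
  by case: n {nS0 nSS nP up dn} => [|n];
    [rewrite mul0r|rewrite mulr_ge0 // subr_ge0 ler_ln ?posrE ?ltr0n // ler_nat].
have up2 : 1 + (6 * n.+1%:R)^-1 <= n.+2%:R * (ln n.+2%:R - ln n.+1%:R) :> R.
  by rewrite nSS; apply: ln_step_lbound; rewrite ler1n.
have up1 : n.+2%:R * (ln n.+2%:R - ln n.+1%:R) <= 1 + n.+1%:R^-1 :> R.
  apply: le_trans (ler_wpM2l _ up) _; first by rewrite ler0n.
  by rewrite nSS mulrDl divff ?gt_eqF // mul1r.
have lower : n%:R * (ln n.+1%:R - ln n%:R) >= 1 - n.+1%:R^-1 :> R.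
  case: n {nSS up dn dn0 up2 up1} nS0 nP => [|n] nS0 nP; first by rewrite mul0r invr1 subrr.
  have /andP[h _] := @lnS_bounds R n.+1 isT.
  apply: le_trans (ler_wpM2l (ler0n _ _) h); rewrite nP mulrBl divff ?gt_eqF //.
  by rewrite mul1r.
apply/andP; split.
  have -> : n.+2%:R * ln n.+2%:R - n.+1%:R * ln n.+1%:R -
     (n.+1%:R * ln n.+1%:R - n%:R * ln n%:R) =
     n.+2%:R * (ln n.+2%:R - ln n.+1%:R) - n%:R * (ln n.+1%:R - ln n%:R) :> R.
    by rewrite nSS nP; ring.
  by rewrite lerBrDr (le_trans _ up2) // addrC lerD2r.
have -> : n.+2%:R * ln n.+2%:R - n.+1%:R * ln n.+1%:R -
   (n.+1%:R * ln n.+1%:R - n%:R * ln n%:R) =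
   n.+2%:R * (ln n.+2%:R - ln n.+1%:R) - n%:R * (ln n.+1%:R - ln n%:R) :> R.
  by rewrite nSS nP; ring.
apply: le_trans (lerB up1 lower) _; move: (n.+1%:R^-1) => u; lra.
Qed.

Let pot N (s : nat) : R := N%:R * (xlnx N - xlnx s - xlnx (N - s)).

Let pot_end N : pot N 0 = 0 /\ pot N N = 0.
Proof.
by rewrite /pot /xlnx subn0 subnn !mul0r !subr0 subrr mulr0.
Qed.

(** The second differences of [x log x] at [s] and [N - s] are of order [1 / s]
    and [1 / (N - s)], whose sum cancels the jump rate [s (N - s) / N ^ 2]. *)
Lemma voter_drift N s : (0 < s < N)%N -> -2 <= bd_gen id N (pot N) s <= - 6^-1.
Proof.
move=> /[dup] sN /andP[s0 sN'].
have n0 : 0 < N%:R :> R by rewrite ltr0n; lia.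
have x0 : 0 < s%:R :> R by rewrite ltr0n.
have y0 : 0 < (N - s)%:R :> R by rewrite ltr0n; lia.
have yE : (N - s)%:R = N%:R - s%:R :> R by rewrite natrB // ltnW.
have /andP[a1 a2] := xlnx_diff2 s0.
have /andP[b1 b2] := @xlnx_diff2 (N - s) ltac:(lia).
have e1 : (N - s).+1 = (N - s.-1)%N by lia.
have e2 : (N - s).-1 = (N - s.+1)%N by lia.
rewrite e1 e2 in b1 b2.
set A := xlnx s.+1 - _ - _ in a1 a2; set C := xlnx (N - s.-1) - _ - _ in b1 b2.
have -> : bd_gen id N (pot N) s = - (s%:R * (N - s)%:R / N%:R) * (A + C).
  rewrite /bd_gen /bd_up /bd_down /pot /A /C yE; field; exact: lt0r_neq0.
have k : s%:R * (N - s)%:R / N%:R * (s%:R^-1 + (N - s)%:R^-1) = 1 :> R.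
  by rewrite yE; field; rewrite -yE !gt_eqF.
have w0 : 0 <= s%:R * (N - s)%:R / N%:R :> R by rewrite divr_ge0 ?mulr_ge0 ?ltW.
have h1 : A + C <= 2 * (s%:R^-1 + (N - s)%:R^-1) by lra.
have h2 : 6^-1 * (s%:R^-1 + (N - s)%:R^-1) <= A + C.
  by rewrite !invfM in a1 b1; lra.
have := ler_wpM2l w0 h1; have := ler_wpM2l w0 h2; move: w0 k.
set W := _ / N%:R; set S := _ + _ => w0 k.
by rewrite mulNr !(mulrCA W _ S) k !mulr1; lra.
Qed.

Lemma pot_Ent N s : (0 < s < N)%N -> pot N s = N%:R ^+ 2 * Ent (s%:R / N%:R).
Proof.
move=> /andP[s0 sN].
have n0 : 0 < N%:R :> R by rewrite ltr0n; lia.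
have x0 : 0 < s%:R :> R by rewrite ltr0n.
have y0 : 0 < (N - s)%:R :> R by rewrite ltr0n; lia.
have yE : (N - s)%:R = N%:R - s%:R :> R by rewrite natrB // ltnW.
have qE : 1 - s%:R / N%:R = (N - s)%:R / N%:R :> R by rewrite yE mulrBl divff // gt_eqF.
rewrite /Ent qE !ln_div ?posrE // /pot /xlnx yE; field.
by rewrite gt_eqF.
Qed.

Lemma voter_time_ubound N : time_ubound id N (fun s => 6 * (N%:R ^+ 2 * Ent (s%:R / N%:R))).
Proof.
have [p0 pN] := pot_end N.
apply: (@time_ubound_scale _ _ (pot N) _ 6^-1) => [//|s sN|s sN|s sN].
- by have /andP[] := voter_drift sN.
- case: (posnP s) => [->|s0]; first by rewrite p0.
  move: sN; rewrite leq_eqVlt => /predU1P[->|sN]; first by rewrite pN.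
  have sN' : (0 < s < N)%N by rewrite s0.
  have /andP[q0 q1] := freq_bounds sN'.
  rewrite pot_Ent // mulr_ge0 ?sqr_ge0 // /Ent.
  have := ln_le0 (ltW q1); have := @ln_le0 R (1 - s%:R / N%:R) ltac:(lra).
  by nra.
- by rewrite pot_Ent // mulrA mulVf ?mul1r.
Qed.

Lemma voter_time_lbound N s : (0 < s < N)%N ->
  time_lbound id N s (2^-1 * (N%:R ^+ 2 * Ent (s%:R / N%:R))).
Proof.
have [p0 pN] := pot_end N.
move=> sN; apply: (@time_lbound_scale _ _ (pot N) _ _ 2) => [//|k kN|||].
- by have /andP[] := voter_drift kN.
- by rewrite p0.
- by rewrite pN.
- by rewrite pot_Ent // mulrA divff // mul1r.
Qed.

End Voter.

End BirthDeath.

(** * One repelling endpoint *)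

Section Potentials.
Variables (R : realType) (F : R -> R) (rr : R).
Hypothesis rr1 : 1 <= rr.
Hypothesis F01 : forall p : R, 0 <= p <= 1 -> 0 <= F p <= 1.
Hypothesis F_lin0 : forall p : R, 0 <= p <= 1 -> F p <= rr * p.
Hypothesis F_lin1 : forall p : R, 0 <= p <= 1 -> 1 - F p <= rr * (1 - p).
Implicit Types (N s : nat) (g : nat -> R).

Lemma bd_rates N s (p := s%:R / N%:R : R) : (0 < s < N)%N ->
  [/\ bd_up F N s <= rr * (p * (1 - p)), bd_down F N s <= rr * (p * (1 - p)) &
      p * (1 - p) / 2 <= bd_up F N s + bd_down F N s].
Proof.
move=> /(freq_bounds R); rewrite /bd_up /bd_down -/p => /andP[p0 p1].
have p01 : 0 <= p <= 1 by rewrite !ltW.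
have /andP[f0 f1] := F01 p01; have l0 := F_lin0 p01; have l1 := F_lin1 p01.
have q0 : 0 < 1 - p by lra.
split.
- by rewrite mulrA [leRHS]mulrC ler_pM2l.
- by rewrite mulrCA ler_pM2l.
- by have [h|h] := leP (F p) 2^-1; nra.
Qed.

Section Repelling.
Hypothesis F_drift : forall p : R, 0 <= p <= 1 -> p * (1 - p) <= F p - p.

(* A shift large enough for the drift of [ln (s + A)] to beat its concavity even
   at [s = 1]. *)
Let A : R := 8 * rr.

Let A8 : 8 <= A. Proof. have h := rr1; rewrite /A; lra. Qed.

Let bd_gen_ln N s : (0 < s < N)%N ->
  (1 - s%:R / N%:R) / (2 * (1 + A)) <= N%:R * bd_gen F N (fun k => ln (k%:R + A)) s.
Proof.
move=> /[dup] sN /andP[s0 sN'].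
have U0 := bd_up_ge0 F01 sN; have D0 := bd_down_ge0 F01 sN.
have n0 : 0 < N%:R :> R by rewrite ltr0n (leq_ltn_trans _ sN').
have x1 : 1 <= s%:R :> R by rewrite ler1n.
have [u1 d1 _] := bd_rates sN; have /andP[p0 p1] := freq_bounds R sN.
have dr := F_drift (p := s%:R / N%:R) ltac:(by rewrite !ltW).
rewrite -bd_drift in dr; set p := s%:R / N%:R in u1 d1 p0 p1 dr *.
have a8 := A8; set z := s%:R + A; have z9 : 9 <= z by rewrite /z; lra.
set y := z^-1; have y0 : 0 < y by rewrite invr_gt0; lra.
have yA : A * y <= 1.
  by rewrite /y ler_pdivrMr ?mul1r /z; lra.
have yh : y <= 2^-1 by rewrite lef_pV2 ?posrE; lra.
have zy : z * y = 1 by rewrite divff // gt_eqF //; lra.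
clearbody y.
have lup : y - 2 * y ^+ 2 <= ln (s.+1%:R + A) - ln (s%:R + A).
  have -> : s.+1%:R + A = z * (1 + y) by rewrite mulrDr zy -natr1 /z; ring.
  rewrite -/z lnM ?posrE; [|lra|lra].
  by rewrite [leRHS]addrC addKr ln1D_lbound //; lra.
have ldn : ln (s%:R + A) - ln (s.-1%:R + A) <= y + 2 * y ^+ 2.
  have -> : s.-1%:R + A = z * (1 - y).
    rewrite mulrBr zy mulr1 /z -{2}(prednK s0) -natr1; ring.
  rewrite -/z lnM ?posrE; [|lra|lra].
  have := @ln1D_lbound R (- y); rewrite sqrrN => /(_ _); lra.
have h1 := ler_wpM2l U0 lup; have h2 := ler_wpM2l D0 ldn.
have : (bd_up F N s - bd_down F N s) * y - 2 * (bd_up F N s + bd_down F N s) * y ^+ 2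
   <= bd_gen F N (fun k => ln (k%:R + A)) s by rewrite /bd_gen; lra.
set P := p * (1 - p) in u1 d1 dr.
have P0 : 0 < P by rewrite mulr_gt0 // subr_gt0.
have low : P * y / 2 <= (bd_up F N s - bd_down F N s) * y
   - 2 * (bd_up F N s + bd_down F N s) * y ^+ 2.
  have t1 := ler_wpM2r (ltW y0) dr.
  have y20 : 0 <= y ^+ 2 by rewrite sqr_ge0.
  have t2 := ler_wpM2r y20 (lerD u1 d1).
  have t3 : 4 * (rr * P) * y ^+ 2 <= P * y / 2.
    have -> : 4 * (rr * P) * y ^+ 2 = (P * y / 2) * (A * y) by rewrite /A; field.
    by rewrite ler_piMr // divr_ge0 // mulr_ge0 // ltW.
  lra.
move=> /(le_trans low)/(ler_wpM2l (ltW n0)); apply: le_trans.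
have -> : N%:R * (P * y / 2) = (1 - p) / (2 * (1 + A)) * ((1 + A) * (s%:R * y)).
  by rewrite /P /p; field; rewrite gt_eqF //=; lra.
rewrite ler_peMr //; first by rewrite divr_ge0 //; lra.
rewrite -[leLHS]zy mulrA ler_wpM2r ?(ltW y0) // /z; nra.
Qed.

(** The harmonic term decreases near the attracting endpoint and [- ln (s + A)]
    decreases near the repelling one. *)
Lemma repelling_time_ubound : exists2 C : R, 0 < C & forall N, (0 < N)%N ->
  time_ubound F N (fun s => C * (N%:R * (1 + ln (N - s)%:R))).
Proof.
have a8 := A8; have c0 : 0 < (2 * (1 + A))^-1 by rewrite invr_gt0; lra.
exists (2 * (2 * (1 + A))) => [|N N0]; first by lra.
have n0 : 0 < N%:R :> R by rewrite ltr0n.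
apply: (@time_ubound_scale _ _ _ (fun k => N%:R * (harm R (N - k) + (ln (N%:R + A)
   - ln (k%:R + A)))) _ (2 * (1 + A))^-1) => // s sN.
- rewrite bd_genZ bd_genD mulrDr.
  have -> : bd_gen F N (fun k => ln (N%:R + A) - ln (k%:R + A)) s =
     - bd_gen F N (fun k => ln (k%:R + A)) s by rewrite /bd_gen; ring.
  have h1 := bd_gen_harm_rev F01 sN; have h2 := bd_gen_ln sN.
  have /andP[p0 p1] := freq_bounds R sN.
  have dr := F_drift (p := s%:R / N%:R) ltac:(by rewrite !ltW).
  set p := s%:R / N%:R in p0 p1 h1 h2 dr *.
  have h3 : p <= (F p - p) / (1 - p) by rewrite ler_pdivlMr // subr_gt0.
  have h4 : p / (2 * (1 + A)) <= p.
    by rewrite ler_pdivrMr ?ler_peMr ?ltW //; lra.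
  by rewrite mulrBl mul1r in h2; lra.
- apply: mulr_ge0 (ltW n0) _.
  rewrite addr_ge0 ?harm_ge0 // subr_ge0 ler_ln ?posrE.
  + by rewrite lerD2r ler_nat.
  + by have : 0 <= s%:R :> R by []; lra.
  + by lra.
- have -> : (2 * (1 + A))^-1 * (2 * (2 * (1 + A)) * (N%:R * (1 + ln (N - s)%:R))) =
     N%:R * (2 * (1 + ln (N - s)%:R)) by field; rewrite gt_eqF; lra.
  rewrite ler_pM2l //; have /andP[s0 sN'] := sN.
  have h := @harm_le_ln R (N - s) ltac:(lia).
  suff : ln (N%:R + A) - ln (s%:R + A) <= harm R (N - s) by lra.
  apply: le_trans (ln_le_harm R (N - s)).
  have x1 : 1 <= s%:R :> R by rewrite ler1n.
  have z1 : 0 < s%:R + A by lra.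
  have z2 : 0 < N%:R + A by lra.
  rewrite -ln_div ?posrE // ler_ln ?posrE ?ltr0n ?divr_gt0 // ler_pdivrMr //.
  have y0 : 0 <= (N - s)%:R :> R by [].
  have -> : (N%:R : R) = (N - s)%:R + s%:R by rewrite -natrD subnK // ltnW.
  by rewrite -[(N - s).+1]addn1 natrD mulrDl mul1r addrA lerD2r lerD2r ler_peMr //; lra.
Qed.

Let theta : R := rr / (rr + 1).

(** The odds of rising against dropping are at least [1 + 1 / rr], so [theta ^ s]
    is a supermartingale: started from one agent, the count escapes the repelling
    endpoint with positive probability. *)
Let bd_gen_theta N s : (0 < s < N)%N -> bd_gen F N (fun k => theta ^+ k) s <= 0.
Proof.
move=> /[dup] sN /andP[s0 sN'].
have U0 := bd_up_ge0 F01 sN; have D0 := bd_down_ge0 F01 sN.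
have [u1 d1 _] := bd_rates sN; have /andP[p0 p1] := freq_bounds R sN.
have dr := F_drift (p := s%:R / N%:R) ltac:(by rewrite !ltW).
rewrite -bd_drift in dr; set P := _ * _ in u1 d1 dr.
have hr := rr1; have r0 : 0 < rr + 1 by lra.
have t0 : 0 < theta by rewrite divr_gt0 //; lra.
have DU : bd_down F N s <= theta * bd_up F N s.
  rewrite /theta mulrAC ler_pdivlMr //.
  have : bd_down F N s <= rr * (bd_up F N s - bd_down F N s).
    by apply: le_trans d1 _; rewrite ler_wpM2l //; lra.
  lra.
have t1 : theta <= 1 by rewrite ler_pdivrMr //; lra.
have -> : bd_gen F N (fun k => theta ^+ k) s =
  (theta ^+ s.-1 * (1 - theta)) * (bd_down F N s - theta * bd_up F N s).
  have es : theta ^+ s = theta * theta ^+ s.-1 by rewrite -exprS prednK.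
  by rewrite /bd_gen exprS es; ring.
by rewrite mulr_ge0_le0 // ?subr_le0 // mulr_ge0 ?exprn_ge0 ?subr_ge0 // ltW.
Qed.

(** Subtracting [theta ^ s] times the value at 0 cancels the harmonic term there
    and only increases the drift. This suffices when the harmonic numbers of
    [N - s] and [N] are close and large; the other cases follow from
    [time_lbound_harm]. *)
Lemma repelling_time_lbound : exists2 c : R, 0 < c & forall N s, (0 < s < N)%N ->
  time_lbound F N s (c * (N%:R * (1 + ln (N - s)%:R))).
Proof.
have hr := rr1; have r0 : 0 < rr + 1 by lra.
exists (4 * (rr + 1))^-1 => [|N s /[dup] sN /andP[s0 sN']]; first by rewrite invr_gt0; lra.
have n0 : 0 < N%:R :> R by rewrite ltr0n (leq_ltn_trans _ sN').
set H := harm R (N - s).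
have H1 : 1 <= H by apply: harm_ge1; lia.
suff [E E0 HE] : exists2 E, time_lbound F N s (N%:R * E) & H <= 2 * (rr + 1) * E.
  apply: time_lbound_le E0; rewrite mulrCA ler_pM2l //.
  have := @harm_ge_ln R (N - s) ltac:(lia); rewrite -/H => h.
  by rewrite mulrC ler_pdivrMr; lra.
have [sh|sh] := leqP (N - s) s.
  exists H; last by nra.
  apply: time_lbound_le (time_lbound_harm F01 sN).
  by rewrite min_r ?harm_le.
have t1 : 0 <= theta <= 1.
  by rewrite divr_ge0 ?ler_pdivrMr //; lra.
have G : time_lbound F N s (N%:R * (H - theta ^+ s * harm R N)).
  exists (fun k => N%:R * (harm R (N - k) + (- harm R N) * theta ^+ k)); last first.
    by rewrite mulNr [harm R N * _]mulrC.
  split=> [k kN||].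
  - rewrite bd_genZ bd_genD bd_genZ.
    have U0 := bd_up_ge0 F01 kN; have D0 := bd_down_ge0 F01 kN.
    have h1 := bd_gen_theta kN.
    have h2 : 0 <= - harm R N * bd_gen F N (fun k => theta ^+ k) k.
      by rewrite mulNr -mulrN mulr_ge0 ?harm_ge0 // oppr_ge0.
    have /andP[k0 kN'] := kN.
    have y0 : 0 < (N - k)%:R :> R by rewrite ltr0n subn_gt0.
    have e1 := harm_subS R kN'.
    have e2 : harm R (N - k) - harm R (N - k.-1) <= 0.
      by rewrite subr_le0 harm_le // leq_sub2l // leq_pred.
    have h3 := mulr_ge0_le0 D0 e2.
    have e3 : N%:R * (bd_up F N k * (N - k)%:R^-1) = F (k%:R / N%:R).
      rewrite /bd_up natrB ?(ltnW kN') //; field.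
      by rewrite (gt_eqF n0) /= -natrB ?(ltnW kN') // gt_eqF.
    have /andP[p0 p1] := freq_bounds R kN.
    have /andP[F0 F1] := F01 (p := k%:R / N%:R) ltac:(by rewrite !ltW).
    have : N%:R * (- (bd_up F N k * (N - k)%:R^-1)) <=
        N%:R * (bd_gen F N (fun k => harm R (N - k)) k
          + - harm R N * bd_gen F N (fun k => theta ^+ k) k).
      by rewrite ler_pM2l // {1}/bd_gen e1 mulrN; lra.
    by rewrite mulrN e3; lra.
  - by rewrite subn0 expr0 mulr1 subrr mulr0.
  - by rewrite subnn harm0 add0r mulNr mulrN oppr_le0 !mulr_ge0 ?harm_ge0 ?exprn_ge0 // ?(ltW n0); case/andP: t1.
have HN : harm R N <= H + 1.
  have -> : N = (N - s + s)%N by rewrite subnK // ltnW.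
  have : forall k, (k <= N - s)%N -> harm R (N - s + k) <= H + k%:R / (N - s)%:R.
    elim=> [|k IH] kN; first by rewrite addn0 mul0r addr0.
    rewrite addnS harmS -[k.+1]addn1 natrD mulrDl addrA lerD ?IH ?(ltnW kN) //.
    by rewrite mul1r lef_pV2 ?posrE ?ltr0n ?ler_nat ?addn_gt0 ?subn_gt0 ?sN' // -addnS leq_addr.
  move=> /(_ s (ltnW sh)) h; apply: le_trans h _; rewrite lerD2l ler_pdivrMr ?mul1r ?ler_nat.
    exact: ltnW.
  by rewrite ltr0n subn_gt0.
have key : H <= (rr + 1) * (H - theta ^+ s * harm R N + 1).
  have ts : theta ^+ s <= theta.
    rewrite -(prednK s0) exprS; have /andP[ta tb] := t1.
    by rewrite ler_piMr // exprn_ile1.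
  have h1 : theta ^+ s * harm R N <= theta * (H + 1).
    by apply: ler_pM => //; [rewrite exprn_ge0 //; case/andP: t1|exact: harm_ge0].
  have h2 : (rr + 1) * theta = rr by rewrite mulrC divfK // gt_eqF.
  have := ler_wpM2l (ltW r0) h1; rewrite [X in _ <= X]mulrA h2; lra.
have [EH|EH] := leP 1 (H - theta ^+ s * harm R N).
  exists (H - theta ^+ s * harm R N) => //; apply: le_trans key _.
  by rewrite -mulrA [leRHS]mulrCA ler_pM2l //; lra.
exists 1; last by apply: le_trans key _; rewrite mulr1 mulrC ler_pM2r //; lra.
apply: time_lbound_le (time_lbound_harm F01 sN); rewrite ler_pM2l // le_min.
by rewrite !harm_ge1 ?subn_gt0.
Qed.

End Repelling.

End Potentials.

(** * Two attracting endpoints *)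

Section RegularisedDistance.
Variable R : realType.

(** Second-order expansion of [ln (M + x ^+ 2)] when [x] moves by one:
    [8 x ^+ 2 + 2] bounds the squared increments of [x ^+ 2], and the factor 2 in
    [e] is that of [ln1D_lbound]. *)
Lemma ln_sq_step (M x U D e : R) : 16 <= M -> 0 <= U -> 0 <= D ->
  e * (M + x ^+ 2) = 2 * (8 * x ^+ 2 + 2) ->
  2 * (x * (U - D)) + (U + D) * (1 - e) <=
  (U * (ln (M + (x + 1) ^+ 2) - ln (M + x ^+ 2)) -
   D * (ln (M + x ^+ 2) - ln (M + (x - 1) ^+ 2))) * (M + x ^+ 2).
Proof.
move=> M16 U0 D0; set z := M + x ^+ 2 => ez.
have x20 : 0 <= x ^+ 2 by apply: sqr_ge0.
have z0 : 0 < z by rewrite /z; lra.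
have zn0 : z != 0 by rewrite gt_eqF.
have step w : w ^+ 2 = x ^+ 2 ->
    2 * w + 1 - e <= (ln (M + (w + 1) ^+ 2) - ln z) * z.
  move=> wx; pose y := (2 * w + 1) / z.
  have yz : y * z = 2 * w + 1 by rewrite /y divfK.
  have yh : - 2^-1 <= y.
    rewrite /y ler_pdivlMr // /z -wx; have := sqr_ge0 (w + 2); clear -M16; nra.
  have -> : M + (w + 1) ^+ 2 = z * (1 + y).
    by rewrite mulrDr mulr1 [z * y]mulrC yz /z -wx; ring.
  have y1 : 0 < 1 + y by clear -yh; lra.
  rewrite lnM ?posrE // [ln z + _]addrC addrK.
  apply: le_trans (ler_wpM2r (ltW z0) (ln1D_lbound yh)).
  rewrite mulrBl yz lerD2l lerN2 -(ler_pM2r z0).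
  have -> : 2 * y ^+ 2 * z * z = 2 * (y * z) ^+ 2 by ring.
  rewrite yz ez -wx; have := sqr_ge0 (2 * w - 1); clear; nra.
have h1 := ler_wpM2l U0 (step x erefl).
have h2 := ler_wpM2l D0 (step (- x) (sqrrN x)).
have -> : x - 1 = - (- x + 1) by ring.
rewrite sqrrN; move: (ln _) (ln _) (ln _) h1 h2 => a b d; clear; lra.
Qed.

(** Within a distance of order [sqrt (A n)] of the unstable point the noise [U + D]
    makes the logarithm grow; beyond it the second-order term may be negative, but
    the drift outweighs it. *)
Lemma diffusive_balance (rr c A n x U D e P : R) :
  1 <= rr -> 0 < c <= 1 -> 2048 <= A -> A * c = 2048 * rr -> 1 <= n ->
  0 <= P -> U + D <= 2 * rr * P -> P / 2 <= U + D ->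
  c * P * x ^+ 2 <= n * (x * (U - D)) ->
  e * (A * n + x ^+ 2) = 2 * (8 * x ^+ 2 + 2) ->
  P * (A * n + x ^+ 2) <=
  n * (2 * (x * (U - D)) + (U + D) * (1 - e)) * (8 * A).
Proof.
move=> hr /andP[c0 c1] A1 Ac n1 P0 UD2 a1 dr ez.
have n0 : 0 < n by clear -n1; lra.
have x20 : 0 <= x ^+ 2 by apply: sqr_ge0.
have A0 : 0 < 8 * A by clear -A1; lra.
have M1 : 2048 <= A * n by clear -A1 n1; nra.
have z0 : 0 < A * n + x ^+ 2 by clear -M1 x20; lra.
have UD0 : 0 <= U + D by clear -P0 a1; lra.
have Px0 : 0 <= P * x ^+ 2 by rewrite mulr_ge0.
have [xs|xl] := leP (64 * x ^+ 2) (A * n).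
  have e12 : e <= 2^-1 by rewrite -(ler_pM2r z0) ez; clear -xs M1; lra.
  have h3 : (U + D) * 2^-1 <= (U + D) * (1 - e).
    by rewrite ler_wpM2l //; clear -e12; lra.
  have h4 : 0 <= x * (U - D).
    by rewrite -(pmulr_rge0 _ n0); apply: le_trans dr; rewrite -mulrA mulr_ge0 // ltW.
  have W1 : n * (P / 4) <= n * (2 * (x * (U - D)) + (U + D) * (1 - e)).
    by rewrite ler_pM2l //; clear -h3 h4 a1; lra.
  apply: le_trans (ler_wpM2r (ltW A0) W1).
  have zM : A * n + x ^+ 2 <= 2 * (A * n) by clear -xs x20; lra.
  by have := ler_wpM2l P0 zM; clear; lra.
have e16 : e <= 16 by rewrite -(ler_pM2r z0) ez; clear -x20 M1; lra.
have W1 : c * (P * x ^+ 2) <= n * (2 * (x * (U - D)) + (U + D) * (1 - e)).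
  have h3 : (2 * rr * P) * (-15) <= (U + D) * (1 - e).
    have : (U + D) * (-15) <= (U + D) * (1 - e) by rewrite ler_wpM2l //; clear -e16; lra.
    by clear -UD2; lra.
  have h4 := ler_wpM2l (ltW n0) h3.
  have h5 : 32 * (rr * (n * P)) <= c * (P * x ^+ 2).
    have := ler_wpM2l (ltW c0) (ltW xl); have -> : c * (A * n) = 2048 * (rr * n).
      by rewrite mulrA [c * A]mulrC Ac mulrA.
    by move=> /(ler_wpM2l P0); clear; lra.
  have h6 : 0 <= rr * (n * P) by rewrite !mulr_ge0 ?(ltW n0) //; clear -hr; lra.
  by rewrite mulrDr; clear -h4 h5 h6 dr; lra.
apply: le_trans (ler_wpM2r (ltW A0) W1).
have -> : c * (P * x ^+ 2) * (8 * A) = 8 * (A * c) * (P * x ^+ 2) by ring.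
rewrite Ac.
have h : P * (A * n + x ^+ 2) <= 65 * (P * x ^+ 2).
  by rewrite mulrCA ler_wpM2l //; clear -xl; lra.
by apply: le_trans h _; rewrite ler_wpM2r //; clear -hr; lra.
Qed.

(** Bounds the height of the regularised potential at a count [t] by [log t]: far
    below the unstable point [q n] the squared distance has order [n ^ 2], and
    otherwise [t] has order [n]. *)
Lemma unstable_log_gap (A n t q : R) : 1 <= A -> 1 <= n -> 1 <= t -> 0 < q < 1 ->
  (A + 1) * n ^+ 2 <= (A * n + (t - q * n) ^+ 2) * (t * (4 * (A + 1) / q ^+ 2)).
Proof.
move=> A1 n1 t1 /andP[q0 q1].
have q20 : 0 < q ^+ 2 by rewrite exprn_gt0.
rewrite !mulrA ler_pdivlMr //.
have n20 : 0 <= n ^+ 2 by apply: sqr_ge0.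
have d20 := sqr_ge0 (t - q * n).
have A10 : 0 <= A + 1 by clear -A1; lra.
have A0 : 0 <= A by clear -A1; lra.
have n0 : 0 <= n by clear -n1; lra.
have t0 : 0 <= t by clear -t1; lra.
have An0 : 0 <= A * n by rewrite mulr_ge0.
have [h|h] := leP (2 * t) (q * n).
  have h1 : (q * n) ^+ 2 <= 4 * (t - q * n) ^+ 2.
    rewrite -subr_ge0 (_ : _ - _ = (q * n - 2 * t) * (3 * (q * n) - 2 * t)); last by ring.
    by rewrite mulr_ge0 //; clear -h t0; lra.
  have h2 : (q * n) ^+ 2 <= (A * n + (t - q * n) ^+ 2) * t * 4.
    apply: le_trans h1 _; rewrite mulrC ler_pM2r //.
    by rewrite -[leLHS]mulr1 ler_pM // lerDr.
  by have := ler_wpM2r A10 h2; rewrite exprMn; clear; lra.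
have h1 : A * n * (q * n) <= (A * n + (t - q * n) ^+ 2) * (2 * t).
  apply: ler_pM => //; last exact: ltW.
    by rewrite mulr_ge0 // ltW.
  by rewrite lerDl.
have h2 : n ^+ 2 * q ^+ 2 <= A * n * (q * n).
  have -> : A * n * (q * n) = n ^+ 2 * (A * q) by ring.
  rewrite ler_wpM2l // expr2 ler_wpM2r ?(ltW q0) //; clear -A1 q1; lra.
have := ler_wpM2r A10 (le_trans h2 h1).
have : 0 <= (A * n + (t - q * n) ^+ 2) * (2 * t) by apply: mulr_ge0;
  [exact: addr_ge0|exact: mulr_ge0].
by move=> /(mulr_ge0 A10); clear; lra.
Qed.

End RegularisedDistance.

Section TwoAttractors.
Variables (R : realType) (F : R -> R) (rr r2 ps c : R).
Hypothesis rr1 : 1 <= rr.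
Hypothesis F01 : forall p : R, 0 <= p <= 1 -> 0 <= F p <= 1.
Hypothesis F_lin0 : forall p : R, 0 <= p <= 1 -> F p <= rr * p.
Hypothesis F_lin1 : forall p : R, 0 <= p <= 1 -> 1 - F p <= rr * (1 - p).
Hypothesis F_quad0 : forall p : R, 0 <= p <= 1 -> F p <= r2 * p ^+ 2.
Hypothesis F_quad1 : forall p : R, 0 <= p <= 1 -> 1 - F p <= r2 * (1 - p) ^+ 2.
Hypotheses (r20 : 0 <= r2) (ps01 : 0 < ps < 1) (c01 : 0 < c <= 1).
Hypothesis F_unstable : forall p : R, 0 <= p <= 1 ->
  c * (p * (1 - p)) * (p - ps) ^+ 2 <= (p - ps) * (F p - p).
Implicit Types (N s : nat).

(* A large multiple of the ratio of noise to drift, so that the drift dominates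
   beyond a distance of order [sqrt (A N)]. *)
Let A : R := 2048 * rr / c.

Let A_ge : 2048 <= A /\ A * c = 2048 * rr.
Proof.
have := rr1; have /andP[c0 c1] := c01 => hr.
have Ac : A * c = 2048 * rr by rewrite /A divfK // gt_eqF.
split=> //; rewrite -(ler_pM2r c0) Ac; nra.
Qed.

Let dist2 N s : R := (s%:R - ps * N%:R) ^+ 2.

(** The squared distance to the unstable point, regularised at the diffusive scale
    [sqrt N], grows by a constant factor in time of order [N], as long as the count
    stays away from the endpoints. *)
Let bd_gen_dist N s : (0 < s < N)%N ->
  s%:R / N%:R * (1 - s%:R / N%:R) / (8 * A) <=
  N%:R * bd_gen F N (fun k => ln (A * N%:R + dist2 N k)) s.
Proof.
move=> /[dup] sN /andP[s0 sN'].
have U0 := bd_up_ge0 F01 sN; have D0 := bd_down_ge0 F01 sN.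
have n1 : 1 <= N%:R :> R by rewrite ler1n (leq_ltn_trans _ sN').
have n0 : 0 < N%:R :> R by rewrite ltr0n (leq_ltn_trans _ sN').
have [u1 d1 a1] := bd_rates F01 F_lin0 F_lin1 sN; have /andP[p0 p1] := freq_bounds R sN.
have p01 : 0 <= (s%:R / N%:R : R) <= 1 by rewrite !ltW.
have dr := F_unstable p01; have [A1 Ac] := A_ge.
have P0 : 0 <= s%:R / N%:R * (1 - s%:R / N%:R) :> R.
  by case/andP: p01 => ? ?; rewrite mulr_ge0 // subr_ge0.
pose x := s%:R - ps * N%:R.
rewrite -bd_drift (_ : s%:R / N%:R - ps = x / N%:R) in dr; last first.
  by rewrite /x mulrBl mulfK // gt_eqF.
have M1 : 2048 <= A * N%:R by nra.
have z0 : 0 < A * N%:R + x ^+ 2 by rewrite ltr_wpDr ?sqr_ge0 //; lra.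
pose e := 2 * (8 * x ^+ 2 + 2) / (A * N%:R + x ^+ 2).
have ez : e * (A * N%:R + x ^+ 2) = 2 * (8 * x ^+ 2 + 2) by rewrite /e divfK // gt_eqF.
rewrite ler_pdivrMr; last by lra.
rewrite -(ler_pM2r z0).
have {}dr : c * (s%:R / N%:R * (1 - s%:R / N%:R)) * x ^+ 2 <=
    N%:R * (x * (bd_up F N s - bd_down F N s)).
  have := ler_wpM2l (exprn_ge0 2 (ltW n0)) dr.
  move: (s%:R / N%:R * (1 - s%:R / N%:R)) (bd_up F N s - bd_down F N s) => P B.
  have nE : x = x / N%:R * N%:R by rewrite divfK // gt_eqF.
  rewrite [in X in _ -> X]nE.
  have -> : N%:R ^+ 2 * (c * P * (x / N%:R) ^+ 2) = c * P * (x / N%:R * N%:R) ^+ 2 by ring.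
  by have -> : N%:R ^+ 2 * (x / N%:R * B) = N%:R * (x / N%:R * N%:R * B) by ring.
apply: le_trans (diffusive_balance rr1 c01 A1 Ac n1 P0 _ a1 dr ez) _.
  by lra.
rewrite [leRHS]mulrAC ler_wpM2r //; first by lra.
rewrite -[leRHS]mulrA ler_wpM2l ?(ltW n0) //.
apply: le_trans (ln_sq_step _ U0 D0 ez) _; first by lra.
have -> : bd_gen F N (fun k => ln (A * N%:R + dist2 N k)) s =
   bd_up F N s * (ln (A * N%:R + (x + 1) ^+ 2) - ln (A * N%:R + x ^+ 2)) -
   bd_down F N s * (ln (A * N%:R + x ^+ 2) - ln (A * N%:R + (x - 1) ^+ 2)).
  rewrite /bd_gen /dist2.
  have -> : s.-1%:R = s%:R - 1 :> R by rewrite -{2}(prednK s0) -natr1 addrK.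
  have -> : s.+1%:R = s%:R + 1 :> R by rewrite natr1.
  have -> : s%:R + 1 - ps * N%:R = x + 1 by rewrite /x; ring.
  by have -> : s%:R - 1 - ps * N%:R = x - 1 by rewrite /x; ring.
by [].
Qed.

Let bd_gen_ends N s : (0 < s < N)%N ->
  N%:R * bd_gen F N (fun k => harm R k + harm R (N - k)) s <=
  -1 + 4 * (1 + r2) * (s%:R / N%:R * (1 - s%:R / N%:R)).
Proof.
move=> sN; have h1 := bd_gen_harm F01 sN; have h2 := bd_gen_harm_rev F01 sN.
have /andP[p0 p1] := freq_bounds R sN; rewrite bd_genD mulrDr.
set p := s%:R / N%:R in p0 p1 h1 h2 *.
have p01 : 0 <= p <= 1 by rewrite !ltW.
apply: le_trans (lerD h1 h2) _.
have q0 : 0 < 1 - p by lra.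
have -> : (F p - p) / p - (F p - p) / (1 - p) = (F p - p) * (1 - 2 * p) / (p * (1 - p)).
  by field; rewrite !gt_eqF.
rewrite ler_pdivrMr ?(mulr_gt0 p0 q0) //; have f0 := F_quad0 p01; have f1 := F_quad1 p01.
have hr := r20.
have [h|h] := leP p 2^-1.
  have a1 : (F p - p) * (1 - 2 * p) <= (r2 * p ^+ 2 - p) * (1 - 2 * p).
    by rewrite ler_wpM2r //; lra.
  apply: le_trans a1 _.
  have a2 : p ^+ 2 <= 4 * (p * (1 - p)) ^+ 2.
    by rewrite -subr_ge0 (_ : _ - _ = p ^+ 2 * ((1 - 2 * p) * (3 - 2 * p)));
      [rewrite mulr_ge0 ?sqr_ge0 ?mulr_ge0 //; lra|ring].
  have a3 : (1 + r2) * p ^+ 2 <= (1 + r2) * (4 * (p * (1 - p)) ^+ 2) by rewrite ler_wpM2l //; lra.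
  have a4 : 0 <= r2 * p ^+ 2 * (2 * p) by rewrite !mulr_ge0 ?sqr_ge0 //; lra.
  lra.
have a1 : (F p - p) * (1 - 2 * p) <= ((1 - p) - r2 * (1 - p) ^+ 2) * (1 - 2 * p).
  by rewrite ler_wnM2r //; lra.
apply: le_trans a1 _.
have a2 : (1 - p) ^+ 2 <= 4 * (p * (1 - p)) ^+ 2.
  by rewrite -subr_ge0 (_ : _ - _ = (1 - p) ^+ 2 * ((2 * p - 1) * (2 * p + 1)));
    [rewrite mulr_ge0 ?sqr_ge0 ?mulr_ge0 //; lra|ring].
have a3 : (1 + r2) * (1 - p) ^+ 2 <= (1 + r2) * (4 * (p * (1 - p)) ^+ 2)
  by rewrite ler_wpM2l //; lra.
have a4 : 0 <= r2 * (1 - p) ^+ 2 * (2 * (1 - p)) by rewrite !mulr_ge0 ?sqr_ge0 //; lra.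
lra.
Qed.

(** Near an attracting endpoint the sum of the two harmonic terms decreases at
    rate [1 / N]; away from the endpoints the growth of [dist2] takes over. *)
Lemma two_attractors_time_ubound : exists2 C : R, 0 < C & forall N, (0 < N)%N ->
  time_ubound F N (fun s => C * (N%:R * (1 + ln (minn s (N - s))%:R))).
Proof.
have [A1 _] := A_ge; have hr := r20; have /andP[ps0 ps1] := ps01.
pose K := 4 * (1 + r2) * (8 * A); have K0 : 0 < K by apply: mulr_gt0; lra.
pose E := 4 * (A + 1) / (ps * (1 - ps)) ^+ 2.
have pp0 : 0 < ps * (1 - ps) by rewrite mulr_gt0 // subr_gt0.
have pp1 : ps * (1 - ps) <= 1 by nra.
have E1 : 1 <= E.
  rewrite ler_pdivlMr ?exprn_gt0 // mul1r; apply: (@le_trans _ _ 1); last by lra.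
  by rewrite exprn_ile1 // ltW.
have E0 : 0 < E by lra.
have lnE0 : 0 <= ln E by apply: ln_ge0.
have KE0 : 0 <= K * ln E by rewrite mulr_ge0 // ltW.
exists (1 + K + K * ln E) => [|N N0]; first by lra.
have n1 : 1 <= N%:R :> R by rewrite ler1n.
have n0 : 0 < N%:R :> R by lra.
have A11 : 1 <= A by lra.
have M0 k : 0 < A * N%:R + dist2 N k.
  by apply: ltr_wpDr; [exact: sqr_ge0|apply: mulr_gt0 => //; lra].
pose L : R := ln ((A + 1) * N%:R ^+ 2).
have AN0 : 0 < (A + 1) * N%:R ^+ 2 by apply: mulr_gt0; [lra|exact: exprn_gt0].
apply: (@time_ubound_scale _ _ _ (fun k => N%:R * ((harm R k + harm R (N - k) - harm R N) +
   K * (L - ln (A * N%:R + dist2 N k)))) _ 1) => // s sN.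
- rewrite bd_genZ bd_genD bd_gen_addc bd_genZ mulrDr.
  have -> : bd_gen F N (fun k => L - ln (A * N%:R + dist2 N k)) s =
     - bd_gen F N (fun k => ln (A * N%:R + dist2 N k)) s by rewrite /bd_gen; ring.
  have h1 := bd_gen_ends sN; have h2 := bd_gen_dist sN.
  have h3 := ler_wpM2l (ltW K0) h2.
  have e : K * (s%:R / N%:R * (1 - s%:R / N%:R) / (8 * A)) =
     4 * (1 + r2) * (s%:R / N%:R * (1 - s%:R / N%:R)).
    by rewrite /K; field; rewrite !gt_eqF //; lra.
  rewrite e in h3; rewrite mulrN mulrN mulrCA; lra.
- have hs := harmD R s (N - s); rewrite subnKC // in hs.
  apply: mulr_ge0 (ltW n0) _; apply: addr_ge0; first by lra.
  apply: mulr_ge0 (ltW K0) _; rewrite subr_ge0 ler_ln ?posrE //.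
  have x0 : 0 <= s%:R :> R by []; have xN : s%:R <= N%:R :> R by rewrite ler_nat.
  have : dist2 N s <= N%:R ^+ 2.
    have h1 : 0 <= ps * N%:R by rewrite mulr_ge0 // ltW.
    have h2 : ps * N%:R <= N%:R by rewrite ler_piMl // ltW.
    rewrite /dist2 -subr_ge0 subr_sqr; apply: mulr_ge0; lra.
  have : A * N%:R <= A * N%:R ^+ 2 by apply: ler_wpM2l; [lra|rewrite expr2 ler_peMr //; lra].
  lra.
- rewrite mul1r mulrCA ler_pM2l //.
  have /andP[s0 sN'] := sN.
  have br t q : (0 < t)%N -> (t%:R - q * N%:R) ^+ 2 = dist2 N s -> 0 < q < 1 ->
      (ps * (1 - ps)) ^+ 2 <= q ^+ 2 -> L - ln (A * N%:R + dist2 N s) <= ln t%:R + ln E.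
    move=> t0 tq q01 pq; have /andP[q0 q1] := q01.
    have t1 : 1 <= t%:R :> R by rewrite ler1n.
    have t0' : 0 < t%:R :> R by rewrite ltr0n.
    have tE0 : 0 < t%:R * E by apply: mulr_gt0.
    rewrite /L lerBlDl -lnM ?posrE // -lnM ?posrE // ler_ln ?posrE //; last exact: mulr_gt0.
    apply: le_trans (unstable_log_gap A11 n1 t1 q01) _; rewrite tq ler_pM2l // ler_pM2l //.
    by rewrite /E ler_pM2l ?lef_pV2 ?posrE ?exprn_gt0 //; lra.
  have q1 : (ps * (1 - ps)) ^+ 2 <= ps ^+ 2.
    by rewrite lerXn2r ?nnegrE //; nra.
  have q2 : (ps * (1 - ps)) ^+ 2 <= (1 - ps) ^+ 2.
    by rewrite lerXn2r ?nnegrE //; nra.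
  have b1 := br s ps s0 erefl ps01 q1.
  have b2 := br (N - s)%N (1 - ps) _ _ _ q2.
  have {}b2 : L - ln (A * N%:R + dist2 N s) <= ln (N - s)%:R + ln E.
    apply: b2; first by rewrite subn_gt0.
    - by rewrite /dist2 natrB ?(ltnW sN') //; ring.
    - by apply/andP; split; lra.
  have k1 := ler_wpM2l (ltW K0) b1; have k2 := ler_wpM2l (ltW K0) b2.
  have m1 : harm R s <= harm R N by apply/harm_le/ltnW.
  have m2 : harm R (N - s) <= harm R N by apply/harm_le/leq_subr.
  have [sh|sh] := leqP s (N - s).
    have l0 : 0 <= ln s%:R :> R by rewrite ln_ge0 // ler1n.
    have := mulr_ge0 KE0 l0; have := harm_le_ln R s0; lra.
  have d0 : (0 < N - s)%N by rewrite subn_gt0.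
  have l0 : 0 <= ln (N - s)%:R :> R by rewrite ln_ge0 // ler1n.
  have := mulr_ge0 KE0 l0; have := harm_le_ln R d0; lra.
Qed.

End TwoAttractors.

(** * Degenerate rules *)

Section SqrtStep.
Variable R : realType.

Lemma sqrt_steps (a b c : R) : 0 <= a -> 1 <= b -> 0 <= c ->
  a ^+ 2 = b ^+ 2 + 1 -> c ^+ 2 = b ^+ 2 - 1 ->
  a - b <= (2 * b)^-1 /\ (5 * b ^+ 3)^-1 <= 2 * b - a - c.
Proof.
move=> a0 b1 c0 a2 c2; have b0 : 0 < b by lra.
have ab : b <= a by rewrite -(ler_pXn2r (ltn0Sn 1)) ?nnegrE ?(ltW b0) // a2; lra.
have cb : c <= b by rewrite -(ler_pXn2r (ltn0Sn 1)) ?nnegrE ?(ltW b0) // c2; lra.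
have ab2 : a <= 3 / 2 * b.
  by rewrite -(ler_pXn2r (ltn0Sn 1)) ?nnegrE //; [rewrite exprMn a2; nra|lra].
have acb : a + c <= 2 * b.
  rewrite -(ler_pXn2r (ltn0Sn 1)) ?nnegrE; [|lra|lra].
  by have := sqr_ge0 (a - c); rewrite exprMn; nra.
split.
  rewrite -[leRHS]mul1r ler_pdivlMr ?mulr_gt0 //.
  have : (a - b) * (a + b) = 1 by rewrite -subr_sqr a2; ring.
  nra.
pose W := (a + b) * (b + c) * (a + c).
have WE : (2 * b - a - c) * W = 2.
  have -> : (2 * b - a - c) * W = ((b ^+ 2 - c ^+ 2) * (a + b)
     - (a ^+ 2 - b ^+ 2) * (b + c)) * (a + c) by rewrite /W; ring.
  by rewrite a2 c2; move: (a2) (c2); nra.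
have W0 : 0 < W by rewrite /W !mulr_gt0 //; lra.
have WB : W <= 10 * b ^+ 3.
  have -> : 10 * b ^+ 3 = (5 / 2 * b) * (2 * b) * (2 * b) by field.
  by apply: ler_pM; [apply: mulr_ge0; lra|lra|apply: ler_pM; lra|lra].
have Wn : W != 0 by rewrite gt_eqF.
rewrite (canRL (mulfK Wn) WE) ler_pdivlMr // mulrC ler_pdivrMr; first by lra.
by rewrite mulr_gt0 ?exprn_gt0.
Qed.

(** Here [d1] and [d2] are the first and second difference of the square root at
    [b ^ 2]. The concavity gain, of order [b ^- 3], times the noise [p (1 - p)]
    exceeds a drift [U - D] of at most [(1 - p) / (40 n)]. *)
Lemma sqrt_balance (n p U D d1 d2 b t : R) : 0 < n -> 1 <= b -> p * n = b ^+ 2 ->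
  p <= 1 -> 0 <= D -> 0 <= U - D -> p * (1 - p) / 2 <= U + D ->
  n * (U - D) <= (1 - p) / 40 -> d1 <= (2 * b)^-1 -> (5 * b ^+ 3)^-1 <= d2 -> b <= t ->
  n * t * ((U - D) * d1 - D * d2) <= - ((1 - p) / 40).
Proof.
move=> n0 b1 pn p1 D0 B0 a1 B1 h1 h2 bt.
have b0 : 0 < b by lra.
pose i := b^-1; have i0 : 0 < i by rewrite invr_gt0.
have bi : b * i = 1 by rewrite divff // gt_eqF.
have i1 : i <= 1 by rewrite invf_le1.
have e1 : (2 * b)^-1 = i / 2 by rewrite invfM mulrC.
have e2 : (5 * b ^+ 3)^-1 = i ^+ 3 / 5 by rewrite invfM mulrC exprVn.
rewrite e1 in h1; rewrite e2 in h2.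
have q0 : 0 <= 1 - p by lra.
have i3 : i ^+ 3 <= i by rewrite exprS ler_piMr ?exprn_ile1 ?(ltW i0).
have i30 : 0 <= i ^+ 3 by rewrite exprn_ge0 // ltW.
have k1 := ler_wpM2l B0 h1; have k2 := ler_wpM2l D0 h2.
have k3 : (p * (1 - p) / 4 - (U - D) / 2) * i ^+ 3 <= D * i ^+ 3.
  by rewrite ler_wpM2r //; lra.
have k4 : (U - D) * d1 - D * d2 <=
    (U - D) * (i / 2) - (p * (1 - p) / 4 - (U - D) / 2) * i ^+ 3 / 5 by lra.
have k5 := ler_wpM2l (ltW n0) k4.
have k6 : n * (p * (1 - p)) * i ^+ 3 = (1 - p) * i.
  have -> : n * (p * (1 - p)) * i ^+ 3 = (p * n) * (1 - p) * i ^+ 3 by ring.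
  rewrite pn; have -> : b ^+ 2 * (1 - p) * i ^+ 3 = (b * i) ^+ 2 * ((1 - p) * i) by ring.
  by rewrite bi expr1n mul1r.
have k7 : n * (U - D) * i ^+ 3 <= (1 - p) / 40 * i.
  by apply: ler_pM => //; rewrite mulr_ge0 // ltW.
have k8 : n * (U - D) * i <= (1 - p) / 40 * i by rewrite ler_wpM2r // ltW.
have qi : 0 <= (1 - p) * i by rewrite mulr_ge0 // ltW.
have k9 : n * ((U - D) * d1 - D * d2) <= - ((1 - p) * i / 40) by lra.
have t0 : 0 <= t by lra.
have := ler_wpM2l t0 k9.
have : (1 - p) * 1 <= (1 - p) * (t * i) by rewrite ler_wpM2l // -bi ler_wpM2r // ltW.
lra.
Qed.

Lemma reciprocal_balance (B a z : R) : 1 < z -> a <= B * z / 2 -> 0 <= B ->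
  (a - B * z) / (z * (z ^+ 2 - 1)) <= - (B / (2 * z ^+ 2)).
Proof.
move=> z1 aB B0; have z0 : 0 < z by lra.
have z20 : 0 < z ^+ 2 - 1 by rewrite subr_gt0 -(expr1n R 2) ltrXn2r ?nnegrE // ltW.
have z2 : 0 < z ^+ 2 by rewrite exprn_gt0.
have d0 : 0 < z * (z ^+ 2 - 1) by rewrite mulr_gt0.
apply: (@le_trans _ _ (- (B * z / 2) / (z * (z ^+ 2 - 1)))).
  by rewrite ler_pM2r ?invr_gt0 //; lra.
have -> : - (B * z / 2) / (z * (z ^+ 2 - 1)) = - (B / (2 * (z ^+ 2 - 1))).
  by field; rewrite !gt_eqF.
rewrite lerN2 ler_wpM2l // lef_pV2 ?posrE ?mulr_gt0 //.
by rewrite ler_pM2l //; lra.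
Qed.

End SqrtStep.

Section Degenerate.
Variables (R : realType) (F : R -> R) (rr Cm : R) (m : nat).
Hypothesis rr1 : 1 <= rr.
Hypothesis F01 : forall p : R, 0 <= p <= 1 -> 0 <= F p <= 1.
Hypothesis F_lin0 : forall p : R, 0 <= p <= 1 -> F p <= rr * p.
Hypothesis F_lin1 : forall p : R, 0 <= p <= 1 -> 1 - F p <= rr * (1 - p).
Hypotheses (Cm1 : 1 <= Cm) (m2 : (2 <= m)%N).
Hypothesis F_drift : forall p : R, 0 <= p <= 1 ->
  p ^+ m * (1 - p) <= F p - p <= Cm * (p ^+ m * (1 - p)).
Implicit Types (N s : nat) (g h : nat -> R) (sg : R).

Lemma bd_gen_min N s g h : (0 < s < N)%N -> g s <= h s ->
  bd_gen F N (fun k => Num.min (g k) (h k)) s <= bd_gen F N g s.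
Proof.
move=> sN gh; have U0 := bd_up_ge0 F01 sN; have D0 := bd_down_ge0 F01 sN.
rewrite /bd_gen (min_l gh) lerB // ler_wpM2l // ?lerD2r ?ge_min ?lexx //.
by rewrite lerD2l lerN2 ge_min lexx.
Qed.

Lemma bd_gen_max0 N s g : (0 < s < N)%N ->
  (0 <= g s -> bd_gen F N g s <= bd_gen F N (fun k => Num.max 0 (g k)) s) /\
  (g s <= 0 -> 0 <= bd_gen F N (fun k => Num.max 0 (g k)) s).
Proof.
move=> sN; have U0 := bd_up_ge0 F01 sN; have D0 := bd_down_ge0 F01 sN.
have m0 k : 0 <= Num.max 0 (g k) by rewrite le_max lexx.
have mg k : g k <= Num.max 0 (g k) by rewrite le_max lexx orbT.
split=> gs; rewrite /bd_gen.
  rewrite (max_r gs) lerB // ler_wpM2l // ?lerD2r ?mg //.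
  by rewrite lerD2l lerN2 mg.
rewrite (max_l gs) subr0 sub0r mulrN opprK.
by apply: addr_ge0; apply: mulr_ge0.
Qed.

(* The scale at which drift and noise balance: [sg = N ^ (1 - 1 / m)]. *)
Section Scale.
Variables (N : nat) (sg : R).
Hypotheses (N0 : (0 < N)%N) (sg0 : 0 < sg) (sgE : sg ^+ m = N%:R ^+ m.-1).
Let n0 : 0 < N%:R :> R. Proof. by rewrite ltr0n. Qed.

Let mS : m = m.-1.+1. Proof. by rewrite prednK // (leq_trans _ m2). Qed.

(** At the scale [sg] the drift in time [N] is a power of the rescaled count. *)
Lemma scaled_drift s : N%:R * (s%:R / N%:R) ^+ m = (s%:R / sg) ^+ m :> R.
Proof.
rewrite !expr_div_n sgE {2}mS exprS invfM mulrCA; congr (_ * _).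
by rewrite mulrA divff ?mul1r // gt_eqF.
Qed.

Lemma scale_le : sg <= N%:R.
Proof.
have mP : (0 < m)%N by rewrite (leq_trans _ m2).
rewrite -(ler_pXn2r mP) ?nnegrE ?(ltW sg0) ?(ltW n0) // sgE.
by apply: ler_weXn2l; [rewrite ler1n|exact: leq_pred].
Qed.

Lemma scale_sqr : N%:R <= sg ^+ 2.
Proof.
have mP : (0 < m)%N by rewrite (leq_trans _ m2).
rewrite -(ler_pXn2r mP) ?nnegrE ?exprn_ge0 ?(ltW sg0) ?(ltW n0) //.
rewrite -exprM mulnC exprM sgE -exprM; apply: ler_weXn2l; first by rewrite ler1n.
by move: m2; case: (m) => [|[|k]] //= _; lia.
Qed.

Lemma harm_scale : harm R N <= 2 * sg.
Proof.
apply: le_trans (harm_le_ln R N0) _.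
have : ln (N%:R : R) <= ln (sg ^+ 2) by rewrite ler_ln ?posrE ?exprn_gt0 // scale_sqr.
rewrite lnXn // -mulr_natl; have := ln_ubound sg0; lra.
Qed.

Lemma bd_gen_sqrt s (u := s%:R / sg) : (0 < s < N)%N -> u <= 1 -> Cm * (40 * u ^+ m) <= 1 ->
  N%:R * Num.sqrt sg * bd_gen F N (fun k => Num.sqrt k%:R) s <= - ((1 - s%:R / N%:R) / 40).
Proof.
move=> /[dup] sN /andP[s0 sN'] u1 hu.
have U0 := bd_up_ge0 F01 sN; have D0 := bd_down_ge0 F01 sN.
have [_ _ a1] := bd_rates F01 F_lin0 F_lin1 sN; have /andP[p0 p1] := freq_bounds R sN.
have p01 : 0 <= (s%:R / N%:R : R) <= 1 by rewrite !ltW.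
have /andP[dl du] := F_drift p01; rewrite -bd_drift in dl du.
have E := scaled_drift s; rewrite -/u in E.
have x1 : 1 <= s%:R :> R by rewrite ler1n.
have x0 : 0 < s%:R :> R by rewrite ltr0n.
set a := Num.sqrt (s.+1%:R : R); set b := Num.sqrt (s%:R : R); set c := Num.sqrt (s.-1%:R : R).
have b2 : b ^+ 2 = s%:R by rewrite sqr_sqrtr.
have b1 : 1 <= b by rewrite -sqrtr1 ler_wsqrtr.
have [h1 h2] : a - b <= (2 * b)^-1 /\ (5 * b ^+ 3)^-1 <= 2 * b - a - c.
  apply: sqrt_steps; rewrite ?sqrtr_ge0 // !sqr_sqrtr ?ler0n //.
    by rewrite natr1.
  by rewrite -{2}(prednK s0) -natr1 addrK.
have bsg : b <= Num.sqrt sg.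
  by rewrite ler_wsqrtr //; move: u1; rewrite /u ler_pdivrMr // mul1r.
have -> : bd_gen F N (fun k => Num.sqrt k%:R) s =
  (bd_up F N s - bd_down F N s) * (a - b) - bd_down F N s * (2 * b - a - c).
  by rewrite /bd_gen -/a -/b -/c; ring.
have dr : 0 <= bd_up F N s - bd_down F N s.
  by apply: le_trans dl; rewrite mulr_ge0 ?exprn_ge0 ?subr_ge0 ?ltW.
apply: (sqrt_balance n0 b1 _ (ltW p1) D0 dr a1 _ h1 h2 bsg).
  by rewrite b2 divfK // gt_eqF.
apply: le_trans (ler_wpM2l (ltW n0) du) _.
have -> : N%:R * (Cm * ((s%:R / N%:R) ^+ m * (1 - s%:R / N%:R))) =
  Cm * (N%:R * (s%:R / N%:R) ^+ m) * (1 - s%:R / N%:R) by ring.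
rewrite E [leRHS]mulrC ler_pM2r ?subr_gt0 //.
by rewrite -[leRHS]mul1r ler_pdivlMr // -mulrA [u ^+ m * _]mulrC.
Qed.

Lemma bd_gen_reciprocal s (u := s%:R / sg) (b v : R) : (0 < s < N)%N -> 0 < v <= u ->
  0 < b -> 4 * rr = b * v ^+ m.-1 ->
  N%:R * sg ^+ 2 * bd_gen F N (fun k => (k%:R + b * sg)^-1) s <=
  - ((1 - s%:R / N%:R) * (v ^+ (m - 2) / (2 * (1 + b / v) ^+ 2))).
Proof.
move=> /[dup] sN /andP[s0 sN'] /andP[v0 vu] b0 bv.
have [uu ud _] := bd_rates F01 F_lin0 F_lin1 sN; have /andP[p0 p1] := freq_bounds R sN.
have p01 : 0 <= (s%:R / N%:R : R) <= 1 by rewrite !ltW.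
have /andP[dl _] := F_drift p01; rewrite -bd_drift in dl.
have E := scaled_drift s; rewrite -/u in E.
have x1 : 1 <= s%:R :> R by rewrite ler1n.
have x0 : 0 < s%:R :> R by rewrite ltr0n.
have u0 : 0 < u by apply: lt_le_trans vu.
have q0 : 0 < 1 - s%:R / N%:R :> R by rewrite subr_gt0.
have bs0 : 0 < b * sg by rewrite mulr_gt0.
pose z := s%:R + b * sg; have z1 : 1 < z by rewrite /z; move: x1 bs0; lra.
have zE : z = sg * (u + b) by rewrite /z /u; field; rewrite gt_eqF.
have dr : 0 <= bd_up F N s - bd_down F N s.
  by apply: le_trans dl; rewrite mulr_ge0 ?exprn_ge0 ?subr_ge0 ?ltW.
have genE : bd_gen F N (fun k => (k%:R + b * sg)^-1) s =
  ((bd_up F N s + bd_down F N s) - (bd_up F N s - bd_down F N s) * z) /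
    (z * (z ^+ 2 - 1)).
  rewrite /bd_gen (_ : s.+1%:R + b * sg = z + 1); last by rewrite -natr1 /z; ring.
  rewrite (_ : s.-1%:R + b * sg = z - 1); last first.
    by rewrite /z -{2}(prednK s0) -natr1; ring.
  rewrite -/z; move: (bd_up F N s) (bd_down F N s) z1 => U D z1.
  field.
  have h1 : z - 1 != 0 by rewrite gt_eqF //; lra.
  have h2 : z + 1 != 0 by rewrite gt_eqF //; lra.
  have h3 : z != 0 by rewrite gt_eqF //; lra.
  have h4 : z ^+ 2 - 1 != 0 by rewrite -(expr1n R 2) subr_sqr mulf_neq0.
  by rewrite h1 h2 h3 h4.
have Nd : u ^+ m * (1 - s%:R / N%:R) <= N%:R * (bd_up F N s - bd_down F N s).
  by rewrite -E -mulrA ler_pM2l.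
have aB : bd_up F N s + bd_down F N s <= (bd_up F N s - bd_down F N s) * z / 2.
  rewrite -(ler_pM2l n0).
  have h1 : 4 * rr * s%:R <= u ^+ m * z.
    have h2 : v ^+ m.-1 <= u ^+ m.-1 by rewrite lerXn2r ?nnegrE ?(ltW v0) ?(ltW u0).
    have h3 : u ^+ m * z = u ^+ m.-1 * (u * sg) * (u + b).
      by rewrite zE {1}mS exprS; ring.
    have us : u * sg = s%:R by rewrite /u divfK // gt_eqF.
    have h4 : b * v ^+ m.-1 <= u ^+ m.-1 * (u + b).
      rewrite mulrC; apply: ler_pM => //; try exact: ltW.
        by rewrite exprn_ge0 // ltW.
      by rewrite lerDr ltW.
    by rewrite h3 us bv [leRHS]mulrAC ler_wpM2r // ltW.
  have h5 : (u ^+ m * (1 - s%:R / N%:R)) * z <= N%:R * (bd_up F N s - bd_down F N s) * z.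
    by rewrite ler_wpM2r // (le_trans _ (ltW z1)).
  have h6 := ler_wpM2l (ltW n0) (lerD uu ud).
  have h7 := ler_wpM2r (ltW q0) h1.
  have h8 : N%:R * (rr * (s%:R / N%:R * (1 - s%:R / N%:R))) = rr * s%:R * (1 - s%:R / N%:R).
    by field; rewrite gt_eqF.
  rewrite [X in _ <= X]mulrDr h8 in h6.
  apply: le_trans h6 _.
  move: h5 h7; rewrite mulrAC mulrA; lra.
have h1 := reciprocal_balance z1 aB dr; rewrite -genE in h1.
have c0 : 0 <= N%:R * sg ^+ 2 by rewrite mulr_ge0 ?exprn_ge0 // ltW.
apply: le_trans (ler_wpM2l c0 h1) _; rewrite mulrN lerN2.
have ub0 : 0 < u + b by rewrite addr_gt0.
have -> : N%:R * sg ^+ 2 * ((bd_up F N s - bd_down F N s) / (2 * z ^+ 2)) =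
   N%:R * (bd_up F N s - bd_down F N s) / (2 * (u + b) ^+ 2).
  by rewrite zE; field; rewrite !gt_eqF.
have w0 : 0 < 2 * (u + b) ^+ 2 by rewrite mulr_gt0 ?exprn_gt0.
have w1 : 0 < 2 * (1 + b / v) ^+ 2.
  by rewrite mulr_gt0 ?exprn_gt0 // addr_gt0 // divr_gt0.
rewrite ler_pdivlMr // (le_trans _ Nd) // [leRHS]mulrC -mulrA ler_pM2l //.
rewrite mulrAC ler_pdivrMr // mulrCA [leRHS]mulrCA ler_pM2l //.
have -> : u ^+ m = u ^+ (m - 2) * u ^+ 2 by rewrite -exprD subnK.
rewrite -mulrA; apply: ler_pM; [exact/exprn_ge0/ltW|exact/exprn_ge0/ltW| |].
  by rewrite lerXn2r ?nnegrE ?(ltW v0) ?(ltW u0).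
have ubv : u + b <= u * (1 + b / v).
  by rewrite mulrDr mulr1 lerD2l mulrCA ler_peMr ?(ltW b0) // ler_pdivlMr // mul1r.
by rewrite -exprMn lerXn2r ?nnegrE ?(ltW ub0) // (le_trans _ ubv) ?ltW.
Qed.

End Scale.

(** Below the scale [sg] noise dominates and a multiple of [sqrt s] is a
    supersolution; above it the drift dominates and a decreasing rational function
    is one. Their minimum interpolates, and the harmonic term takes over near the
    attracting endpoint. *)
Lemma degenerate_time_ubound : exists2 C : R, 0 < C & forall N sg, (0 < N)%N ->
  0 < sg -> sg ^+ m = N%:R ^+ m.-1 -> time_ubound F N (fun=> C * (N%:R * sg)).
Proof.
have hr := rr1; have hC := Cm1.
(* The square root is used up to [4 * u1 * sg] and the rational function from
   [u1 * sg] on; [v1] makes the drift negligible in the first range, and [b] makes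
   the noise negligible in the second. *)
have [v1 [v0 vle v1C]] : exists v1 : R, [/\ 0 < v1, v1 <= 1 & 160 * Cm * v1 ^+ 2 <= 1].
  exists (13 * Cm)^-1; have C0 : 0 < 13 * Cm by lra.
  split; first by rewrite invr_gt0.
    by rewrite invf_le1 //; lra.
  rewrite exprVn ler_pdivrMr ?exprn_gt0 // mul1r exprMn; nra.
pose u1 := v1 ^+ 2.
have u10 : 0 < u1 by rewrite exprn_gt0.
pose b := 4 * rr / u1 ^+ m.-1.
have b0 : 0 < b by rewrite divr_gt0 ?exprn_gt0 //; lra.
have bE : 4 * rr = b * u1 ^+ m.-1 by rewrite divfK // gt_eqF // exprn_gt0.
pose c2 := u1 ^+ (m - 2) / (2 * (1 + b / u1) ^+ 2).
have bu : 0 < 1 + b / u1 by apply: addr_gt0 => //; apply: divr_gt0.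
have c20 : 0 < c2 by apply: divr_gt0; [exact: exprn_gt0|apply: mulr_gt0 => //; exact: exprn_gt0].
pose C2 := c2^-1; have C20 : 0 < C2 by rewrite invr_gt0.
have C2c2 : C2 * c2 = 1 by rewrite mulVf // gt_eqF.
have Cb0 : 0 < C2 / b by apply: divr_gt0.
(* [T / v1] is the coefficient of the square root: with this value the two functions
   cross between [u1 * sg] and [4 * u1 * sg]. *)
pose T := 40 + C2 / b; have T40 : 40 <= T by rewrite /T; lra.
have T0 : 0 < T by lra.
have Tv : 40 <= T / v1 by rewrite ler_pdivlMr // (le_trans _ T40) // ler_piMr.
exists (2 ^+ m * (T + C2 / b + 2)) => [|N sg N0 sg0 sgE].
  by apply: mulr_gt0; [exact: exprn_gt0|lra].
have n0 : 0 < N%:R :> R by rewrite ltr0n.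
pose g1 (k : nat) : R := T / v1 * (N%:R * Num.sqrt sg * Num.sqrt k%:R).
pose g2 (k : nat) : R := N%:R * (sg * T) + C2 * (N%:R * sg ^+ 2 * (k%:R + b * sg)^-1).
have bs0 : 0 < b * sg by apply: mulr_gt0.
have kb (k : nat) : 0 < k%:R + b * sg by rewrite ltr_wpDl.
have Nsg0 : 0 < N%:R * sg by apply: mulr_gt0.
have N2 : 0 < N%:R * sg ^+ 2 by apply: mulr_gt0 => //; exact: exprn_gt0.
have g2lo (k : nat) : N%:R * (sg * T) < g2 k.
  by rewrite /g2 ltrDl mulr_gt0 // mulr_gt0 // invr_gt0.
have g2up (k : nat) : g2 k <= (T + C2 / b) * (N%:R * sg).
  have h : (k%:R + b * sg)^-1 <= (b * sg)^-1 by rewrite lef_pV2 ?posrE // lerDr.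
  have := ler_wpM2l (ltW C20) (ler_wpM2l (ltW N2) h).
  have -> : C2 * (N%:R * sg ^+ 2 * (b * sg)^-1) = C2 / b * (N%:R * sg).
    by field; rewrite !gt_eqF.
  by rewrite /g2; lra.
have g1E (k : nat) (w : R) : 0 <= w ->
    (N%:R * sg * (T / v1 * w) <= g1 k) = (w ^+ 2 * sg <= k%:R).
  move=> w0; have -> : N%:R * sg * (T / v1 * w) = T / v1 * (N%:R * Num.sqrt sg * (Num.sqrt sg * w)).
    by rewrite -{1}(sqr_sqrtr (ltW sg0)); ring.
  have sq0 : 0 < Num.sqrt sg by rewrite sqrtr_gt0.
  rewrite /g1 ler_pM2l ?(lt_le_trans _ Tv) // ler_pM2l ?mulr_gt0 //.
  rewrite -[LHS](ler_pXn2r (ltn0Sn 1)) ?nnegrE ?sqrtr_ge0 ?mulr_ge0 ?sqrtr_ge0 //.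
  by rewrite exprMn !sqr_sqrtr ?(ltW sg0) ?ler0n // [sg * _]mulrC.
have g1ge0 (k : nat) : 0 <= g1 k.
  by rewrite /g1 !mulr_ge0 ?sqrtr_ge0 // ?(ltW n0) ?invr_ge0 ?(ltW v0) ?(ltW T0).
have genmin s : (0 < s < N)%N ->
    bd_gen F N (fun k => Num.min (g1 k) (g2 k)) s <= - (1 - s%:R / N%:R).
  move=> sN; have /andP[p0 p1] := freq_bounds R sN.
  have q0 : 0 < 1 - s%:R / N%:R :> R by rewrite subr_gt0.
  have [g12|g21] := leP (g1 s) (g2 s).
    apply: le_trans (bd_gen_min sN g12) _; rewrite bd_genZ bd_genZ.
    have us : s%:R / sg <= 4 * u1.
      rewrite ler_pdivrMr // leNgt; apply/negP => sl.
      have := g1E s (2 * v1); rewrite exprMn -/u1 (_ : 2 ^+ 2 = 4); last by ring.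
      rewrite (ltW sl) => /(_ (mulr_ge0 (ler0n _ _) (ltW v0))) h.
      have {}h : N%:R * sg * (T / v1 * (2 * v1)) <= g1 s by rewrite h.
      have := le_trans h (le_trans g12 (g2up s)).
      have -> : N%:R * sg * (T / v1 * (2 * v1)) = (2 * T) * (N%:R * sg).
        by field; rewrite gt_eqF.
      by rewrite ler_pM2r // /T; lra.
    have u4 : 4 * u1 <= 1 by rewrite /u1; nra.
    have us0 : 0 <= s%:R / sg by rewrite divr_ge0 // ltW.
    have um : (s%:R / sg) ^+ m <= 4 * u1.
      apply: (le_trans _ us); rewrite -[leRHS]expr1; apply: ler_wiXn2l => //.
        exact: le_trans us u4.
      by rewrite (leq_trans _ m2).
    have h1 : Cm * (40 * (s%:R / sg) ^+ m) <= 1.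
      apply: le_trans v1C; rewrite mulrAC [leRHS]mulrC ler_pM2l; last by lra.
      by rewrite /u1 in um; lra.
    have h2 := bd_gen_sqrt N0 sg0 sgE sN (le_trans us u4) h1.
    have Tv0 : 0 < T / v1 by rewrite divr_gt0.
    have h3 := ler_wpM2l (ltW Tv0) h2; apply: le_trans h3 _.
    rewrite mulrN lerN2; have := ler_wpM2r (ltW q0) Tv; lra.
  have -> : bd_gen F N (fun k => Num.min (g1 k) (g2 k)) s =
      bd_gen F N (fun k => Num.min (g2 k) (g1 k)) s.
    by rewrite /bd_gen ![Num.min (g1 _) _]minC.
  apply: le_trans (bd_gen_min sN (ltW g21)) _.
  have -> : bd_gen F N g2 s = C2 * (N%:R * sg ^+ 2 * bd_gen F N (fun k => (k%:R + b * sg)^-1) s).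
    by rewrite /bd_gen /g2; ring.
  have su : u1 <= s%:R / sg.
    rewrite ler_pdivlMr // /u1 -g1E ?(ltW v0) // divfK; last by rewrite gt_eqF.
    by apply: ltW; apply: lt_trans g21; rewrite -mulrA; apply: g2lo.
  have vv : 0 < u1 <= s%:R / sg by rewrite u10.
  have h1 := bd_gen_reciprocal N0 sg0 sgE sN vv b0 bE.
  have := ler_wpM2l (ltW C20) h1; rewrite -/c2 mulrN (mulrCA C2 _ c2) C2c2 mulr1; exact.
apply: (@time_ubound_scale _ _ _ (fun k => Num.min (g1 k) (g2 k) + N%:R * harm R (N - k))
   _ (2 ^- m)) => [|s sN|s sN|s sN].
- by rewrite invr_gt0 exprn_gt0.
- have /andP[p0 p1] := freq_bounds R sN.
  have p01 : 0 <= (s%:R / N%:R : R) <= 1 by rewrite !ltW.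
  have /andP[dl _] := F_drift p01.
  have q0 : 0 < 1 - s%:R / N%:R :> R by rewrite subr_gt0.
  rewrite bd_genD bd_genZ; have h1 := genmin _ sN; have h2 := bd_gen_harm_rev F01 sN.
  have h3 : (s%:R / N%:R) ^+ m <= (F (s%:R / N%:R) - s%:R / N%:R) / (1 - s%:R / N%:R).
    by rewrite ler_pdivlMr.
  have mP : (0 < m)%N by rewrite (leq_trans _ m2).
  have h4 : 2 ^- m <= (1 - s%:R / N%:R) + (s%:R / N%:R) ^+ m :> R.
    rewrite -exprVn; have [ph|ph] := leP (s%:R / N%:R) (2^-1 : R).
      have : (2^-1 : R) ^+ m <= 2^-1.
        by rewrite -[leRHS]expr1; apply: ler_wiXn2l => //; lra.
      have : 0 <= (s%:R / N%:R : R) ^+ m by rewrite exprn_ge0 // ltW.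
      lra.
    have : (2^-1 : R) ^+ m <= (s%:R / N%:R) ^+ m.
      by rewrite lerXn2r ?nnegrE ?(ltW ph) ?(ltW p0).
    lra.
  lra.
- apply: addr_ge0; last by rewrite mulr_ge0 ?harm_ge0.
  rewrite le_min g1ge0 /=; apply: ltW; apply: le_lt_trans (g2lo s).
  by rewrite !mulr_ge0 ?ltW.
- have -> : 2 ^- m * (2 ^+ m * (T + C2 / b + 2) * (N%:R * sg)) =
      (T + C2 / b) * (N%:R * sg) + N%:R * (2 * sg).
    by rewrite !mulrA mulVf ?mul1r; [ring|rewrite gt_eqF // exprn_gt0].
  apply: lerD; first by rewrite ge_min g2up orbT.
  rewrite ler_pM2l //; apply: le_trans (harm_scale N0 sg0 sgE).
  exact/harm_le/leq_subr.
Qed.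

(** The quadratic [s - k s ^ 2 / sg], cut off at 0, is large at the scale [sg] and
    has drift of order at most [1 / N] there. *)
Lemma degenerate_time_lbound (a b : R) : 0 < a -> 0 < b ->
  exists2 c : R, 0 < c & forall N sg s, 0 < sg -> sg ^+ m = N%:R ^+ m.-1 ->
  (0 < s < N)%N -> a * sg <= s%:R <= b * sg -> time_lbound F N s (c * (N%:R * sg)).
Proof.
move=> a0 b0; have hr := rr1; have hC := Cm1.
pose k := (2 * b)^-1; have k0 : 0 < k by rewrite invr_gt0 mulr_gt0.
pose cd := Cm * k ^- m + 2 * rr.
have km0 : 0 < k ^+ m by rewrite exprn_gt0.
have Ck0 : 0 < Cm * k ^- m by apply: mulr_gt0; [lra|rewrite invr_gt0].
have cd0 : 0 < cd by rewrite /cd; lra.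
have c10 : 0 < a / 2 / cd by apply: divr_gt0 => //; lra.
exists (Num.min (a / 2 / cd) (k ^+ m)); first by rewrite lt_min c10.
move=> N sg s sg0 sgE /[dup] sN /andP[s0 sN'] /andP[al bu].
have N0 : (0 < N)%N by rewrite (leq_ltn_trans _ sN').
have n1 : 1 <= N%:R :> R by rewrite ler1n.
have n0 : 0 < N%:R :> R by rewrite ltr0n.
have Nsg0 : 0 < N%:R * sg by apply: mulr_gt0.
(* If the parabola is still positive at [N], then [N] is bounded. *)
have [big|small] := leP sg (k * N%:R); last first.
  apply: time_lbound_le (time_lbound_harm F01 sN).
  have h1 : 1 <= Num.min (harm R s) (harm R (N - s)).
    by rewrite le_min !harm_ge1 // subn_gt0.
  apply: (@le_trans _ _ N%:R); last by rewrite ler_peMr // ltW.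
  have mP : (0 < m)%N by rewrite (leq_trans _ m2).
  have h2 : (k * N%:R) ^+ m <= N%:R ^+ m.-1.
    by rewrite -sgE lerXn2r ?nnegrE ?(ltW sg0) ?(ltW small) // mulr_ge0 // ltW.
  have h3 : k ^+ m * N%:R <= 1.
    rewrite -(ler_pM2r (exprn_gt0 m.-1 n0)) mul1r -mulrA -exprS prednK //.
    by rewrite -exprMn.
  apply: (@le_trans _ _ (k ^+ m * (N%:R * sg))).
    by rewrite ler_pM2r // ge_min lexx orbT.
  rewrite mulrA; apply: le_trans (ler_wpM2r (ltW sg0) h3) _.
  by rewrite mul1r; apply: (scale_le N0 sg0 sgE).
pose g (j : nat) : R := N%:R * j%:R * (1 - k * j%:R / sg).
have gE j : (0 < j < N)%N -> bd_gen F N g j =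
    N%:R * (F (j%:R / N%:R) - j%:R / N%:R) - k * N%:R / sg *
    (2 * j%:R * (F (j%:R / N%:R) - j%:R / N%:R) + (bd_up F N j + bd_down F N j)).
  move=> /andP[j0 _]; rewrite -bd_drift /bd_gen /g.
  rewrite (_ : j.-1%:R = j%:R - 1 :> R); last by rewrite -{2}(prednK j0) -natr1 addrK.
  rewrite -[(j.+1)%:R]natr1; field; exact: lt0r_neq0.
have gneg j : (0 <= g j) = (j == 0%N) || (k * j%:R <= sg).
  case: j => [|j]; first by rewrite /g mulr0 mul0r lexx.
  rewrite /g pmulr_rge0 ?mulr_gt0 ?ltr0n //= subr_ge0 ler_pdivrMr // mul1r.
  by [].
apply: time_lbound_le (_ : time_lbound F N s (a / 2 / cd * (N%:R * sg))).
  by rewrite ler_pM2r // ge_min lexx.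
apply: (@time_lbound_scale _ _ _ (fun j => Num.max 0 (g j)) _ _ cd) => //.
- move=> j jN; have [m1 m0] := bd_gen_max0 g jN.
  have [gj|gj] := leP 0 (g j); last by apply: le_trans (m0 (ltW gj)); rewrite oppr_le0 ltW.
  apply: le_trans (m1 gj).
  have /andP[p0 p1] := freq_bounds R jN; have /andP[j0 jN'] := jN.
  have p01 : 0 <= (j%:R / N%:R : R) <= 1 by rewrite !ltW.
  have [u1 d1 _] := bd_rates F01 F_lin0 F_lin1 jN.
  move: gj; rewrite gneg eqn0Ngt j0 /= => kj.
  have /andP[dl du] := F_drift p01.
  have x0 : 0 < j%:R :> R by rewrite ltr0n.
  have E := scaled_drift N0 sgE j.
  rewrite gE //; set B := F _ - _ in dl du *; set a' := bd_up F N j + _.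
  have B0 : 0 <= B by apply: le_trans dl; rewrite mulr_ge0 ?exprn_ge0 ?subr_ge0 ?ltW.
  have q0 : 0 <= 1 - j%:R / N%:R :> R by rewrite subr_ge0 ltW.
  have ujk : j%:R / sg <= k^-1.
    by rewrite ler_pdivrMr // ler_pdivlMl.
  have NB : N%:R * B <= Cm * k ^- m.
    apply: le_trans (ler_wpM2l (ltW n0) du) _.
    have -> : N%:R * (Cm * ((j%:R / N%:R) ^+ m * (1 - j%:R / N%:R))) =
        Cm * ((N%:R * (j%:R / N%:R) ^+ m) * (1 - j%:R / N%:R)) by ring.
    rewrite E ler_pM2l; last by lra.
    rewrite -exprVn -[leRHS]mulr1; apply: ler_pM => //.
    - by rewrite exprn_ge0 // divr_ge0 // ltW.
    - by apply: lerXn2r => //; rewrite nnegrE; [rewrite divr_ge0 // ltW|rewrite invr_ge0 ltW].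
  have t1 : k * N%:R / sg * (2 * j%:R * B) <= 2 * (N%:R * B).
    have -> : k * N%:R / sg * (2 * j%:R * B) = (k * j%:R / sg) * (2 * (N%:R * B)) by ring.
    rewrite ler_piMl ?mulr_ge0 ?(ltW n0) //.
    by rewrite ler_pdivrMr // mul1r.
  have t2 : k * N%:R / sg * a' <= 2 * rr.
    have kn0 : 0 <= k * N%:R / sg by rewrite divr_ge0 ?mulr_ge0 // ltW.
    have := ler_wpM2l kn0 (lerD u1 d1).
    move=> /le_trans; apply.
    have -> : k * N%:R / sg * (rr * (j%:R / N%:R * (1 - j%:R / N%:R)) +
        rr * (j%:R / N%:R * (1 - j%:R / N%:R))) =
      (2 * rr) * ((k * j%:R / sg) * (1 - j%:R / N%:R)) by field; rewrite !gt_eqF.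
    rewrite ler_piMr //; first by lra.
    apply: mulr_ile1 => //.
      by rewrite divr_ge0 ?mulr_ge0 // ltW.
    by rewrite ler_pdivrMr // mul1r.
  rewrite [k * N%:R / sg * _]mulrDr /cd; lra.
- by rewrite /g mulr0 mul0r maxxx.
- rewrite ge_max lexx /= /g mulr_ge0_le0 ?mulr_ge0 ?(ltW n0) // subr_le0.
  by rewrite ler_pdivlMr // mul1r.
have -> : cd * (a / 2 / cd * (N%:R * sg)) = N%:R * (a * sg) * (1 / 2).
  by field; rewrite gt_eqF.
rewrite le_max; apply/orP; right; rewrite /g; apply: ler_pM => //.
- by rewrite !mulr_ge0 // ltW.
- by rewrite ler_pM2l.
have : k * s%:R / sg <= 1 / 2.
  rewrite ler_pdivrMr //; apply: le_trans (ler_wpM2l (ltW k0) bu) _.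
  have -> : k * (b * sg) = 1 / 2 * sg by rewrite /k; field; rewrite gt_eqF.
  by [].
lra.
Qed.

End Degenerate.

(** * From the configuration chain to the count *)

Section CountDynamics.
Variables (R : realType) (N : nat).
Hypothesis N_gt0 : (0 < N)%N.
Implicit Types (x y : config N) (g : nat -> R).

Lemma ones_le x : (ones x <= N)%N.
Proof. by rewrite /ones (leq_trans (max_card _)) // card_ord. Qed.

Lemma ones_update x v b :
  ones (update x v b) = if b then if x v then ones x else (ones x).+1
                        else if x v then (ones x).-1 else ones x.
Proof.
have split_v y : ones y = (y v + \sum_(i | i != v) y i)%N.
  by rewrite /ones -sum1_card big_mkcond (bigD1 v).
rewrite !split_v updateE eqxx.
rewrite (_ : \sum_(i | i != v) update x v b i = \sum_(i | i != v) x i)%N.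
  by case: b; case: (x v).
by apply: eq_bigr => i /negbTE iv; rewrite updateE iv.
Qed.

Lemma sum_update x g b :
  \sum_(v < N) g (ones (update x v b)) =
  if b then (ones x)%:R * g (ones x) + (N%:R - (ones x)%:R) * g (ones x).+1
  else (ones x)%:R * g (ones x).-1 + (N%:R - (ones x)%:R) * g (ones x).
Proof.
have cT (c : R) : \sum_(v < N | x v) c = (ones x)%:R * c.
  by rewrite sumr_const /ones mulr_natl; congr (_ *+ _); apply: eq_card.
have cF (c : R) : \sum_(v < N | ~~ x v) c = (N%:R - (ones x)%:R) * c.
  have : \sum_(v < N) c = N%:R * c by rewrite sumr_const card_ord mulr_natl.
  rewrite (bigID x) /= cT mulrBl => <-; ring.
rewrite (bigID x) /=.
have -> : \sum_(v < N | x v) g (ones (update x v b)) =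
    \sum_(v < N | x v) g (if b then ones x else (ones x).-1).
  by apply: eq_bigr => v xv; rewrite ones_update xv.
have -> : \sum_(v < N | ~~ x v) g (ones (update x v b)) =
    \sum_(v < N | ~~ x v) g (if b then (ones x).+1 else ones x).
  by apply: eq_bigr => v /negbTE xv; rewrite ones_update xv.
by rewrite cT cF; case: b.
Qed.

Lemma rule_kernel_mean r (f : config r -> bool) x (h : config N -> R) :
  \sum_y rule_kernel R f x y * h y =
  (\sum_(v < N) \sum_(J : {ffun 'I_r -> 'I_N}) h (update x v (f [ffun k => x (J k)])))
    / (N ^ r.+1)%:R.
Proof.
rewrite mulr_suml /rule_kernel.
under eq_bigr => y _ do rewrite mulrAC mulr_suml mulr_suml.
rewrite exchange_big /=; apply: eq_bigr => v _.
under eq_bigr => y _ do rewrite mulr_suml mulr_suml.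
rewrite exchange_big /= mulr_suml; apply: eq_bigr => J _.
rewrite (bigD1 (update x v (f [ffun k => x (J k)]))) //= eqxx mul1r.
by rewrite big1 ?addr0 // => y /negbTE yx; rewrite eq_sym yx !mul0r.
Qed.

Lemma rule_kernel_gen r (f : config r -> bool) x g :
  \sum_y rule_kernel R f x y * g (ones y) - g (ones x) =
  bd_gen (bern_rule f) N g (ones x).
Proof.
have n0 : N%:R != 0 :> R by rewrite pnatr_eq0 -lt0n.
rewrite rule_kernel_mean exchange_big /=.
under eq_bigr => J _ do rewrite sum_update.
set s := ones x; set A1 := _ + _ * g s.+1; set A0 := _ + _ * g s.
have -> : \sum_(J : {ffun 'I_r -> 'I_N}) (if f [ffun k => x (J k)] then A1 else A0) =
    (N ^ r)%:R * (bern_rule f (s%:R / N%:R) * A1 + (1 - bern_rule f (s%:R / N%:R)) * A0).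
  rewrite (sample_bern_mean x (fun y : config r => if f y then A1 else A0)) //.
  congr (_ * _); rewrite (eq_bern_mean _ (h := fun y : config r =>
    A0 + (A1 - A0) * (f y)%:R)); last by move=> y; case: (f y); rewrite /=; ring.
  by rewrite bern_meanD bern_meanZ bern_mean_const -/(bern_rule f _) -/s; ring.
rewrite expnS natrM /A1 /A0 /bd_gen /bd_up /bd_down.
have nr0 : (N ^ r)%:R != 0 :> R by rewrite natrX expf_neq0.
by field; rewrite n0 nr0.
Qed.

Lemma consensusE x : consensus x <-> (ones x == 0%N) || (ones x == N).
Proof.
split=> [cx|].
  pose i0 := Ordinal N_gt0; have xE i : x i = x i0 by apply: cx.
  case x0: (x i0).
    apply/orP; right; apply/eqP; rewrite /ones -[RHS]card_ord; apply: eq_card => i.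
    by rewrite !inE xE x0.
  apply/orP; left; rewrite /ones -leqn0 leqNgt; apply/negP => /card_gt0P[i].
  by rewrite inE xE x0.
case/orP => [/eqP c0 i j|/eqP cN i j].
  have xF k : x k = false.
    apply/negbTE/negP => xk; suff : (0 < ones x)%N by rewrite c0.
    by rewrite /ones; apply/card_gt0P; exists k; rewrite inE.
  by rewrite !xF.
have xT k : x k = true.
  have /subset_cardP h : #|[pred i | x i]| = #|'I_N| by rewrite card_ord.
  have := h (subset_predT _) k; rewrite inE /=.
  by rewrite [in RHS]inE.
by rewrite !xT.
Qed.

End CountDynamics.

(** * Lyapunov bounds on the mean consensus time *)

Section FiniteChain.
Variables (R : realType) (N : nat) (K : config N -> config N -> R).
Variables (d : measure_display) (Omega : measurableType d).
Variables (P : probability Omega R) (X : nat -> Omega -> config N).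
Hypothesis mc : markov_chain K P X.
Implicit Types (x y : config N) (t : nat).

Let pr (E : set Omega) : R := fine (P E).

Let prE E : measurable E -> P E = (pr E)%:E.
Proof. by move=> mE; rewrite /pr fineK // fin_num_measure. Qed.

Lemma measurable_state t x : measurable (X t @^-1` [set x]).
Proof. by case: mc => h _; apply: h. Qed.

Lemma measurable_finite_valued (T : finType) (Z : Omega -> T) (A : set T) :
  (forall z, measurable (Z @^-1` [set z])) -> measurable (Z @^-1` A).
Proof.
move=> mZ; rewrite (_ : Z @^-1` A = \bigcup_(z in A) (Z @^-1` [set z])).
  by apply: fin_bigcup_measurable => //; apply: finite_finset.
apply/seteqP; split=> [w Aw|w [z Az /= wz]]; first by exists (Z w).
by rewrite /preimage /= wz.
Qed.

Lemma probability_split (T : finType) (Z : Omega -> T) (E : set Omega) :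
  (forall z, measurable (Z @^-1` [set z])) -> measurable E ->
  pr E = \sum_z pr (E `&` Z @^-1` [set z]).
Proof.
move=> mZ mE; apply: EFin_inj; rewrite -prE // -sumEFin.
transitivity (P (\bigcup_(z in [set` enum T]) (E `&` Z @^-1` [set z]))).
  congr (P _); apply/seteqP; split=> [w Ew|w [z _ [Ew _]]] //=; exists (Z w) => //=.
  exact: mem_enum.
rewrite measure_fin_bigcup; first last.
- by move=> z _; apply: measurableI.
- by move=> z z' _ _ [w /= [[_ <-] [_ <-]]].
- exact: finite_finset.
rewrite -fsbig_seq ?enum_uniq // big_enum /=; apply: eq_bigr => z _.
by rewrite -prE //; apply: measurableI.
Qed.

Definition history t (w : Omega) : {ffun 'I_t.+1 -> config N} := [ffun i : 'I_t.+1 => X i w].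

Lemma historyE t (z : {ffun 'I_t.+1 -> config N}) :
  history t @^-1` [set z] = [set w | forall i, (i <= t)%N -> X i w = z (inord i)].
Proof.
apply/seteqP; split=> [w /= <- i it|w /= h].
  by rewrite ffunE inordK.
apply/ffunP => i; rewrite ffunE h ?inord_val //.
by rewrite -ltnS.
Qed.

Lemma measurable_history t z : measurable (history t @^-1` [set z]).
Proof.
rewrite (_ : _ @^-1` _ = \bigcap_(i in [set: 'I_t.+1]) (X i @^-1` [set z i])).
  apply: fin_bigcap_measurable => [|i _]; last exact: measurable_state.
  exact: finite_finset.
apply/seteqP; split=> [w /= <- i _|w /= h]; first by rewrite /= ffunE.
by apply/ffunP => i; rewrite ffunE; apply: h.
Qed.

Lemma measurable_history_event t (A : set {ffun 'I_t.+1 -> config N}) :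
  measurable (history t @^-1` A).
Proof. exact/measurable_finite_valued/measurable_history. Qed.

Lemma pr_set0 : pr set0 = 0.
Proof. by rewrite /pr measure0. Qed.

Lemma pr_ge0 E : 0 <= pr E.
Proof. exact: fine_ge0. Qed.

(** The Markov property is given history by history, so an event of the past is
    first split into the finitely many histories it contains. *)
Lemma markov_step t (A : set {ffun 'I_t.+1 -> config N}) x y :
  pr (history t @^-1` A `&` X t @^-1` [set x] `&` X t.+1 @^-1` [set y]) =
  pr (history t @^-1` A `&` X t @^-1` [set x]) * K x y.
Proof.
have mA := measurable_history_event A.
have mx := measurable_state t x; have my := measurable_state t.+1 y.
have mAx : measurable (history t @^-1` A `&` X t @^-1` [set x]) by apply: measurableI.
rewrite (probability_split (@measurable_history t)); last exact: measurableI.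
rewrite [in RHS](probability_split (@measurable_history t)) // mulr_suml.
apply: eq_bigr => z _.
have [[Az zx]|nz] := pselect (A z /\ z ord_max = x); last first.
  rewrite [X in pr X](_ : _ = set0) ?[X in pr X * _](_ : _ = set0) ?pr_set0 ?mul0r //.
    apply/seteqP; split=> // w /= [[Aw wx] hz]; apply: nz; rewrite -hz; split => //.
    by rewrite ffunE.
  apply/seteqP; split=> // w /= [[[Aw wx] _] hz]; apply: nz; rewrite -hz; split => //.
  by rewrite ffunE.
have eA : history t @^-1` A `&` X t @^-1` [set x] `&` history t @^-1` [set z] =
    [set w | forall i, (i <= t)%N -> X i w = z (inord i)].
  rewrite -historyE; apply/seteqP; split=> [w [_]//|w hz]; split=> //.
  split; first by rewrite /preimage /= (_ : history t w = z).
  by move: hz => /= hz; rewrite -zx -hz ffunE.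
have eAy : history t @^-1` A `&` X t @^-1` [set x] `&` X t.+1 @^-1` [set y]
     `&` history t @^-1` [set z] =
    [set w | (forall i, (i <= t)%N -> X i w = z (inord i)) /\ X t.+1 w = y].
  rewrite setIAC eA; apply/seteqP; split=> w [].
    by split.
  by split.
rewrite eAy eA; apply: EFin_inj; rewrite EFinM -!prE.
- case: mc => _ /(_ t (fun i => z (inord i)) y) ->.
  by rewrite (_ : inord t = ord_max) ?zx //; apply/val_inj; rewrite /= inordK.
- by rewrite -historyE; apply: measurable_history.
- by rewrite -eAy; apply: measurableI; [apply: measurableI|exact: measurable_history].
Qed.

Section Survival.
Variable D : pred (config N).

Definition alive t : set Omega :=
  [set w | D (X 0%N w) /\ forall i, (i <= t)%N -> ~ consensus (X i w)].

Let alive_history t : exists A, alive t = history t @^-1` A.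
Proof.
exists [set z | D (z ord0) /\ forall i, ~ consensus (z i)].
apply/seteqP; split=> [w [Dw h]|w [Dz h]].
  split; first by rewrite ffunE.
  by move=> i; rewrite ffunE; apply: h; rewrite -ltnS.
move: Dz; rewrite ffunE => Dw; split=> // i it.
by have := h (inord i); rewrite ffunE inordK.
Qed.

Lemma measurable_alive t : measurable (alive t).
Proof. by have [A ->] := alive_history t; apply: measurable_history_event. Qed.

Lemma aliveS t y : consensus y -> alive t.+1 `&` X t.+1 @^-1` [set y] = set0.
Proof.
move=> cy; apply/seteqP; split=> // w [[_ h] /= wy].
by apply: (h t.+1) => //; rewrite wy.
Qed.

Lemma alive_step t y : ~ consensus y ->
  alive t.+1 `&` X t.+1 @^-1` [set y] = alive t `&` X t.+1 @^-1` [set y].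
Proof.
move=> cy; apply/seteqP; split=> w [[Dw h] /= wy]; split=> //; split=> // i.
  by move=> it; apply: h; rewrite (leq_trans it).
by rewrite leq_eqVlt => /predU1P[->|]; [rewrite wy|rewrite ltnS; apply: h].
Qed.

Definition alive_mean t (h : config N -> R) : R :=
  \sum_x pr (alive t `&` X t @^-1` [set x]) * h x.

Lemma alive_next t (h : config N -> R) :
  \sum_y pr (alive t `&` X t.+1 @^-1` [set y]) * h y =
  alive_mean t (fun x => \sum_y K x y * h y).
Proof.
have [A AE] := alive_history t.
rewrite /alive_mean; under [RHS]eq_bigr do rewrite mulr_sumr.
rewrite exchange_big /=; apply: eq_bigr => y _.
rewrite (probability_split (measurable_state t)); last first.
  by apply: measurableI; [exact: measurable_alive|exact: measurable_state].
rewrite mulr_suml; apply: eq_bigr => x _.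
by rewrite mulrA setIAC AE markov_step.
Qed.

Lemma pr_alive t : pr (alive t) = alive_mean t (fun=> 1).
Proof.
rewrite (probability_split (measurable_state t) (measurable_alive t)).
by apply: eq_bigr => x _; rewrite mulr1.
Qed.

Lemma alive_mean_le t (h k : config N -> R) :
  (forall x, ~ consensus x -> h x <= k x) -> alive_mean t h <= alive_mean t k.
Proof.
move=> hk; apply: ler_sum => x _; have [cx|ncx] := pselect (consensus x).
  rewrite [X in pr X](_ : _ = set0) ?pr_set0 ?mul0r //.
  by apply/seteqP; split=> // w [[_ a] /= wx]; apply: (a t) => //; rewrite wx.
by rewrite ler_wpM2l ?pr_ge0 // hk.
Qed.

Lemma alive_meanD t (h k : config N -> R) :
  alive_mean t (fun x => h x + k x) = alive_mean t h + alive_mean t k.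
Proof. by rewrite -big_split; apply: eq_bigr => x _; rewrite mulrDr. Qed.

Lemma alive_meanZ t (c : R) (h : config N -> R) :
  alive_mean t (fun x => c * h x) = c * alive_mean t h.
Proof. by rewrite mulr_sumr; apply: eq_bigr => x _; rewrite mulrCA. Qed.

(** Each step costs at least one unit of a nonnegative supersolution. *)
Lemma lyapunov_ubound (h : config N -> R) n : (forall x, 0 <= h x) ->
  (forall x, ~ consensus x -> \sum_y K x y * h y - h x <= -1) ->
  \sum_(t < n) pr (alive t) <= alive_mean 0 h.
Proof.
move=> h0 hK.
have step t : alive_mean t.+1 h <= alive_mean t h - pr (alive t).
  apply: (@le_trans _ _ (alive_mean t (fun x => \sum_y K x y * h y))).
    rewrite -alive_next; apply: ler_sum => y _; rewrite ler_wpM2r //.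
    have [cy|ncy] := pselect (consensus y); last by rewrite alive_step.
    by rewrite aliveS // pr_set0 pr_ge0.
  rewrite pr_alive -mulN1r -alive_meanZ -alive_meanD; apply: alive_mean_le => x ncx.
  by have := hK x ncx; lra.
suff : \sum_(t < n) pr (alive t) + alive_mean n h <= alive_mean 0 h.
  have : 0 <= alive_mean n h by apply: sumr_ge0 => x _; rewrite mulr_ge0 ?pr_ge0.
  lra.
elim: n => [|n IH]; first by rewrite big_ord0 add0r.
by rewrite big_ord_recr /=; have := step n; lra.
Qed.

(** A subsolution loses at most 1 per step on average, and what is left of it at
    time [n] is at most [H] times the probability of no consensus yet. *)
Lemma lyapunov_lbound (h : config N -> R) (H : R) n :
  (forall x, consensus x -> h x <= 0) -> (forall x, h x <= H) ->
  (forall x, ~ consensus x -> -1 <= \sum_y K x y * h y - h x) ->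
  alive_mean 0 h - H * pr (alive n) <= \sum_(t < n) pr (alive t).
Proof.
move=> h0 hH hK.
have step t : alive_mean t h - pr (alive t) <= alive_mean t.+1 h.
  apply: (@le_trans _ _ (alive_mean t (fun x => \sum_y K x y * h y))).
    rewrite pr_alive -mulN1r -alive_meanZ -alive_meanD; apply: alive_mean_le => x ncx.
    by have := hK x ncx; lra.
  rewrite -alive_next; apply: ler_sum => y _.
  have [cy|ncy] := pselect (consensus y); last by rewrite alive_step.
  by rewrite aliveS // pr_set0 mul0r mulr_ge0_le0 ?pr_ge0 ?h0.
have last_le : alive_mean n h <= H * pr (alive n).
  by rewrite pr_alive -alive_meanZ; apply: alive_mean_le => x _; rewrite mulr1.
suff : alive_mean 0 h <= \sum_(t < n) pr (alive t) + alive_mean n h by lra.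
elim: n {last_le} => [|n IH]; first by rewrite big_ord0 add0r.
by rewrite big_ord_recr /=; have := step n; lra.
Qed.

Lemma alive_nonincreasing s t : (s <= t)%N -> pr (alive t) <= pr (alive s).
Proof.
move=> st; rewrite -lee_fin -!prE; [|exact: measurable_alive..].
apply: le_measure; rewrite ?inE; [exact: measurable_alive..|].
by move=> w [Dw h]; split=> // i it; apply: h; apply: leq_trans st.
Qed.

Let start : set Omega := [set w | D (X 0%N w)].

Lemma measurable_start : measurable start.
Proof. exact: (measurable_finite_valued [set x | D x] (measurable_state 0%N)). Qed.

(** The time is the number of steps without consensus so far; both sides are
    infinite when consensus is never reached. *)
Lemma consensus_time_series w :
  consensus_time R X w =
  (\sum_(0 <= t <oo) (\1_[set w | forall i, (i <= t)%N -> ~ consensus (X i w)] w)%:E)%E.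
Proof.
pose never (t : nat) := [set w | forall i, (i <= t)%N -> ~ consensus (X i w)].
rewrite -/never /consensus_time.
have [[t0 ct0]|nc] := pselect (exists t, consensus (X t w)).
  have [T cT minT] : exists2 T : nat, consensus (X T w) &
      forall t, consensus (X t w) -> (T <= t)%N.
    have ex : exists t, `[< consensus (X t w) >] by exists t0; apply/asboolP.
    case: (ex_minnP ex) => T /asboolP cT minT; exists T => // t ct.
    by apply: minT; apply/asboolP.
  have nvE (t : nat) : \1_(never t) w = (t < T)%N%:R :> R.
    rewrite indicE; congr (_%:R); congr nat_of_bool; apply/idP/idP.
      rewrite inE => nv; rewrite ltnNge; apply/negP => Tt; exact: (nv T).
    move=> tT; rewrite inE => i it /minT; rewrite leqNgt => /negP; apply.
    exact: leq_ltn_trans tT.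
  have -> : (\sum_(0 <= t <oo) (\1_(never t) w : R)%:E = T%:R%:E)%E.
    rewrite (nneseries_split 0%N T) => [|t _]; last by rewrite lee_fin.
    rewrite add0n [X in (_ + X)%E]eseries0 => [|t Tt _]; last by rewrite nvE ltnNge Tt.
    rewrite adde0 sumEFin; congr (_%:E).
    rewrite (eq_big_nat _ _ (F2 := fun=> 1)) => [|t /andP[_ tT]]; last by rewrite nvE tT.
    by rewrite sumr_const_nat subn0.
  apply/eqP; rewrite eq_le; apply/andP; split.
    by apply: ereal_inf_lbound; exists T.
  apply: le_ereal_inf_tmp => y [t ct <-].
  by rewrite lee_fin ler_nat; apply: minT.
have -> : [set t%:R%:E | t in [set t | consensus (X t w)]] = set0 :> set (\bar R).
  by apply/seteqP; split=> // y [t ct _]; apply: nc; exists t.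
rewrite ereal_inf0; apply/esym.
have nvE (t : nat) : \1_(never t) w = 1 :> R.
  by rewrite indicE mem_set // => i _ ci; apply: nc; exists i.
rewrite (eq_eseriesr (g := fun=> 1%E)); last by move=> t _; rewrite nvE.
apply/eqyP => A A0; apply: le_trans (nneseries_lim_ge (Num.truncn A).+1 _) => //.
rewrite sumEFin lee_fin sumr_const_nat subn0.
exact/ltW/truncnS_gt.
Qed.

Lemma integral_consensus_time :
  (\int[P]_(w in start) consensus_time R X w = \sum_(0 <= t <oo) (pr (alive t))%:E)%E.
Proof.
have mnever (t : nat) : measurable [set w | forall i, (i <= t)%N -> ~ consensus (X i w)].
  rewrite (_ : [set w | _] = \bigcap_(i in [set i | (i <= t)%N])
    (X i @^-1` [set x | ~ consensus x])).
    apply: bigcap_measurable => [|i _]; first by exists 0%N.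
    exact: measurable_finite_valued (measurable_state i).
  by apply/seteqP; split=> w h i /h.
under eq_integral do rewrite consensus_time_series.
rewrite integral_nneseries; last 3 first.
- exact: measurable_start.
- by move=> t; apply/measurable_realfun.measurable_EFinP;
  apply: measurable_realfun.measurable_indic; exact: mnever.
- by move=> t w _; rewrite lee_fin.
apply: eq_eseriesr => t _; rewrite integral_indic //; last exact: measurable_start.
rewrite -prE; last exact: measurable_alive.
by congr (P _); apply/seteqP; split=> w [].
Qed.

Lemma consensus_time_ubound (h : config N -> R) : (forall x, 0 <= h x) ->
  (forall x, ~ consensus x -> \sum_y K x y * h y - h x <= -1) ->
  (\int[P]_(w in start) consensus_time R X w <= (alive_mean 0 h)%:E)%E.
Proof.
move=> h0 hK; rewrite integral_consensus_time.
apply: lime_le; first by apply: is_cvg_nneseries => t _ _; rewrite lee_fin pr_ge0.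
apply: nearW => n; rewrite sumEFin lee_fin big_mkord; exact: lyapunov_ubound.
Qed.

Lemma consensus_time_lbound (h : config N -> R) :
  (forall x, consensus x -> h x <= 0) ->
  (forall x, ~ consensus x -> -1 <= \sum_y K x y * h y - h x) ->
  ((alive_mean 0 h)%:E <= \int[P]_(w in start) consensus_time R X w)%E.
Proof.
move=> h0 hK; rewrite integral_consensus_time.
set S : \bar R := (\sum_(0 <= t <oo) _)%E.
have Sge n : ((\sum_(t < n) pr (alive t))%:E <= S)%E.
  rewrite -(big_mkord xpredT (fun t => pr (alive t))) -sumEFin.
  by apply: nneseries_lim_ge => t _; rewrite lee_fin pr_ge0.
have [H [H0 hH]] : exists H : R, 0 <= H /\ forall x, h x <= H.
  exists (\sum_x `|h x|); split; first exact: sumr_ge0.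
  move=> x; apply: le_trans (ler_norm _) _; rewrite (bigD1 x) //= lerDl.
  exact: sumr_ge0.
have S0 : (0 <= S)%E by apply: nneseries_ge0 => t _ _; rewrite lee_fin pr_ge0.
case: S S0 Sge => [S| |] S0 Sge; [|exact: leey|by []].
rewrite lee_fin in S0; rewrite lee_fin; apply/ler_addgt0Pr => e e0.
(* The events [alive t] decrease, so [n * pr (alive n) <= S]. *)
pose n := (Num.truncn (H * S / e)).+1.
have n0 : 0 < n%:R :> R by rewrite ltr0n.
have := lyapunov_lbound n h0 hH hK; have := Sge n; rewrite lee_fin => Sn L.
suff : H * pr (alive n) <= e by lra.
have nS : n%:R * pr (alive n) <= S.
  apply: le_trans Sn; rewrite mulr_natl -[X in _ *+ X]card_ord -sumr_const.
  by apply: ler_sum => t _; apply: alive_nonincreasing; apply: ltnW.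
rewrite -(ler_pM2l n0) mulrCA; apply: le_trans (ler_wpM2l H0 nS) _.
have : H * S / e < n%:R by rewrite /n truncnS_gt.
rewrite ltr_pdivrMr //; exact: ltW.
Qed.

End Survival.

End FiniteChain.

(** * Mean consensus times of the three regimes *)

Section MeanTime.
Variables (R : realType) (r : nat) (f : config r -> bool) (N : nat).
Variables (d : measure_display) (Omega : measurableType d).
Variables (P : probability Omega R) (X : nat -> Omega -> config N).
Hypothesis N_gt0 : (0 < N)%N.
Hypothesis mc : markov_chain (rule_kernel R f) P X.

Lemma ones_inner (x : config N) : ~ consensus x -> (0 < ones x < N)%N.
Proof.
move=> ncx; have := ones_le x; rewrite leq_eqVlt => /orP[/eqP xN|xN].
  by case: ncx; apply/(consensusE N_gt0); rewrite xN eqxx orbT.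
rewrite xN andbT lt0n; apply/negP => x0.
by case: ncx; apply/(consensusE N_gt0); rewrite x0.
Qed.

Lemma alive_mean_start (s : nat) (g : nat -> R) : (0 < s < N)%N ->
  alive_mean P X (fun x => ones x == s) 0 (fun x => g (ones x)) =
  g s * fine (P (starts_at X s)).
Proof.
move=> /andP[s0 sN]; set D : pred (config N) := fun x => ones x == s.
have startE : starts_at X s = alive X D 0.
  apply/seteqP; split=> w; last by case=> /eqP.
  move=> /= ws; split; first exact/eqP.
  move=> i; rewrite leqn0 => /eqP-> /(consensusE N_gt0).
  by rewrite ws (gtn_eqF s0) (ltn_eqF sN).
rewrite startE (pr_alive mc) -alive_meanZ; apply: eq_bigr => x _.
have [xs|xs] := eqVneq (ones x) s; first by rewrite xs mulr1.
rewrite [X in P X](_ : _ = set0) ?measure0 ?mul0r //.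
by apply/seteqP; split=> // w [[/eqP ws _] /= wx]; case/eqP: xs; rewrite -wx.
Qed.

Lemma mean_time_ubound (B : nat -> R) (s : nat) : time_ubound (bern_rule f) N B ->
  (0 < s < N)%N -> (0 < P (starts_at X s))%E ->
  (mean_consensus_time P X s <= (B s)%:E)%E.
Proof.
move=> [g [g1 g0] gB] sN Ps.
have e : [set w | ones (X 0%N w) == s] = starts_at X s.
  by apply/seteqP; split=> w /eqP.
have mS : measurable (starts_at X s).
  by rewrite -e; apply: (measurable_start mc (fun x : config N => ones x == s)).
have Pfin : P (starts_at X s) \is a fin_num by apply: fin_num_measure.
have P0 : 0 < fine (P (starts_at X s)) by rewrite -lte_fin fineK.
rewrite /mean_consensus_time /cond_mean.
have h : (\int[P]_(w in starts_at X s) consensus_time R X w <=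
    (g s * fine (P (starts_at X s)))%:E)%E.
  rewrite -alive_mean_start // -e.
  apply: (consensus_time_ubound mc) => [x|x ncx]; first exact/g0/ones_le.
  rewrite (rule_kernel_gen N_gt0); apply: g1; exact: ones_inner.
have iP0 : (0 <= ((fine (P (starts_at X s)))^-1)%:E)%E by rewrite lee_fin invr_ge0 ltW.
apply: le_trans (lee_wpmul2r iP0 h) _.
by rewrite -EFinM lee_fin mulfK ?gt_eqF // gB.
Qed.

Lemma mean_time_lbound (b : R) (s : nat) : time_lbound (bern_rule f) N s b ->
  (0 < s < N)%N -> (0 < P (starts_at X s))%E ->
  (b%:E <= mean_consensus_time P X s)%E.
Proof.
move=> [g [g1 g0 gN] gb] sN Ps.
have e : [set w | ones (X 0%N w) == s] = starts_at X s.
  by apply/seteqP; split=> w /eqP.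
have mS : measurable (starts_at X s).
  by rewrite -e; apply: (measurable_start mc (fun x : config N => ones x == s)).
have Pfin : P (starts_at X s) \is a fin_num by apply: fin_num_measure.
have P0 : 0 < fine (P (starts_at X s)) by rewrite -lte_fin fineK.
rewrite /mean_consensus_time /cond_mean.
have h : ((g s * fine (P (starts_at X s)))%:E <=
    \int[P]_(w in starts_at X s) consensus_time R X w)%E.
  rewrite -alive_mean_start // -e.
  apply: (consensus_time_lbound mc) => [x|x ncx].
    by move=> /(consensusE N_gt0)/orP[] /eqP->.
  rewrite (rule_kernel_gen N_gt0); apply: g1; exact: ones_inner.
have iP0 : (0 <= ((fine (P (starts_at X s)))^-1)%:E)%E by rewrite lee_fin invr_ge0 ltW.
apply: le_trans (lee_wpmul2r iP0 h).
by rewrite -EFinM lee_fin mulfK ?gt_eqF.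
Qed.

Lemma total_time_ubound (B : nat -> R) (M : R) : time_ubound (bern_rule f) N B ->
  0 <= M -> (forall s, (0 < s < N)%N -> B s <= M) ->
  (\int[P]_w consensus_time R X w <= M%:E)%E.
Proof.
move=> [g [g1 g0] gB] M0 BM.
have e : [set: Omega] = [set w | xpredT (X 0%N w)] by apply/seteqP; split.
rewrite e; apply: (@le_trans _ _ (alive_mean P X xpredT 0 (fun x => g (ones x)))%:E).
  apply: (consensus_time_ubound mc) => [x|x ncx]; first exact/g0/ones_le.
  rewrite (rule_kernel_gen N_gt0); apply: g1; exact: ones_inner.
rewrite lee_fin; apply: (@le_trans _ _ (alive_mean P X xpredT 0 (fun=> M * 1))).
  apply: (alive_mean_le P) => x ncx; rewrite mulr1; have xN := ones_inner ncx.
  exact: le_trans (gB _ xN) (BM _ xN).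
rewrite alive_meanZ -(pr_alive mc) ler_piMr // -lee_fin fineK.
  exact/probability_le1/(measurable_alive mc).
by apply: fin_num_measure; apply: (measurable_alive mc).
Qed.

End MeanTime.

Section Regimes.
Variables (R : realType) (r : nat).
Hypothesis r_gt0 : (0 < r)%N.
Implicit Types (f : config r -> bool).

Let rr1 : 1 <= r%:R :> R. Proof. by rewrite ler1n. Qed.

Lemma bern_rule01 f p : 0 <= p <= 1 -> 0 <= (bern_rule f p : R) <= 1.
Proof. by move=> p01; rewrite bern_rule_ge0 ?bern_rule_le1. Qed.

Lemma bern_rule_dual_fun f : bern_rule f = dual_fun (bern_rule (dual_rule f)) :> (R -> R).
Proof.
by apply/funext => p; rewrite /dual_fun bern_rule_dual (_ : 1 - (1 - p) = p); ring.
Qed.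

Section Rule.
Variable f : config r -> bool.
Hypotheses (mf : monotone_rule f) (cf : nonconstant_rule f).
Let F : R -> R := bern_rule f.
Let F01 := @bern_rule01 f.
Let F_lin0 (p : R) : 0 <= p <= 1 -> F p <= r%:R * p.
Proof. exact: bern_rule_le_linear. Qed.
Let F_lin1 (p : R) : 0 <= p <= 1 -> 1 - F p <= r%:R * (1 - p).
Proof. exact: bern_rule_ge_linear. Qed.

Lemma attracting_ends_ubound : D0 f = 0%N -> D1 f = 0%N ->
  exists2 C : R, 0 < C & forall N, (0 < N)%N ->
  time_ubound F N (fun s => C * (N%:R * (1 + ln (minn s (N - s))%:R))).
Proof.
move=> d0 d1; have [ps [c [ps01 c01 Fu]]] := bern_rule_unstable R mf cf d0 d1.
apply: (two_attractors_time_ubound rr1 F01 F_lin0 F_lin1 _ _ _ ps01 c01 Fu).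
- exact: (fun p => bern_rule_le_quadratic mf cf d0).
- exact: (fun p => bern_rule_ge_quadratic mf cf d1).
- exact: sqr_ge0.
Qed.

Lemma minn_time_lbound : exists2 c : R, 0 < c & forall N s, (0 < s < N)%N ->
  time_lbound F N s (c * (N%:R * (1 + ln (minn s (N - s))%:R))).
Proof.
exists 2^-1 => [//|N s /[dup] sN /andP[s0 sN']].
apply: time_lbound_le (time_lbound_harm F01 sN).
have h1 := @harm_ge_ln R s s0; have h2 := @harm_ge_ln R (N - s) ltac:(by rewrite subn_gt0).
have n0 : 0 < N%:R :> R by rewrite ltr0n (leq_ltn_trans _ sN').
rewrite mulrCA ler_pM2l // le_min.
have mle (k l : nat) : (0 < k)%N -> (k <= l)%N -> ln (k%:R : R) <= ln l%:R.
  by move=> k0 kl; rewrite ler_ln ?posrE ?ltr0n ?ler_nat // (leq_trans k0).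
have m0 : (0 < minn s (N - s))%N by rewrite leq_min s0 subn_gt0.
have := mle _ _ m0 (geq_minl _ _); have := mle _ _ m0 (geq_minr _ _).
by move=> ? ?; apply/andP; split; lra.
Qed.

Lemma repelling_zero : (2 <= D0 f)%N ->
  (exists2 C : R, 0 < C & forall N, (0 < N)%N ->
     time_ubound F N (fun s => C * (N%:R * (1 + ln (N - s)%:R)))) /\
  (exists2 c : R, 0 < c & forall N s, (0 < s < N)%N ->
     time_lbound F N s (c * (N%:R * (1 + ln (N - s)%:R)))).
Proof.
move=> d2; have dr (p : R) : 0 <= p <= 1 -> p * (1 - p) <= F p - p.
  exact: bern_rule_ge_or.
split; first exact: (repelling_time_ubound rr1 F01 F_lin0 F_lin1 dr).
exact: (repelling_time_lbound rr1 F01 F_lin0 F_lin1 dr).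
Qed.

Lemma degenerate_zero : D0 f = 1%N -> D1 f = 0%N ->
  [/\ (2 <= m0 f)%N,
      exists2 C : R, 0 < C & forall N sg, (0 < N)%N -> 0 < sg ->
        sg ^+ m0 f = N%:R ^+ (m0 f).-1 -> time_ubound F N (fun=> C * (N%:R * sg)) &
      forall a b : R, 0 < a -> 0 < b -> exists2 c : R, 0 < c &
        forall N sg s, 0 < sg -> sg ^+ m0 f = N%:R ^+ (m0 f).-1 ->
        (0 < s < N)%N -> a * sg <= s%:R <= b * sg -> time_lbound F N s (c * (N%:R * sg))].
Proof.
move=> d0 d1; rewrite /m0; case: pickP => [j fj|nof]; last first.
  have /D0_gt0P[j fj] : (0 < D0 f)%N by rewrite d0.
  by have := nof j; rewrite fj.
have [y gy] : exists y, residual f j y.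
  exists [ffun=> true]; have : f (Defs.indic (~: [set j])%SET).
    by apply: contra_eqT d1 => fN; rewrite -lt0n; apply/D1_gt0P; exists j.
  rewrite (residual_split mf fj) ffunE !inE eqxx /= => h.
  congr (is_true (residual f j _)): h.
  by apply/ffunP => k; rewrite !ffunE !inE eq_sym neq_lift.
have m2 : (2 <= least_minterm_size (residual f j))%N.
  by have [B mB <-] := least_minterm_sizeP gy; apply: (residual_minterm_ge2 mf cf fj d0 mB).
have dr (p : R) : 0 <= p <= 1 -> _ := fun p01 => bern_rule_residual mf fj d1 p01.
have C1 : 1 <= (2 : R) ^+ r by rewrite exprn_ege1 // ler1n.
split=> //; first exact: (degenerate_time_ubound rr1 F01 F_lin0 F_lin1 C1 m2 dr).
exact: (degenerate_time_lbound rr1 F01 F_lin0 F_lin1 C1 m2 dr).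
Qed.

End Rule.
End Regimes.

Section Assembly.
Variable R : realType.

Lemma nondegenerate_time_bounds r (f : config r -> bool) : (0 < r)%N ->
  monotone_rule f -> nonconstant_rule f -> nondegenerate_rule f ->
  (exists2 C : R, 0 < C & forall N, (0 < N)%N ->
     time_ubound (bern_rule f) N (fun s => C * (N%:R * (1 + ln (attr_dist f N s)%:R)))) /\
  (exists2 c : R, 0 < c & forall N s, (0 < s < N)%N ->
     time_lbound (bern_rule f) N s (c * (N%:R * (1 + ln (attr_dist f N s)%:R)))).
Proof.
move=> r0 mf cf [n0 n1]; rewrite /attr_dist.
case: (posnP (D0 f)) => [d0|d0]; last first.
  apply: repelling_zero => //; move: d0 n0; case: (D0 f) => [|[|k]] //.
case: (posnP (D1 f)) => [d1|d1].
  by split; [exact: attracting_ends_ubound|exact: minn_time_lbound].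
have d2 : (2 <= D0 (dual_rule f))%N.
  by rewrite D0_dual; move: d1 n1; case: (D1 f) => [|[|k]].
have [[C C0 HC] [c c0 Hc]] := @repelling_zero R r r0 _ (dual_monotone mf) (dual_nonconstant cf) d2.
rewrite bern_rule_dual_fun; split.
  exists C => // N N0; apply: time_ubound_le (time_ubound_dual (HC N N0)) => s /andP[_ sN].
  by rewrite subKn // ltnW.
exists c => // N s /[dup] sN /andP[s0 sN']; apply: time_lbound_dual; first exact: ltnW.
have := Hc N (N - s)%N; rewrite subKn ?(ltnW sN') //; apply.
by rewrite subn_gt0 sN' /= ltn_subrL s0 (leq_ltn_trans _ sN').
Qed.

Lemma degenerate_time_bounds r (f : config r -> bool) (m := m_index f) : (0 < r)%N ->
  monotone_rule f -> nonconstant_rule f -> degenerate_rule f ->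
  [/\ (2 <= m)%N,
      exists2 C : R, 0 < C & forall N sg, (0 < N)%N -> 0 < sg ->
        sg ^+ m = N%:R ^+ m.-1 ->
        time_ubound (bern_rule f) N (fun=> C * (N%:R * sg)) &
      forall a b : R, 0 < a -> 0 < b -> exists2 c : R, 0 < c &
        forall N sg s, 0 < sg -> sg ^+ m = N%:R ^+ m.-1 ->
        (0 < s < N)%N -> a * sg <= (degenerate_dist f N s)%:R <= b * sg ->
        time_lbound (bern_rule f) N s (c * (N%:R * sg))].
Proof.
move=> r0 mf cf; rewrite /m /m_index /degenerate_dist => -[[d0 d1]|[d0 d1]]; rewrite d0 /=.
  exact: degenerate_zero.
have d0' : D0 (dual_rule f) = 1%N by rewrite D0_dual.
have d1' : D1 (dual_rule f) = 0%N by rewrite D1_dual.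
have [m2 [C C0 HC] HL] :=
  @degenerate_zero R r r0 _ (dual_monotone mf) (dual_nonconstant cf) d0' d1'.
split=> //; rewrite bern_rule_dual_fun.
  by exists C => // N sg N0 sg0 sgE; apply: time_ubound_dual (HC _ _ N0 sg0 sgE).
move=> a b a0 b0; have [c c0 Hc] := HL a b a0 b0; exists c => // N sg s sg0 sgE sN dist.
have /andP[s0 sN'] := sN; apply: time_lbound_dual; first exact: ltnW.
apply: (Hc N sg (N - s)%N) => //.
by rewrite subn_gt0 sN' /= ltn_subrL s0 (leq_ltn_trans _ sN').
Qed.

Lemma attr_dist_bounds r (f : config r -> bool) N s : (0 < s < N)%N ->
  (0 < attr_dist f N s <= N)%N.
Proof.
move=> /andP[s0 sN]; rewrite /attr_dist; case: ifP => _.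
  by rewrite subn_gt0 sN leq_subr.
case: ifP => _; first by rewrite s0 ltnW.
by rewrite leq_min s0 subn_gt0 sN geq_min (ltnW sN).
Qed.

Lemma dictator_kernel r (f : config r -> bool) (j : 'I_r) N (x y : config N) :
  (forall z, f z = z j) -> (0 < N)%N -> rule_kernel R f x y = voter_kernel R x y.
Proof.
move=> fj N0; rewrite /rule_kernel /voter_kernel.
have n0 : N%:R != 0 :> R by rewrite pnatr_eq0 -lt0n.
have J_sum (phi : 'I_N -> R) :
    \sum_(J : {ffun 'I_r -> 'I_N}) phi (J j) = N%:R ^+ r.-1 * \sum_u phi u.
  have -> : \sum_(J : {ffun 'I_r -> 'I_N}) phi (J j) =
      \sum_(J : {ffun 'I_r -> 'I_N}) \prod_k (if k == j then phi (J k) else 1).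
    apply: eq_bigr => J _; rewrite (bigD1 j) //= eqxx big1 ?mulr1 // => k /negbTE kj.
    by rewrite kj.
  rewrite -(bigA_distr_bigA (fun k u => if k == j then phi u else 1)).
  rewrite (bigD1 j) //= mulrC; congr (_ * _); last by apply: eq_bigr => u _; rewrite eqxx.
  rewrite (eq_bigr (fun=> N%:R)) => [|k /negbTE kj].
    by rewrite prodr_const cardC1 card_ord.
  by rewrite kj sumr_const card_ord.
have rS : r = r.-1.+1 by rewrite prednK // (leq_ltn_trans _ (ltn_ord j)).
under eq_bigr => v _ do
  (under eq_bigr => J _ do rewrite fj ffunE;
   rewrite (J_sum (fun u => (update x v (x u) == y)%:R))).
rewrite -mulr_sumr {2}rS !natrX !exprS expr0 mulr1.
have nr0 : N%:R ^+ r.-1 != 0 :> R by rewrite expf_neq0.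
by field; rewrite n0 nr0.
Qed.

Lemma bern_rule_dictator r (f : config r -> bool) (j : 'I_r) :
  (forall z, f z = z j) -> bern_rule f = id :> (R -> R).
Proof.
move=> fj; apply/funext => p; rewrite /bern_rule -[RHS](bern_mean_coord p j).
by apply: eq_bern_mean => y; rewrite fj.
Qed.

Definition deg_scale (N m : nat) : R := N%:R `^ ((m%:R - 1) / m%:R).

Lemma deg_scaleP N m : (0 < N)%N -> (2 <= m)%N ->
  [/\ 0 < deg_scale N m, deg_scale N m ^+ m = N%:R ^+ m.-1 &
      N%:R * deg_scale N m = N%:R `^ (2 - m%:R^-1)].
Proof.
move=> N0 m2; have n0 : 0 < N%:R :> R by rewrite ltr0n.
have m0 : (0 < m)%N by rewrite (leq_trans _ m2).
have mn0 : m%:R != 0 :> R by rewrite pnatr_eq0 -lt0n.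
split; first exact: powR_gt0.
  rewrite -powR_mulrn ?powR_ge0 // /deg_scale -powRrM divfK //.
  by rewrite -{1}(prednK m0) -natr1 addrK powR_mulrn // ler0n.
have -> : 2 - m%:R^-1 = 1 + (m%:R - 1) / m%:R :> R by field.
by rewrite powRD ?powRr1 ?(ltW n0) // (gt_eqF n0) implybT.
Qed.

Lemma deg_scale_lt N m : (2 <= N)%N -> (2 <= m)%N -> 1 <= deg_scale N m < N%:R.
Proof.
move=> N2 m2; have N0 : (0 < N)%N by rewrite (leq_trans _ N2).
have n1 : 1 < N%:R :> R by rewrite ltr1n.
have m0 : (0 < m)%N by rewrite (leq_trans _ m2).
have [s0 sE _] := deg_scaleP N0 m2; apply/andP; split.
  rewrite -(ler_pXn2r m0) ?nnegrE ?(ltW s0) // expr1n sE exprn_ege1 // ltW //.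
rewrite -(ltr_pXn2r m0) ?nnegrE ?(ltW s0) // sE ltr_eXn2l // prednK //.
Qed.

End Assembly.

Theorem theorem1 (R : realType) :
  (* the constants of regime (ii) are absolute *)
  exists cv Cv : R, [/\ 0 < cv, cv <= Cv &
  forall (r : nat) (f : config r -> bool),
    (1 <= r)%N -> monotone_rule f -> nonconstant_rule f ->
  [/\
    (* exactly one regime *)
    [/\ nondegenerate_rule f \/ dictatorial_rule f \/ degenerate_rule f,
        ~ (nondegenerate_rule f /\ dictatorial_rule f),
        ~ (nondegenerate_rule f /\ degenerate_rule f) &
        ~ (dictatorial_rule f /\ degenerate_rule f)],
    (* (i) *)
    nondegenerate_rule f ->
    [/\ exists c C : R, [/\ 0 < c, c < C &
          forall (N : nat) (d : measure_display) (Omega : measurableType d)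
                 (P : probability Omega R) (X : nat -> Omega -> config N)
                 (s : nat),
            markov_chain (rule_kernel R f) P X ->
            (1 <= s <= N - 1)%N -> (0 < P (starts_at X s))%E ->
            ((c * N%:R * (1 + ln (attr_dist f N s)%:R))%:E
               <= mean_consensus_time P X s
               <= (C * N%:R * (1 + ln (attr_dist f N s)%:R))%:E)%E],
        exists C : R, 0 < C /\
          forall (N : nat) (d : measure_display) (Omega : measurableType d)
                 (P : probability Omega R) (X : nat -> Omega -> config N),
            (2 <= N)%N -> markov_chain (rule_kernel R f) P X ->
            (\int[P]_w consensus_time R X w <= (C * (N%:R * ln N%:R))%:E)%E &
        forall eps : R, 0 < eps ->
        exists c C : R, [/\ 0 < c, c <= C &
          forall (N : nat) (d : measure_display) (Omega : measurableType d)
                 (P : probability Omega R) (X : nat -> Omega -> config N)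
                 (s : nat),
            markov_chain (rule_kernel R f) P X ->
            (1 <= s <= N - 1)%N -> (0 < P (starts_at X s))%E ->
            eps * N%:R <= (attr_dist f N s)%:R ->
            ((c * (N%:R * ln N%:R))%:E
               <= mean_consensus_time P X s
               <= (C * (N%:R * ln N%:R))%:E)%E]],
    (* (ii) *)
    (dictatorial_rule f <-> is_dictator f) /\
    (dictatorial_rule f ->
       (forall (N : nat) (x y : config N), (1 <= N)%N ->
          rule_kernel R f x y = voter_kernel R x y) /\
       (forall (N : nat) (d : measure_display) (Omega : measurableType d)
               (P : probability Omega R) (X : nat -> Omega -> config N)
               (s : nat),
          markov_chain (rule_kernel R f) P X ->
          (2 <= N)%N -> (1 <= s <= N - 1)%N -> (0 < P (starts_at X s))%E ->
          ((cv * (N%:R ^+ 2 * Ent (s%:R / N%:R)))%:E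
             <= mean_consensus_time P X s
             <= (Cv * (N%:R ^+ 2 * Ent (s%:R / N%:R)))%:E)%E)) &
    (* (iii) *)
    degenerate_rule f ->
    [/\ (2 <= m_index f)%N,
        exists c C : R, [/\ 0 < c, c <= C &
          forall (N : nat) (d : measure_display) (Omega : measurableType d)
                 (P : probability Omega R) (X : nat -> Omega -> config N),
            markov_chain (rule_kernel R f) P X -> (2 <= N)%N ->
            (forall s, (1 <= s <= N - 1)%N -> (0 < P (starts_at X s))%E) ->
            ((c * N%:R `^ (2 - (m_index f)%:R^-1))%:E
               <= \big[maxe/-oo]_(1 <= s < N) mean_consensus_time P X s
               <= (C * N%:R `^ (2 - (m_index f)%:R^-1))%:E)%E] &
        forall a b : R, 0 < a -> a <= b ->
        exists c : R, 0 < c /\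
          forall (N : nat) (d : measure_display) (Omega : measurableType d)
                 (P : probability Omega R) (X : nat -> Omega -> config N)
                 (s : nat),
            markov_chain (rule_kernel R f) P X ->
            (1 <= s <= N - 1)%N -> (0 < P (starts_at X s))%E ->
            a * N%:R `^ (((m_index f)%:R - 1) / (m_index f)%:R)
              <= (degenerate_dist f N s)%:R
              <= b * N%:R `^ (((m_index f)%:R - 1) / (m_index f)%:R) ->
            ((c * N%:R `^ (2 - (m_index f)%:R^-1))%:E
               <= mean_consensus_time P X s)%E]]].
Proof.
have ln2 : 2^-1 <= ln (2 : R).
  by apply: le_trans (@ln_lbound R 2 _) => //; lra.
have lnN N : (2 <= N)%N -> 2^-1 <= ln (N%:R : R).
  move=> N2; apply: le_trans ln2 _; rewrite ler_ln ?posrE ?ltr0n ?(leq_trans _ N2) //.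
  by rewrite ler_nat.
have inner N s : (1 <= s <= N - 1)%N -> (0 < s < N)%N.
  by move=> /andP[s0 sN]; rewrite s0; lia.
exists 2^-1, 6; split; [by []|by lra|].
move=> r f r0 mf cf; split.
- split.
  + case: (eqVneq (D0 f) 1%N) => [d0|/eqP d0].
      case: (posnP (D1 f)) => [d1|d1]; first by right; right; left.
      have [|j /dictator_degrees ?] := both_degrees_eq1 mf _ d1; first by rewrite d0.
      by right; left.
    case: (eqVneq (D1 f) 1%N) => [d1|/eqP d1]; last by left.
    case: (posnP (D0 f)) => [d0'|d0']; first by right; right; right.
    have [|j /dictator_degrees ?] := both_degrees_eq1 mf d0' _; first by rewrite d1.
    by right; left.
  + by move=> [[n0 _] [d0 _]].
  + by move=> [[n0 n1] [[d0 _]|[_ d1]]].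
  + by move=> [[d0 d1] [[_ d1']|[d0' _]]]; [rewrite d1' in d1|rewrite d0' in d0].
- move=> nd; have [[C C0 HC] [c c0 Hc]] := nondegenerate_time_bounds R r0 mf cf nd.
  have ln_dist N s : (0 < s < N)%N ->
      0 <= (ln (attr_dist f N s)%:R : R) <= ln N%:R.
    move=> sN; have /andP[a0 aN] := attr_dist_bounds f sN.
    rewrite ln_ge0 ?ler1n // ler_ln ?posrE ?ltr0n ?ler_nat //.
    by rewrite (leq_trans a0).
  have upN N s : (0 < s < N)%N ->
      C * (N%:R * (1 + ln (attr_dist f N s)%:R)) <= 3 * C * (N%:R * ln N%:R).
    move=> sN; have /andP[_ lN] := ln_dist _ _ sN.
    have l2 := lnN N ltac:(lia).
    have CN : 0 <= C * N%:R by rewrite mulr_ge0 // ltW.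
    have h : 1 + ln (attr_dist f N s)%:R <= 3 * ln (N%:R : R) by lra.
    have := ler_wpM2l CN h; lra.
  split.
  + exists c, (C + c); split=> //; first by rewrite ltrDr.
    move=> N d Omega P X s mc /inner sN Ps.
    have N0 : (0 < N)%N by lia.
    have /andP[l0 _] := ln_dist _ _ sN; rewrite -!mulrA; apply/andP; split.
      exact: (mean_time_lbound N0 mc (Hc N s sN)).
    apply: le_trans (mean_time_ubound N0 mc (HC N N0) sN Ps) _.
    by rewrite lee_fin ler_wpM2r ?mulr_ge0 ?lerDl ?(ltW c0) //; lra.
  + exists (3 * C); split; first by rewrite mulr_gt0.
    move=> N d Omega P X N2 mc; have N0 : (0 < N)%N by lia.
    apply: (total_time_ubound N0 mc (HC N N0)) => [|s sN]; last exact: upN.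
    by have := lnN N N2 => l2; rewrite !mulr_ge0 ?(ltW C0) //; lra.
  + move=> eps e0; pose L := `|ln eps|.
    have L0 : 0 <= L by apply: normr_ge0.
    exists (Num.min (c / (1 + L)) (3 * C)), (3 * C); split.
    * by rewrite lt_min; apply/andP; split; [apply: divr_gt0 => //; lra|lra].
    * by rewrite ge_min lexx orbT.
    move=> N d Omega P X s mc /inner sN Ps far.
    have N0 : (0 < N)%N by lia.
    have n0 : 0 < N%:R :> R by rewrite ltr0n.
    have l2 := lnN N ltac:(lia).
    apply/andP; split; last first.
      apply: le_trans (mean_time_ubound N0 mc (HC N N0) sN Ps) _.
      by rewrite lee_fin upN.
    apply: le_trans (mean_time_lbound N0 mc (Hc N s sN) sN Ps); rewrite lee_fin.
    have /andP[l0 _] := ln_dist _ _ sN; have /andP[a0 _] := attr_dist_bounds f sN.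
    have h : ln eps + ln N%:R <= ln (attr_dist f N s)%:R.
      by rewrite -lnM ?posrE // ler_ln ?posrE ?mulr_gt0 // ltr0n.
    have hL : - L <= ln eps by rewrite /L lerNl -normrN ler_norm.
    have Ll := mulr_ge0 L0 l0.
    have h2 : ln N%:R <= (1 + L) * (1 + ln (attr_dist f N s)%:R) :> R by lra.
    apply: (@le_trans _ _ (c / (1 + L) * (N%:R * ln N%:R))).
      by rewrite ler_wpM2r ?ge_min ?lexx // mulr_ge0 ?(ltW n0) //; lra.
    rewrite -mulrA ler_pM2l // mulrCA ler_pM2l // ler_pdivrMl //; lra.
- split.
    split=> [[d0 d1]|[j /dictator_degrees//]].
    by apply: (both_degrees_eq1 mf); rewrite ?d0 ?d1.
  move=> [d0 d1]; have [||j fj] := both_degrees_eq1 mf; rewrite ?d0 ?d1 //.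
  split=> [N x y N0|N d Omega P X s mc N2 /inner sN Ps].
    exact: dictator_kernel fj N0.
  have N0 : (0 < N)%N by lia.
  apply/andP; split.
    apply: (mean_time_lbound N0 mc _ sN Ps); rewrite (bern_rule_dictator R fj).
    exact: voter_time_lbound.
  have ub : time_ubound (bern_rule f) N (fun s => 6 * (N%:R ^+ 2 * Ent (s%:R / N%:R : R))).
    by rewrite (bern_rule_dictator R fj); apply: voter_time_ubound.
  exact: (mean_time_ubound N0 mc ub sN Ps).
move=> dg; have [m2 [C C0 HC] HL] := degenerate_time_bounds R r0 mf cf dg.
set m := m_index f in m2 HC HL *.
have low a b : 0 < a -> a <= b -> exists c : R, 0 < c /\
    forall N d (Omega : measurableType d) (P : probability Omega R)
      (X : nat -> Omega -> config N) s,
    markov_chain (rule_kernel R f) P X ->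
    (0 < s < N)%N -> (0 < P (starts_at X s))%E ->
    a * deg_scale R N m <= (degenerate_dist f N s)%:R <= b * deg_scale R N m ->
    ((c * N%:R `^ (2 - m%:R^-1))%:E <= mean_consensus_time P X s)%E.
  move=> a0 ab; have b0 : 0 < b by apply: lt_le_trans ab.
  have [c c0 Hc] := HL a b a0 b0; exists c; split=> //.
  move=> N d Omega P X s mc sN Ps dist; have N0 : (0 < N)%N by lia.
  have [sg0 sgE NsgE] := deg_scaleP R N0 m2.
  by apply: (mean_time_lbound N0 mc _ sN Ps); rewrite -NsgE; apply: Hc.
split=> //.
- have [c [c0 Hc]] := low 2^-1 1 ltac:(by []) ltac:(lra).
  exists (Num.min c C), C; split; [by rewrite lt_min c0|by rewrite ge_min lexx orbT|].
  move=> N d Omega P X mc N2 Ps.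
  have N0 : (0 < N)%N by lia.
  have [sg0 sgE NsgE] := deg_scaleP R N0 m2.
  have /andP[sg1 sgN] := deg_scale_lt R N2 m2.
  apply/andP; split; last first.
    rewrite big_nat; apply: bigmax_le => [|s sN]; first exact: leNye.
    have sN' : (1 <= s <= N - 1)%N by clear -sN; lia.
    apply: le_trans (mean_time_ubound N0 mc (HC N _ N0 sg0 sgE) sN (Ps _ sN')) _.
    by rewrite NsgE.
  (* The lower bound is attained at the integer part of the critical scale. *)
  have [s0 t0 t1] : exists2 s0 : nat, s0%:R <= deg_scale R N m &
      deg_scale R N m < s0%:R + 1.
    have /andP[t0 t1] := truncn_itv (ltW sg0).
    by exists (Num.truncn (deg_scale R N m)) => //; rewrite natr1.
  have s00 : (0 < s0)%N.
    by rewrite lt0n; apply/eqP => s0E; move: t1; rewrite s0E add0r ltNge sg1.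
  have s0N : (s0 < N)%N by rewrite -(ltr_nat R); apply: le_lt_trans t0 sgN.
  pose s1 := if D0 f == 1%N then s0 else (N - s0)%N.
  have s1N : (0 < s1 < N)%N by rewrite /s1; case: ifP => _; clear -s00 s0N; lia.
  have s1E : degenerate_dist f N s1 = s0.
    by rewrite /degenerate_dist /s1; case: (D0 f == 1%N) => //; rewrite subKn // ltnW.
  have s1N' : (1 <= s1 <= N - 1)%N by clear -s1N; lia.
  apply: (@bigmax_sup_seq _ _ _ _ _ s1) => //; first by rewrite mem_index_iota.
  apply: le_trans (Hc _ _ _ _ _ _ mc s1N (Ps _ s1N') _).
    by rewrite lee_fin ler_wpM2r ?powR_ge0 // ge_min lexx.
  rewrite s1E mul1r t0 andbT.
  have x1 : 1 <= s0%:R :> R by rewrite ler1n.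
  rewrite ler_pdivrMl //; apply: le_trans (ltW t1) _.
  by rewrite mulrDl mul1r lerD2l.
move=> a b a0 ab; have [c [c0 Hc]] := low a b a0 ab; exists c; split=> //.
move=> N d Omega P X s mc /inner sN Ps dist; exact: Hc.
Qed.
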